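(* Let $n\ge1$, $m>1$, let $\mathcal{Z}=\{z_i\}_{i=1}^m$ be distinct points of $\mathbb{B}^n$ and $\mathcal{W}=\{w_i\}_{i=1}^m\subset\mathbb{D}$, with the $w_i$ not all zero. Let $\psi_{\mathcal{Z},\mathcal{W}}=\sum_{j=1}^mc_jK_n(\cdot,z_j)$, where $(c_1,\dots,c_m)^{T}=[K_n(z_i,z_j)]_{m\times m}^{-1}(w_1,\dots,w_m)^{T}$, and define $$\mathcal{M}_{\mathcal{Q}_{\mathcal{Z}}}=\mathcal{Q}_{\mathcal{Z}}^{conj}\dot+[\mathcal{M}(\mathbb{S}^n)\dot+H^2_0(\mathbb{S}^n)],\qquad \widetilde{\mathcal{M}_{\mathcal{Q}_{\mathcal{Z}}}}=[\mathcal{Q}_{\mathcal{Z}}^{conj}\ominus\{\overline{\psi_{\mathcal{Z},\mathcal{W}}}\}]\dot+[\mathcal{M}(\mathbb{S}^n)\dot+H^2_0(\mathbb{S}^n)],$$ and $\Pi_{\mathcal{Z},\mathcal{W}}:(\mathcal{M}_{\mathcal{Q}_{\mathcal{Z}}},\|\cdot\|_1)\to\mathbb{C}$, $\Pi_{\mathcal{Z},\mathcal{W}}f=\int_{\mathbb{S}^n}\psi_{\mathcal{Z},\mathcal{W}}f\,d\sigma$. The following are equivalent: (1) $\mathcal{Z}$ and $\mathcal{W}$ solve the extremal problem. (2) $\|\Pi_{\mathcal{Z},\mathcal{W}}\|=1$. (3) $\operatorname{dist}_{L^1(\mathbb{S}^n)}\Big(\dfrac{\overline{\psi_{\mathcal{Z},\mathcal{W}}}}{\|\psi_{\mathcal{Z},\mathcal{W}}\|_2^2},\widetilde{\mathcal{M}_{\mathcal{Q}_{\mathcal{Z}}}}\Big)=1$.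 (4) $\operatorname{dist}_{L^1(\mathbb{S}^n)}\Big(\dfrac{1}{\sum_{i=1}^m|w_i|^2}\displaystyle\sum_{j=1}^m\overline{w_j}\,\overline{K_n(\cdot,z_j)},\widetilde{\mathcal{M}_{\mathcal{Q}_{\mathcal{Z}}}}\Big)=1$.
   Context: $\mathbb{B}^n$ is the open unit ball of $\mathbb{C}^n$, $\mathbb{D}=\mathbb{B}^1$, $\mathbb{S}^n=\partial\mathbb{B}^n$, $\sigma$ the normalized surface measure on $\mathbb{S}^n$. $H^\infty(\mathbb{B}^n)$: bounded analytic functions on $\mathbb{B}^n$ with sup norm; $\mathcal{S}(\mathbb{B}^n)$: its closed unit ball. $\mathcal{Z}$ and $\mathcal{W}$ solve the extremal problem if there exists $\varphi\in\mathcal{S}(\mathbb{B}^n)$ with $\varphi(z_i)=w_i$ for all $i$, and every such $\varphi\in\mathcal{S}(\mathbb{B}^n)$ satisfies $\|\varphi\|_\infty=1$. $H^2(\mathbb{S}^n)=\overline{\mathbb{C}[z_1,\dots,z_n]}^{L^2(\mathbb{S}^n)}$, identified via boundary values ($K$-limits, a.e. equal to radial limits) with the Hardy space $H^2(\mathbb{B}^n)$. $K_n(z,w)=(1-\langle z,w\rangle)^{-n}$ for $z,w\in\mathbb{B}^n$, with $\langle z,w\rangle=\sum_i z_i\overline{w_i}$, is the Szegő kernel; for distinct points the matrix $[K_n(z_i,z_j)]$ is invertible. $\mathcal{Q}_{\mathcal{Z}}=\operatorname{span}\{K_n(\cdot,z_j):j=1,\dots,m\}$. For $S\subseteq L^2(\mathbb{S}^n)$,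 $S^{conj}=\{\overline f:f\in S\}$. $\mathcal{M}(\mathbb{S}^n)=L^2(\mathbb{S}^n)\ominus[H^2(\mathbb{S}^n)+H^2(\mathbb{S}^n)^{conj}]$; $H^2_0(\mathbb{S}^n)=H^2(\mathbb{S}^n)\ominus\{1\}$. $\dot+$ is the algebraic direct sum, all spaces being viewed as subspaces of $L^1(\mathbb{S}^n)$, with norm $\|\cdot\|_1$ of $L^1(\mathbb{S}^n)$. $\mathcal{Q}_{\mathcal{Z}}^{conj}\ominus\{\overline{\psi_{\mathcal{Z},\mathcal{W}}}\}$ is the $L^2$-orthogonal complement of $\overline{\psi_{\mathcal{Z},\mathcal{W}}}$ in $\mathcal{Q}_{\mathcal{Z}}^{conj}$; $\|\cdot\|_2$ is the $L^2(\mathbb{S}^n)$ norm; $\operatorname{dist}_V(x,S)=\inf\{\|x-y\|_V:y\in S\}$. $\|\Pi_{\mathcal{Z},\mathcal{W}}\|$ is the norm as a linear functional on $(\mathcal{M}_{\mathcal{Q}_{\mathcal{Z}}},\|\cdot\|_1)$. *)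

(* Defs.v *)
(* C^n is the type of row vectors 'rV[R[i]]_n. *)
From HB Require Import structures.
From mathcomp Require Import all_boot all_order all_algebra.
From mathcomp Require Import complex.
From mathcomp Require Import all_classical all_reals all_analysis.

Set Implicit Arguments.
Unset Strict Implicit.
Unset Printing Implicit Defensive.

Import Order.TTheory GRing.Theory Num.Theory.
Import ComplexField.Normc.
Import numFieldNormedType.Exports.

Local Open Scope classical_set_scope.
Local Open Scope complex_scope.
Local Open Scope ring_scope.

(* The Borel sigma-algebra of R[i], transported from R * R; that of 'rV[R[i]]_n
   is generated by the coordinates, as the library does for n.-tuple T. *)
Section complex_measurable.
Context {R : realType}.

Definition ReIm (z : R[i]) : R * R := (complex.Re z, complex.Im z).

HB.instance Definition _ := isPointed.Build R[i] 0.

HB.instance Definition _ :=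
  Measurable.copy R[i] (g_sigma_algebra_preimageType ReIm).

Variable n : nat.

Let coord : 'I_n -> 'rV[R[i]]_n -> R[i] := fun i z => z 0 i.

Let rV_set0 : g_sigma_preimage coord set0.
Proof. exact: sigma_algebra0. Qed.

Let rV_setC A : g_sigma_preimage coord A -> g_sigma_preimage coord (~` A).
Proof. exact: sigma_algebraC. Qed.

Let rV_bigcup (F : _^nat) : (forall i, g_sigma_preimage coord (F i)) ->
  g_sigma_preimage coord (\bigcup_i (F i)).
Proof. exact: sigma_algebra_bigcup. Qed.

HB.instance Definition _ := @isMeasurable.Build (measure_tuple_display
  (preimage_display (@ReIm))) 'rV[R[i]]_n (g_sigma_preimage coord)
  rV_set0 rV_setC rV_bigcup.

End complex_measurable.

Section geometry.
Context {R : realType}.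

Definition hip n (z w : 'rV[R[i]]_n) : R[i] := \sum_i z 0 i * (w 0 i)^*.

Definition cnorm n (z : 'rV[R[i]]_n) : R :=
  Num.sqrt (\sum_i normc (z 0 i) ^+ 2).

Definition unit_ball n : set 'rV[R[i]]_n := [set z | cnorm z < 1].

Definition unit_sphere n : set 'rV[R[i]]_n := [set z | cnorm z = 1].

End geometry.
Arguments unit_ball R n : clear implicits.
Arguments unit_sphere R n : clear implicits.

Section surface_measure.
Context (R : realType).
Local Open Scope ereal_scope.

Definition lebesgueC : set R[i] -> \bar R :=
  pushforward (@lebesgue_measure R \x @lebesgue_measure R)
    (fun p : R * R => p.1 +i* p.2).

(* 2n-dimensional Lebesgue measure, with C^(n+1) = C x C^n. *)
Fixpoint lebesgueCn n : set 'rV[R[i]]_n -> \bar R :=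
  match n with
  | 0%N => \d_(0%R : 'rV[R[i]]_0)
  | k.+1 => pushforward (lebesgueC \x @lebesgueCn k)
      (fun p : R[i] * 'rV[R[i]]_k => row_mx p.1%:M p.2 : 'rV[R[i]]_(1 + k))
  end.

(* Normalized surface measure of the unit sphere: in polar coordinates,
   sigma(A) = vol {r x | x in A, 0 < r < 1} / vol (unit ball). It is a
   probability measure carried by the sphere as soon as 0 < n. *)
Definition sigma n (A : set 'rV[R[i]]_n) : \bar R :=
  (fine (lebesgueCn (unit_ball R n)))^-1%:E *
  lebesgueCn [set z | unit_ball R n z /\
                      A ((cnorm z)^-1%:C%C *: z)%R].

End surface_measure.
Arguments sigma R n A : clear implicits.

Section analytic.
Context {R : realType} (n : nat).
Local Notation Cn := 'rV[R[i]]_n.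

Definition monomial_term (c : {ffun 'I_n -> nat} -> R[i]) (h : Cn)
    (a : {ffun 'I_n -> nat}) : R[i] :=
  c a * \prod_i h 0 i ^+ a i.

(* Sum of c_a h^a over the multi-indices a in {0,...,N-1}^n. *)
Definition box_sum (c : {ffun 'I_n -> nat} -> R[i]) (N : nat) (h : Cn) : R[i] :=
  \sum_(a : {ffun 'I_n -> 'I_N}) monomial_term c h [ffun i => a i : nat].

(* f is the sum of an (absolutely) convergent power series around p. *)
Definition analytic_at (f : Cn -> R[i]) (p : Cn) : Prop :=
  exists (r : R) (c : {ffun 'I_n -> nat} -> R[i]), 0 < r /\
    forall h : Cn, cnorm h < r ->
      summable setT (fun a => (normc (monomial_term c h a))%:E) /\
      normc (f (p + h) - box_sum c N h) @[N --> \oo] --> (0 : R).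

Definition analytic_on_ball (f : Cn -> R[i]) : Prop :=
  forall p, unit_ball R n p -> analytic_at f p.

(* Elements of function spaces on the ball are represented by functions on
   C^n whose values outside the ball are irrelevant. *)
Definition Hinf_norm (f : Cn -> R[i]) : \bar R :=
  ereal_sup [set (normc (f z))%:E | z in unit_ball R n].

Definition Hinf : set (Cn -> R[i]) :=
  [set f | analytic_on_ball f /\ (Hinf_norm f < +oo)%E].

Definition schur_class : set (Cn -> R[i]) :=
  [set f | Hinf f /\ (Hinf_norm f <= 1)%E].

Definition solves_extremal_problem m (Z : 'I_m -> Cn) (W : 'I_m -> R[i]) :=
  (exists phi, schur_class phi /\ forall i, phi (Z i) = W i) /\
  (forall phi, schur_class phi -> (forall i, phi (Z i) = W i) ->
     Hinf_norm phi = 1%E).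

End analytic.

Section function_spaces.
Context {R : realType} (n : nat).
Local Notation Cn := 'rV[R[i]]_n.
Local Notation S := (unit_sphere R n).
Local Notation sigma := (sigma R n).

(* Functions on the sphere are represented by functions on C^n; only their
   restriction to the sphere matters, and a.e. equal functions are not
   identified. *)
Implicit Types (f g : Cn -> R[i]) (A B : set (Cn -> R[i])).

Definition sphere_integral f : R[i] :=
  fine (\int[sigma]_(x in S) (complex.Re (f x))%:E)%E +i*
  fine (\int[sigma]_(x in S) (complex.Im (f x))%:E)%E.

Definition L1norm f : \bar R := (\int[sigma]_(x in S) (normc (f x))%:E)%E.

Definition L2 : set (Cn -> R[i]) :=
  [set f | measurable_fun S f /\
           (\int[sigma]_(x in S) (normc (f x) ^+ 2)%:E < +oo)%E].

Definition L2norm f : R :=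
  Num.sqrt (fine (\int[sigma]_(x in S) (normc (f x) ^+ 2)%:E)%E).

Definition L2ip f g : R[i] := sphere_integral (fun x => f x * (g x)^*).

Definition conj_set A : set (Cn -> R[i]) := [set (fun x => (f x)^*) | f in A].

Definition add_set A B : set (Cn -> R[i]) :=
  [set (fun x => f x + g x) | f in A & g in B].

Definition ominus A B : set (Cn -> R[i]) :=
  [set f | A f /\ forall g, B g -> L2ip f g = 0].

(* The polynomials are exactly the functions box_sum c N. *)
Definition H2 : set (Cn -> R[i]) :=
  [set f | L2 f /\ forall e : R, 0 < e ->
     exists N c, L2norm (fun x => f x - box_sum c N x) < e].

Definition H20 : set (Cn -> R[i]) := ominus H2 [set (fun=> 1)].

Definition MS : set (Cn -> R[i]) := ominus L2 (add_set H2 (conj_set H2)).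

Definition distL1 f A : \bar R :=
  ereal_inf [set L1norm (fun x => f x - g x) | g in A].

Definition functional_norm A (F : (Cn -> R[i]) -> R[i]) : \bar R :=
  ereal_sup [set (normc (F f))%:E | f in [set f | A f /\ (L1norm f <= 1)%E]].

Definition szego (z w : Cn) : R[i] := (1 - hip z w) ^- n.

Variables (m : nat) (Z : 'I_m -> Cn) (W : 'I_m -> R[i]).

Definition QZ : set (Cn -> R[i]) :=
  [set f | exists c : 'I_m -> R[i], f = fun z => \sum_j c j * szego z (Z j)].

Definition psiZW : Cn -> R[i] :=
  let c := invmx (\matrix_(i, j) szego (Z i) (Z j)) *m \col_i W i in
  fun z => \sum_j c j 0 * szego z (Z j).

Definition psiZW_conj : Cn -> R[i] := fun z => (psiZW z)^*.

Definition MQ : set (Cn -> R[i]) := add_set (conj_set QZ) (add_set MS H20).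

Definition MQ_tilde : set (Cn -> R[i]) :=
  add_set (ominus (conj_set QZ) [set psiZW_conj]) (add_set MS H20).

Definition PiZW (f : Cn -> R[i]) : R[i] := sphere_integral (fun x => psiZW x * f x).

End function_spaces.

(* Main.v *)
(* Write K_z for the Szego kernel at z. For f in M_Q and g in the ball algebra,
   the integral of g f is a linear combination of the values g(Z_j) whose
   coefficients do not depend on g. Applied to polynomials approximating the
   dilates of an analytic phi with |phi| <= N and phi(Z_i) = W_i, this yields
   |Pi f| <= N |f|_1 on M_Q.

   Conversely, if |Pi f| <= N |f|_1 on M_Q, extend Pi by Hahn-Banach to L^2
   with the same bound, and let F be the extension: phi(z) = F(conj K_z) is
   analytic and phi(Z_i) = W_i. Moreover F(conj K_z) = F(P_z) for the
   Poisson-Szego kernel P_z = |K_z|^2 / K_z(z), a probability density, whence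
   |phi| <= N. Indeed P_z - conj K_z annihilates all polynomials and is a
   uniform limit of trigonometric polynomials; the latter have polynomial
   projections, so that P_z - conj K_z is approximated by elements of
   M + H^2_0, on which F = Pi = 0.

   Hence (1) and (2) both say that 1 is the least N with |Pi f| <= N |f|_1.
   The functions in (3) and (4) are elements of conj Q_Z on which Pi is 1, and
   M_Q tilde is the kernel of Pi, so each distance is
   the inverse of the norm of Pi.

   The reproducing property of K_z comes from the invariance of sigma under
   plane rotations, which are products of shears (z_i replaced by z_i + b z_j):
   differentiating the invariance gives integration by parts on the sphere. *)
Require Import Defs.
From HB Require Import structures.
From mathcomp Require Import all_boot all_order all_algebra.
From mathcomp Require Import complex.
From mathcomp Require Import all_classical all_reals all_analysis.
From mathcomp Require Import measurable_realfun ring lra zify.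
From mathcomp Require cyclic cyclotomic separable.

Set Implicit Arguments.
Unset Strict Implicit.
Unset Printing Implicit Defensive.

Import Order.TTheory GRing.Theory Num.Theory.
Import ComplexField.Normc.
Import numFieldNormedType.Exports.

Local Open Scope classical_set_scope.
Local Open Scope complex_scope.
Local Open Scope ring_scope.

(** * Norm and measurability on C *)

(** Analyticity is given by local power series alone, so interior facts rest on Cauchy estimates for
    polynomials: averaging over roots of unity bounds a coefficient, and functions are handled
    through truncations converging at a geometric rate. In this way the expansion at the center is
    shown to converge along every slice of the ball, which makes the dilates of phi uniform limits
    of polynomials; M_Q is tested against these polynomials instead of boundary values of phi.

    In the converse the extension lives on L^2 but is bounded in the L^1 norm, and phi is read off
    from its values on kernels. The obstacle is the bound on phi, since the conjugate kernel may
    have L^1 norm above 1. Passing to the Poisson-Szego kernel requires splitting a function into a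
    part in M, a part in H^2_0 and a conjugate analytic remainder. For trigonometric polynomials
    this is explicit, because multiplication by a conjugate coordinate followed by projection is a
    partial derivative up to a scalar on each degree. The remainder is small in L^2, hence in L^1,
    as sigma has mass 1. *)

Section complex_norm.
Context {R : realType}.
Implicit Types (x y z : R[i]) (a : R).

Lemma normr_complexE x : `|x| = (normc x)%:C. Proof. by []. Qed.

Lemma normc_ge0 x : 0 <= normc x.
Proof. by case: x => a b; exact: sqrtr_ge0. Qed.

Lemma sqr_normcE x : normc x ^+ 2 = complex.Re x ^+ 2 + complex.Im x ^+ 2.
Proof. by case: x => a b; rewrite /= sqr_sqrtr// addr_ge0// sqr_ge0. Qed.

Lemma normc_conj x : normc x^* = normc x.
Proof. by case: x => a b; rewrite /= sqrrN. Qed.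

Lemma normc_real a : normc a%:C = `|a|.
Proof. by rewrite /= expr0n addr0 sqrtr_sqr. Qed.

Lemma normcX x n : normc (x ^+ n) = normc x ^+ n.
Proof. by elim: n => [|n ih]; rewrite ?normc1// !exprS normcM ih. Qed.

Lemma normc_sub x y : normc (x - y) = normc (y - x).
Proof. by rewrite -normcN opprB. Qed.

Lemma le_normcB x y : normc (x - y) <= normc x + normc y.
Proof. by rewrite (le_trans (le_normcD _ _))// normcN. Qed.

Lemma ler_dist_normc x y : `|normc x - normc y| <= normc (x - y).
Proof.
rewrite ler_norml; apply/andP; split.
  rewrite lerNl opprB lerBlDr normc_sub.
  by rewrite (le_trans _ (le_normcD _ _))// subrK.
by rewrite lerBlDr (le_trans _ (le_normcD _ _))// subrK.
Qed.

Lemma normc_sum (I : Type) (r : seq I) (P : pred I) (F : I -> R[i]) :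
  normc (\sum_(i <- r | P i) F i) <= \sum_(i <- r | P i) normc (F i).
Proof.
elim/big_ind2 : _ => //; first by rewrite normc0.
by move=> x1 a y1 b h1 h2; rewrite (le_trans (le_normcD _ _))// lerD.
Qed.

Lemma normc_prod (I : Type) (r : seq I) (P : pred I) (F : I -> R[i]) :
  normc (\prod_(i <- r | P i) F i) = \prod_(i <- r | P i) normc (F i).
Proof. by elim/big_rec2 : _ => [|i a b _ <-]; rewrite ?normc1 ?normcM. Qed.

Lemma normc_eq0 x : (normc x == 0) = (x == 0).
Proof. by apply/eqP/eqP => [/eq0_normc//|->]; rewrite normc0. Qed.

Lemma normc_gt0 x : (0 < normc x) = (x != 0).
Proof. by rewrite lt_neqAle normc_ge0 andbT eq_sym normc_eq0. Qed.

Lemma Re_le_normc x : `|complex.Re x| <= normc x.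
Proof.
case: x => a b /=; rewrite -sqrtr_sqr ler_sqrt ?addr_ge0 ?sqr_ge0//.
by rewrite lerDl sqr_ge0.
Qed.

Lemma Im_le_normc x : `|complex.Im x| <= normc x.
Proof.
case: x => a b /=; rewrite -sqrtr_sqr ler_sqrt ?addr_ge0 ?sqr_ge0//.
by rewrite lerDr sqr_ge0.
Qed.

Lemma normc_le_ReIm x : normc x <= `|complex.Re x| + `|complex.Im x|.
Proof.
case: x => a b /=; rewrite -[leRHS]ger0_norm ?addr_ge0// -sqrtr_sqr.
rewrite ler_sqrt ?sqr_ge0// -(real_normK (num_real a)) -(real_normK (num_real b)) sqrrD.
by rewrite -addrA lerD2l lerDr pmulrn_lge0// mulr_ge0.
Qed.

Lemma mulc_conj x : x * x^* = (normc x ^+ 2)%:C.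
Proof. by rewrite -normCK normr_complexE -rmorphXn. Qed.

Lemma Re_add x y : complex.Re (x + y) = complex.Re x + complex.Re y.
Proof. by case: x y => [a b] [c d]. Qed.
Lemma Im_add x y : complex.Im (x + y) = complex.Im x + complex.Im y.
Proof. by case: x y => [a b] [c d]. Qed.
Lemma Re_mul x y : complex.Re (x * y) =
  complex.Re x * complex.Re y - complex.Im x * complex.Im y.
Proof. by case: x y => [a b] [c d]. Qed.
Lemma Im_mul x y : complex.Im (x * y) =
  complex.Re x * complex.Im y + complex.Im x * complex.Re y.
Proof. by case: x y => [a b] [c d]. Qed.

Lemma ReC_conj x : complex.Re x^* = complex.Re x.
Proof. by case: x. Qed.
Lemma ImC_conj x : complex.Im x^* = - complex.Im x.
Proof. by case: x. Qed.

Lemma complexEta x : x = complex.Re x +i* complex.Im x.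
Proof. by case: x. Qed.

End complex_norm.

Section measurability.
Context {R : realType} d (T : measurableType d).
Implicit Types (D : set T) (f g : T -> R[i]).

Lemma measurable_ReIm : measurable_fun [set: R[i]] (@ReIm R).
Proof. by move=> _ B mB; exists B. Qed.

Lemma measurable_Re : measurable_fun [set: R[i]] (@complex.Re R).
Proof. exact: (measurableT_comp measurable_fst measurable_ReIm). Qed.

Lemma measurable_Im : measurable_fun [set: R[i]] (@complex.Im R).
Proof. exact: (measurableT_comp measurable_snd measurable_ReIm). Qed.

Lemma measurable_fun_complexT f :
  measurable_fun setT (fun x => complex.Re (f x)) -> measurable_fun setT (fun x => complex.Im (f x)) ->
  measurable_fun setT f.
Proof.
move=> mr mi _ B [C mC <-].
rewrite !setTI -[X in measurable X]setTI.
exact: (measurable_fun_pair mr mi).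
Qed.

Lemma measurable_fun_complex D f : measurable D ->
  measurable_fun D (fun x => complex.Re (f x)) -> measurable_fun D (fun x => complex.Im (f x)) ->
  measurable_fun D f.
Proof.
move=> mD mr mi; rewrite -(setIid D).
pose g : T -> R[i] := fun x => if x \in D then f x else 0.
have -> : D `&` D = D by rewrite setIid.
apply: (@eq_measurable_fun _ _ _ _ _ g) => [x xD|]; first by rewrite /g xD.
apply: measurable_funTS; apply: measurable_fun_complexT.
  rewrite (_ : (fun _ => _) = (fun x => complex.Re (f x)) \_ D).
    exact/(measurable_restrictT _ mD).
  by apply/funext => x; rewrite patchE /g /=; case: ifP.
rewrite (_ : (fun _ => _) = (fun x => complex.Im (f x)) \_ D).
  exact/(measurable_restrictT _ mD).
by apply/funext => x; rewrite patchE /g /=; case: ifP.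
Qed.

Section ops.
Variable D : set T.
Hypothesis mD : measurable D.

Lemma measurable_funRe f : measurable_fun D f -> measurable_fun D (fun x => complex.Re (f x)).
Proof. exact: (measurableT_comp measurable_Re). Qed.

Lemma measurable_funIm f : measurable_fun D f -> measurable_fun D (fun x => complex.Im (f x)).
Proof. exact: (measurableT_comp measurable_Im). Qed.

Lemma measurable_funcD f g : measurable_fun D f -> measurable_fun D g ->
  measurable_fun D (fun x => f x + g x).
Proof.
move=> mf mg; apply: measurable_fun_complex => //.
  rewrite (_ : (fun _ => _) = fun x => complex.Re (f x) + complex.Re (g x)).
    by apply: measurable_funD; exact: measurable_funRe.
  by apply/funext => x /=; rewrite Re_add.
rewrite (_ : (fun _ => _) = fun x => complex.Im (f x) + complex.Im (g x)).
  by apply: measurable_funD; exact: measurable_funIm.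
by apply/funext => x /=; rewrite Im_add.
Qed.

Lemma measurable_funcM f g : measurable_fun D f -> measurable_fun D g ->
  measurable_fun D (fun x => f x * g x).
Proof.
move=> mf mg; apply: measurable_fun_complex => //.
  rewrite (_ : (fun _ => _) = fun x => complex.Re (f x) * complex.Re (g x)
     - complex.Im (f x) * complex.Im (g x)).
    by apply: measurable_funB; apply: measurable_funM;
      (exact: measurable_funRe || exact: measurable_funIm).
  by apply/funext => x /=; rewrite Re_mul.
rewrite (_ : (fun _ => _) = fun x => complex.Re (f x) * complex.Im (g x)
     + complex.Im (f x) * complex.Re (g x)).
  by apply: measurable_funD; apply: measurable_funM;
      (exact: measurable_funRe || exact: measurable_funIm).
by apply/funext => x /=; rewrite Im_mul.
Qed.

Lemma measurable_fun_conj f : measurable_fun D f ->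
  measurable_fun D (fun x => (f x)^*).
Proof.
move=> mf; apply: measurable_fun_complex => //.
  rewrite (_ : (fun _ => _) = fun x => complex.Re (f x)); first exact: measurable_funRe.
  by apply/funext => x /=; case: (f x).
rewrite (_ : (fun _ => _) = fun x => - complex.Im (f x)).
  by apply: measurable_funN; exact: measurable_funIm.
by apply/funext => x /=; case: (f x).
Qed.

Lemma measurable_fun_normc f : measurable_fun D f ->
  measurable_fun D (fun x => normc (f x)).
Proof.
move=> mf; rewrite (_ : (fun _ => _) = fun x => Num.sqrt
   (complex.Re (f x) ^+ 2 + complex.Im (f x) ^+ 2)); last first.
  by apply/funext => x; rewrite -sqr_normcE sqrtr_sqr ger0_norm// normc_ge0.
apply: measurableT_comp.
  by apply: continuous_measurable_fun; exact: sqrt_continuous.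
by apply: measurable_funD; apply: measurable_funX;
 [exact: measurable_funRe|exact: measurable_funIm].
Qed.

Lemma measurable_fun_realc (f : T -> R) : measurable_fun D f ->
  measurable_fun D (fun x => (f x)%:C).
Proof. by move=> mf; apply: measurable_fun_complex => //; exact: measurable_cst. Qed.

(** The inverse is the conjugate divided by |f|^2, also where f vanishes because 0^-1 = 0; the real
    inverse is the power -1, known to be measurable. *)
Lemma measurable_funcV f : measurable_fun D f ->
  measurable_fun D (fun x => (f x)^-1).
Proof.
move=> mf; rewrite (_ : (fun _ => _) = fun x => ((normc (f x) ^+ 2)^-1)%:C * (f x)^*).
  apply: measurable_funcM; last exact: measurable_fun_conj.
  apply: measurable_fun_realc.
  rewrite (_ : (fun _ => _) = fun x => (normc (f x) ^+ 2) `^ (-1)).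
    apply: (@measurableT_comp _ _ _ _ _ _ (fun y : R => y `^ (-1))) => /=.
      exact: measurable_powR.
    by apply: measurable_funX; exact: measurable_fun_normc.
  by apply/funext => x; rewrite powR_inv1// sqr_ge0.
apply/funext => x; have [->|fx0] := eqVneq (f x) 0.
  by rewrite invr0 conjC0 mulr0.
apply: (mulfI fx0); rewrite mulfV// mulrCA mulc_conj -rmorphM /= mulVf//.
by rewrite sqrf_eq0 normc_eq0.
Qed.

Lemma measurable_funcX f n : measurable_fun D f ->
  measurable_fun D (fun x => f x ^+ n).
Proof.
move=> mf; elim: n => [|n ih]; first exact: measurable_cst.
rewrite (_ : (fun _ => _) = fun x => f x * f x ^+ n); first exact: measurable_funcM.
by apply/funext => x; rewrite exprS.
Qed.

End ops.

End measurability.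

Section measurability_rV.
Context {R : realType} (n : nat).
Local Notation Cn := 'rV[R[i]]_n.

Lemma measurable_coord (i : 'I_n) : measurable_fun [set: Cn] (fun z : Cn => z 0 i).
Proof.
move=> _ Y mY; rewrite setTI; apply: sub_sigma_algebra => /=.
rewrite -bigcup_seq/=; exists i => /=; first by rewrite mem_index_enum.
by exists Y => //; rewrite setTI.
Qed.

Lemma measurable_fun_rV d (T : measurableType d) (f : T -> Cn) :
  (forall i, measurable_fun setT (fun x => f x 0 i)) -> measurable_fun setT f.
Proof.
move=> mf; move=> _.
have subs : <<s \big[setU/set0]_(i < n)
    preimage_set_system setT (fun z : Cn => z 0 i) measurable >> `<=`
    [set A | measurable (f @^-1` A)].
  apply: smallest_sub.
    split => /=.
    - by rewrite preimage_set0; exact: measurable0.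
    - by move=> A mA; rewrite setTD preimage_setC; exact: measurableC.
    - by move=> F mF; rewrite preimage_bigcup; exact: bigcup_measurable.
  rewrite -bigcup_seq/=; apply: bigcup_sub => i _ A [B mB <-] /=.
  rewrite setTI -comp_preimage -[X in measurable X]setTI.
  exact: (mf i).
by move=> Y mY; rewrite setTI; exact: subs.
Qed.

Lemma measurable_cnorm : measurable_fun [set: Cn] (@cnorm R n).
Proof.
apply: measurableT_comp.
  by apply: continuous_measurable_fun; exact: sqrt_continuous.
apply: measurable_sum => i; apply: measurable_funX.
by apply: measurable_fun_normc => //; exact: measurable_coord.
Qed.

Lemma measurable_unit_ball : measurable (unit_ball R n).
Proof.
rewrite (_ : unit_ball R n = @cnorm R n @^-1` [set x | x < 1]) ?set_itvE//.
rewrite -[X in measurable X]setTI; apply: measurable_cnorm => //.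
by rewrite -set_itvE.
Qed.

Lemma measurable_unit_sphere : measurable (unit_sphere R n).
Proof.
rewrite (_ : unit_sphere R n = @cnorm R n @^-1` [set 1]) ?set_itvE//.
by rewrite -[X in measurable X]setTI; apply: measurable_cnorm.
Qed.

End measurability_rV.

(** * Measure-preserving shears of C^n *)

Section sigma_finite_measure_of.
Local Open Scope ereal_scope.
Context {R : realType} d (T : measurableType d) (m : set T -> \bar R).
Variables (m0 : m set0 = 0) (mge0 : forall A, 0 <= m A)
  (msa : semi_sigma_additive m) (mfin : sigma_finite setT m).

(** An alias whose arguments are the proofs, so that the measure structures below can be attached to
    an arbitrary set function. *)
Definition set_function_of (_ : m set0 = 0) (_ : forall A, 0 <= m A)
  (_ : semi_sigma_additive m) (_ : sigma_finite setT m) := m.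

Local Notation mm := (set_function_of m0 mge0 msa mfin).

HB.instance Definition _ := isMeasure.Build _ _ _ mm m0 mge0 msa.
HB.instance Definition _ := Measure_isSigmaFinite.Build _ _ _ mm mfin.

Definition sigma_finite_measure_of : {sigma_finite_measure set T -> \bar R} :=
  mm.

End sigma_finite_measure_of.

Section preserving.
Local Open Scope ereal_scope.

Definition preserving {R : realType} d (T : measurableType d)
    (mu : set T -> \bar R) (f : T -> T) :=
  measurable_fun setT f /\ forall A, measurable A -> mu (f @^-1` A) = mu A.

Lemma preserving_comp {R : realType} d (T : measurableType d)
    (mu : set T -> \bar R) (f g : T -> T) :
  preserving mu f -> preserving mu g -> preserving mu (f \o g).
Proof.
move=> [mf pf] [mg pg]; split; first exact: measurableT_comp.
by move=> A mA; rewrite comp_preimage pg ?pf// -[X in measurable X]setTI; exact: mf.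
Qed.

(** The left inverse [g] transports an exhaustion by sets of finite measure. Pairing the measure
    with an equation lets the recursive construction on C^n stay sigma-finite while remaining equal
    to the pushforward that defines the volume. *)
Definition sfin_pushforward_spec {R : realType} d1 d2 (T1 : measurableType d1)
    (T2 : measurableType d2) (mu : {sigma_finite_measure set T1 -> \bar R})
    (f : T1 -> T2) (g : T2 -> T1) (mf : measurable_fun setT f)
    (mg : measurable_fun setT g) (fK : cancel f g) :
  {nu : {sigma_finite_measure set T2 -> \bar R} |
    (nu : set T2 -> \bar R) = pushforward mu f}.
Proof.
pose m := pushforward mu f.
have m0 : m set0 = 0 by rewrite /m /pushforward preimage_set0 measure0.
have mge0 A : 0 <= m A by exact: measure_ge0.
have msa : semi_sigma_additive m.
  move=> F mF tF mUF; rewrite /m /pushforward preimage_bigcup.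
  apply: measure_semi_sigma_additive.
  - by move=> n; rewrite -[X in measurable X]setTI; exact: mf.
  - apply/trivIsetP => /= i j _ _ ij; rewrite -preimage_setI.
    by move/trivIsetP : tF => /(_ _ _ _ _ ij) ->//; rewrite preimage_set0.
  - by rewrite -preimage_bigcup -[X in measurable X]setTI; exact: mf.
have mfin : sigma_finite setT m.
  have /sigma_finiteP[F [TF ndF Foo]] := sigma_finiteT mu.
  exists (fun n => g @^-1` (F n)).
    by rewrite -preimage_bigcup -TF preimage_setT.
  move=> n; have [mFn Fnoo] := Foo n; split.
    by rewrite -[X in measurable X]setTI; exact: mg.
  rewrite /m /pushforward -comp_preimage (_ : g \o f = id) ?preimage_id//.
  by apply/funext => x /=; rewrite fK.
by exists (sigma_finite_measure_of m0 mge0 msa mfin).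
Defined.

End preserving.

Section skew_product.
Local Open Scope ereal_scope.
Context {R : realType} d1 d2 (T1 : measurableType d1) (T2 : measurableType d2).
Variable m1 : {sigma_finite_measure set T1 -> \bar R}.
Variable m2 : {sigma_finite_measure set T2 -> \bar R}.

Lemma product_measure1_sigma_finite : sigma_finite setT (m1 \x m2).
Proof.
have /sigma_finiteP[F [TF ndF Foo]] := sigma_finiteT m1.
have /sigma_finiteP[G [TG ndG Goo]] := sigma_finiteT m2.
exists (fun n => F n `*` G n).
  rewrite -setXTT TF TG predeqE => -[x y]; split.
    move=> [/= [n _ Fnx] [k _ Gky]]; exists (maxn n k) => //; split.
    - by move: x Fnx; exact/subsetPset/ndF/leq_maxl.
    - by move: y Gky; exact/subsetPset/ndG/leq_maxr.
  by move=> [n _ []/= ? ?]; split; exists n.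
move=> k; have [? ?] := Foo k; have [? ?] := Goo k.
split; first exact: measurableX.
by rewrite product_measure1E// lte_mul_pinfty// ge0_fin_numE.
Qed.

Definition product_sigma_finite : {sigma_finite_measure set (T1 * T2)%type -> \bar R} :=
  sigma_finite_measure_of (measure0 (m1 \x m2)) (measure_ge0 (m1 \x m2))
    (@measure_semi_sigma_additive _ _ _ (m1 \x m2)) product_measure1_sigma_finite.

Lemma product_measure12E X : measurable X -> (m1 \x m2) X = (m1 \x^ m2) X.
Proof.
by move=> mX; apply: product_measure_unique => //= *; rewrite product_measure2E.
Qed.

Lemma preserving_rect (f : T1 * T2 -> T1 * T2) : measurable_fun setT f ->
  (forall A B, measurable A -> measurable B ->
    (m1 \x m2) (f @^-1` (A `*` B)) = m1 A * m2 B) ->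
  preserving (m1 \x m2) f.
Proof.
move=> mf fE; split=> // A mA; apply/esym.
pose nu := measure_function_pushforward__canonical__measure_function_Measure
  (m1 \x m2) mf.
exact: (product_measure_unique (m' := nu)).
Qed.

(** Cavalieri's principle: by [preserving_rect] rectangles suffice, and each slice of the preimage
    of a rectangle is empty or has the measure of the first side. *)
Lemma preserving_skew1 (t : T1 * T2 -> T1) : measurable_fun setT t ->
  (forall y, preserving m1 (fun x => t (x, y))) ->
  preserving (m1 \x m2) (fun p => (t p, p.2)).
Proof.
move=> mt pt.
have mf : measurable_fun setT (fun p => (t p, p.2)).
  by apply: measurable_fun_pair => //; exact: measurable_snd.
apply: preserving_rect => // A B mA mB.
(* The slices of the preimage lie in the first variable, so that variable has to be integrated
   first. *)
rewrite product_measure12E; last first.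
  by rewrite -[X in measurable X]setTI; apply: mf => //; exact: measurableX.
rewrite /product_measure2.
rewrite (eq_integral (fun y => (m1 A) * (\1_B y)%:E)); last first.
  move=> y _ /=; rewrite indicE; have [yB|yB] := boolP (y \in B).
    rewrite mule1 -((pt y).2 _ mA); congr (m1 _); apply/seteqP; split => x /=.
      by rewrite ysectionE /= => -[].
    by rewrite ysectionE /=; split => //; exact: set_mem.
  rewrite mule0 (_ : ysection _ _ = set0) ?measure0//.
  apply/seteqP; split => x //=; rewrite ysectionE /= => -[_] /mem_set.
  by rewrite (negbTE yB).
by rewrite ge0_integralZl ?integral_indic ?setIT//; exact: measurableT_comp.
Qed.

Lemma preserving_skew2 (t : T1 * T2 -> T2) : measurable_fun setT t ->
  (forall x, preserving m2 (fun y => t (x, y))) ->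
  preserving (m1 \x m2) (fun p => (p.1, t p)).
Proof.
move=> mt pt.
have mf : measurable_fun setT (fun p => (p.1, t p)).
  by apply: measurable_fun_pair => //; exact: measurable_fst.
apply: preserving_rect => // A B mA mB.
rewrite /product_measure1.
rewrite (eq_integral (fun x => (\1_A x)%:E * (m2 B))); last first.
  move=> x _ /=; rewrite indicE; have [xA|xA] := boolP (x \in A).
    rewrite mul1e -((pt x).2 _ mB); congr (m2 _); apply/seteqP; split => y /=.
      by rewrite xsectionE /= => -[].
    by rewrite xsectionE /=; split => //; exact: set_mem.
  rewrite mul0e (_ : xsection _ _ = set0) ?measure0//.
  apply/seteqP; split => y //=; rewrite xsectionE /= => -[+ _] => /mem_set.
  by rewrite (negbTE xA).
by rewrite ge0_integralZr ?integral_indic ?setIT//; exact: measurableT_comp.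
Qed.

End skew_product.

Section lebesgue_line.
Context {R : realType}.

Local Notation mu := (@lebesgue_measure R).
Local Notation RR := (measurableTypeR R * measurableTypeR R)%type.

Lemma preserving_translation (a : R) :
  preserving mu ((fun x => x + a) : measurableTypeR R -> measurableTypeR R).
Proof.
have mf : measurable_fun setT
    ((fun x => x + a) : measurableTypeR R -> measurableTypeR R).
  by apply: measurable_funD => //; exact: measurable_cst.
split=> // A mA.
rewrite -[LHS]/(pushforward mu
  ((fun x => x + a) : measurableTypeR R -> measurableTypeR R) A).
apply/esym/lebesgue_measure_unique => //= _ [[b c]] _ <-.
rewrite /pushforward (_ : _ @^-1` _ = `]b - a, c - a]%classic); last first.
  by apply/seteqP; split => x /=; rewrite !in_itv/= ltrBlDr lerBrDr.
rewrite !lebesgue_measure_itv/= !lte_fin ltrD2r.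
by case: ifPn => // _; congr (_%:E); rewrite opprB addrA subrK.
Qed.

Definition plane_measure : {sigma_finite_measure set RR -> \bar R} :=
  product_sigma_finite mu mu.

Lemma preserving_plane_translation (a b : R) :
  preserving plane_measure (fun p : RR => (p.1 + a, p.2 + b)).
Proof.
have -> : (fun p : R * R => (p.1 + a, p.2 + b)) =
  (fun p : R * R => (p.1 + a, p.2)) \o (fun p : R * R => (p.1, p.2 + b)) by [].
apply: preserving_comp.
  apply: (@preserving_skew1 _ _ _ _ _ mu mu (fun p : RR => p.1 + a)).
    by apply: measurable_funD => //; exact: measurable_cst.
  by move=> y; exact: preserving_translation.
apply: (@preserving_skew2 _ _ _ _ _ mu mu (fun p : RR => p.2 + b)).
  by apply: measurable_funD => //; exact: measurable_cst.
by move=> y; exact: preserving_translation.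
Qed.

Lemma preserving_shear1 (t : R) :
  preserving plane_measure (fun p : RR => (p.1 + t * p.2, p.2)).
Proof.
apply: (@preserving_skew1 _ _ _ _ _ mu mu (fun p : RR => p.1 + t * p.2)).
  by apply: measurable_funD => //; apply: measurable_funM.
by move=> y; exact: (preserving_translation (t * y)).
Qed.

Lemma preserving_shear2 (t : R) :
  preserving plane_measure (fun p : RR => (p.1, p.2 + t * p.1)).
Proof.
apply: (@preserving_skew2 _ _ _ _ _ mu mu (fun p : RR => p.2 + t * p.1)).
  by apply: measurable_funD => //; apply: measurable_funM.
by move=> y; exact: (preserving_translation (t * y)).
Qed.

(* A rotation of angle other than pi is a product of three shears. *)
Lemma preserving_rotation (c s : R) : c ^+ 2 + s ^+ 2 = 1 -> c != -1 ->
  preserving plane_measure (fun p : RR => (c * p.1 - s * p.2, s * p.1 + c * p.2)).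
Proof.
move=> cs1 cN1; have c1 : 1 + c != 0 by rewrite addrC addr_eq0.
(* For c = cos a and s = sin a this is -tan(a/2); the excluded angle pi is the zero of the
   denominator. *)
pose t := - (s / (1 + c)).
have -> : (fun p : R * R => (c * p.1 - s * p.2, s * p.1 + c * p.2)) =
  (fun p : R * R => (p.1 + t * p.2, p.2)) \o
  (fun p : R * R => (p.1, p.2 + s * p.1)) \o
  (fun p : R * R => (p.1 + t * p.2, p.2)).
  have ts : t * s = c - 1.
    apply: (mulIf c1); rewrite /t mulNr mulrAC mulNr divfK//.
    by rewrite (_ : - _ = c ^+ 2 - 1); [ring|rewrite -cs1; ring].
  have tc : t * (1 + c) = - s by rewrite /t mulNr divfK.
  apply/funext => -[x y] /=; congr pair.
    transitivity (x * (1 + t * s) + (t * (1 + (t * s + 1))) * y); last by ring.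
    by rewrite ts subrK (addrC 1) subrK tc; ring.
  by transitivity (s * x + (1 + t * s) * y); [rewrite ts; ring|ring].
apply: preserving_comp; first apply: preserving_comp.
- exact: preserving_shear1.
- exact: preserving_shear2.
- exact: preserving_shear1.
Qed.

End lebesgue_line.

Section lebesgue_complex.
Context {R : realType}.

Definition toC (p : R * R) : R[i] := p.1 +i* p.2.

Lemma measurable_toC : measurable_fun setT toC.
Proof.
by apply: measurable_fun_complexT; [exact: measurable_fst|exact: measurable_snd].
Qed.

Lemma toCK : cancel toC (@ReIm R). Proof. by case. Qed.
Lemma ReImK : cancel (@ReIm R) toC. Proof. by case. Qed.

Definition lebC : {sigma_finite_measure set R[i] -> \bar R} :=
  sval (sfin_pushforward_spec plane_measure measurable_toC measurable_ReIm toCK).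

Lemma lebCE : (lebC : set R[i] -> \bar R) = @lebesgueC R.
Proof. by rewrite /lebC; case: sfin_pushforward_spec => nu /= ->. Qed.

Lemma lebCP A : lebC A = plane_measure (toC @^-1` A).
Proof. by rewrite lebCE. Qed.

Lemma preserving_lebC (f : R[i] -> R[i]) :
  preserving plane_measure (@ReIm R \o f \o toC) -> preserving lebC f.
Proof.
move=> [mf pf]; split.
  rewrite (_ : f = toC \o (@ReIm R \o f \o toC) \o @ReIm R); last first.
    by apply/funext => x /=; rewrite !ReImK.
  apply: measurableT_comp; last exact: measurable_ReIm.
  by apply: measurableT_comp => //; exact: measurable_toC.
move=> A mA; rewrite !lebCP -[RHS]pf; last first.
  by rewrite -[X in measurable X]setTI; apply: measurable_toC.
by congr (plane_measure _); apply/seteqP; split => x /=; rewrite ReImK.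
Qed.

Lemma preserving_translationC (a : R[i]) : preserving lebC (fun x => x + a).
Proof.
apply: preserving_lebC.
rewrite (_ : _ \o _ = fun p : R * R => (p.1 + complex.Re a, p.2 + complex.Im a)).
  exact: preserving_plane_translation.
by apply/funext => -[x y] /=; case: a.
Qed.

Lemma preserving_rotationC (u : R[i]) : normc u = 1 -> u != -1 ->
  preserving lebC (fun x => u * x).
Proof.
case: u => c s u1 uN1; apply: preserving_lebC.
have cs1 : c ^+ 2 + s ^+ 2 = 1 by rewrite -[LHS](sqr_normcE (c +i* s)) u1 expr1n.
rewrite (_ : _ \o _ = fun p : R * R => (c * p.1 - s * p.2, s * p.1 + c * p.2)).
  apply: preserving_rotation => //; apply: contra uN1 => /eqP cN1.
  have : s ^+ 2 = 0 by move: cs1; rewrite cN1 sqrrN expr1n => ?; lra.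
  by move/eqP; rewrite sqrf_eq0 => /eqP ->; rewrite cN1 eq_complex /= oppr0 !eqxx.
by apply/funext => -[x y] /=; rewrite /ReIm /= (addrC (s * x)) (addrC (c * y)).
Qed.

Lemma lebC_set0 : lebC [set 0] = 0%E.
Proof.
rewrite lebCP (_ : _ @^-1` _ = [set 0] `*` [set 0]).
  transitivity (@lebesgue_measure R [set 0%R] * @lebesgue_measure R [set 0%R])%E.
    exact: product_measure1E.
  by rewrite lebesgue_measure_set1 mul0e.
by apply/seteqP; split => -[x y] /=; [move=> [-> ->]|move=> [-> ->]].
Qed.

(** Boxes have computable volume: one contains the unit ball and a smaller one lies inside it, so
    the ball has finite positive volume. *)
Definition boxC (e : R) : set R[i] :=
  [set z | `|complex.Re z| < e /\ `|complex.Im z| < e].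

Lemma measurable_boxC e : measurable (boxC e).
Proof.
rewrite (_ : boxC e = @ReIm R @^-1` (ball 0 e `*` ball 0 e)).
  rewrite -[X in measurable X]setTI; apply: measurable_ReIm => //.
  by apply: measurableX; exact: measurable_ball.
by apply/seteqP; split => -[x y] /=; rewrite /boxC /ball /= !sub0r !normrN.
Qed.

Lemma lebC_box (e : R) : 0 <= e -> lebC (boxC e) = (4 * e ^+ 2)%:E.
Proof.
move=> e0; rewrite lebCP (_ : _ @^-1` _ = ball 0 e `*` ball 0 e).
  transitivity (@lebesgue_measure R (ball 0%R e) * @lebesgue_measure R (ball 0%R e))%E.
    by apply: product_measure1E; exact: measurable_ball.
  by rewrite lebesgue_measure_ball// -EFinM; congr (_%:E); ring.
by apply/seteqP; split => -[x y] /=; rewrite /boxC /ball /= !sub0r !normrN.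
Qed.

End lebesgue_complex.

(** * Lebesgue measure on C^n, one coordinate at a time *)

Section lebesgue_Cn.
Context {R : realType}.

Definition consC n (p : R[i] * 'rV[R[i]]_n) : 'rV[R[i]]_(n.+1) :=
  row_mx p.1%:M p.2 : 'rV[R[i]]_(1 + n).

Definition unconsC n (z : 'rV[R[i]]_(n.+1)) : R[i] * 'rV[R[i]]_n :=
  (z 0 ord0, \row_i z 0 (lift ord0 i)).

Lemma consC0 n p : @consC n p 0 ord0 = p.1.
Proof. by rewrite /consC mxE; case: splitP => //= j _; rewrite ord1 mxE eqxx. Qed.

Lemma consCS n p i : @consC n p 0 (lift ord0 i) = p.2 0 i.
Proof. by rewrite /consC -rshift1 (@row_mxEr _ 1 1 n). Qed.

Lemma consCK n : cancel (@consC n) (@unconsC n).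
Proof.
move=> [x y]; rewrite /unconsC consC0; congr pair; apply/rowP => i.
by rewrite mxE consCS.
Qed.

Lemma unconsCK n : cancel (@unconsC n) (@consC n).
Proof.
move=> z; apply/rowP => i; case: (unliftP ord0 i) => [j|] ->.
  by rewrite consCS mxE.
by rewrite consC0.
Qed.

Lemma measurable_consC n : measurable_fun setT (@consC n).
Proof.
apply: measurable_fun_rV => i; case: (unliftP ord0 i) => [j|] ->.
  under eq_fun do rewrite consCS.
  apply: (@measurableT_comp _ _ _ _ _ _ (fun z : 'rV[R[i]]_n => z 0 j)) => //.
  exact: measurable_coord.
rewrite (_ : (fun _ => _) = fst); first exact: measurable_fst.
by apply/funext => p; rewrite consC0.
Qed.

Lemma measurable_unconsC n : measurable_fun setT (@unconsC n).
Proof.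
apply: measurable_fun_pair; first exact: measurable_coord.
apply: measurable_fun_rV => i; under eq_fun do rewrite mxE.
exact: measurable_coord.
Qed.

Lemma dirac_sigma_finite d (T : measurableType d) (a : T) :
  sigma_finite setT (\d_a : set T -> \bar R).
Proof.
exists (fun=> setT); first by rewrite bigcup_const.
by move=> _; split => //; rewrite diracT ltry.
Qed.

(** The recursion of [lebesgueCn] with sigma-finiteness carried along, as required to form the next
    product; [lebCnE] identifies the two. *)
Fixpoint lebCn n : {sigma_finite_measure set 'rV[R[i]]_n -> \bar R} :=
  match n with
  | 0%N => sigma_finite_measure_of (measure0 \d_(0 : 'rV[R[i]]_0))
      (measure_ge0 \d_(0 : 'rV[R[i]]_0))
      (@measure_semi_sigma_additive _ _ _ \d_(0 : 'rV[R[i]]_0))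
      (dirac_sigma_finite (0 : 'rV[R[i]]_0))
  | k.+1 => sval (sfin_pushforward_spec (product_sigma_finite lebC (lebCn k))
      (@measurable_consC k) (@measurable_unconsC k) (@consCK k))
  end.

Lemma lebCnS n A :
  lebCn n.+1 A = (product_sigma_finite lebC (lebCn n)) (@consC n @^-1` A).
Proof. by rewrite /=; case: sfin_pushforward_spec => nu /= ->. Qed.

Lemma lebCnE n : (lebCn n : set _ -> \bar R) = @lebesgueCn R n.
Proof.
elim: n => [//|n ih]; apply/funext => A.
by rewrite lebCnS /= -ih -lebCE.
Qed.

Definition upd n (i : 'I_n) (z : 'rV[R[i]]_n) (c : R[i]) : 'rV[R[i]]_n :=
  \row_j if j == i then c else z 0 j.

Lemma preserving_lebCnS n (f : 'rV[R[i]]_(n.+1) -> 'rV[R[i]]_(n.+1)) :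
  preserving (product_sigma_finite lebC (lebCn n)) (@unconsC n \o f \o @consC n) ->
  preserving (lebCn n.+1) f.
Proof.
move=> [mf pf]; split.
  rewrite (_ : f = @consC n \o (@unconsC n \o f \o @consC n) \o @unconsC n); last first.
    by apply/funext => x /=; rewrite !unconsCK.
  apply: measurableT_comp; last exact: measurable_unconsC.
  by apply: measurableT_comp => //; exact: measurable_consC.
move=> A mA; rewrite !lebCnS -[RHS]pf; last first.
  by rewrite -[X in measurable X]setTI; apply: measurable_consC.
by congr (product_sigma_finite _ _ _); apply/seteqP; split => x /=; rewrite unconsCK.
Qed.

(** If coordinate i is the first one, the map is skew in the first factor; otherwise induction
    applies in the second. [g] may depend on the old value of coordinate i as well, which covers
    shears and phase changes alike. *)
Lemma preserving_upd n (i : 'I_n) (g : 'rV[R[i]]_n -> R[i]) :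
  measurable_fun setT g ->
  (forall z, preserving lebC (fun c => g (upd i z c))) ->
  preserving (lebCn n) (fun z => upd i z (g z)).
Proof.
elim: n i g => [[]//|n ih] i g mg pg; apply: preserving_lebCnS.
have mgc : measurable_fun setT (g \o @consC n).
  by apply: measurableT_comp => //; exact: measurable_consC.
case: (unliftP ord0 i) pg => [j|] -> pg.
  rewrite (_ : _ \o _ = fun p => (p.1, upd j p.2 (g (consC p)))); last first.
    apply/funext => -[x y]; rewrite /unconsC /= mxE consC0/=.
    congr pair; apply/rowP => k; rewrite mxE [LHS]mxE [RHS]mxE consCS /=.
    by rewrite (inj_eq lift_inj).
  apply: (@preserving_skew2 _ _ _ _ _ lebC (lebCn n)
     (fun p => upd j p.2 (g (consC p)))).
    apply: measurable_fun_rV => k.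
    have [->|kj] := eqVneq k j; first by under eq_fun do rewrite mxE eqxx.
    under eq_fun do rewrite mxE (negbTE kj).
    apply: (@measurableT_comp _ _ _ _ _ _ (fun z : 'rV[R[i]]_n => z 0 k)) => //.
    exact: measurable_coord.
  move=> x; apply: (ih j (fun y => g (consC (x, y)))).
    exact: (measurableT_comp mgc (measurable_pair1 x)).
  move=> y; rewrite (_ : (fun _ => _) = fun c => g (upd (lift ord0 j) (consC (x, y)) c)) //.
  apply/funext => c; congr g; apply/rowP => k.
  case: (unliftP ord0 k) => [l|] ->.
    by rewrite consCS [LHS]mxE [RHS]mxE consCS (inj_eq lift_inj).
  by rewrite consC0 mxE consC0.
rewrite (_ : _ \o _ = fun p => (g (consC p), p.2)); last first.
  apply/funext => -[x y]; rewrite /unconsC /= mxE eqxx.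
  by congr pair; apply/rowP => k; rewrite mxE [LHS]mxE /= consCS.
apply: (@preserving_skew1 _ _ _ _ _ lebC (lebCn n) (fun p => g (consC p))) => //.
(* The 0 in the first slot is a placeholder, overwritten by [upd]. *)
move=> y; rewrite (_ : (fun _ => _) = fun c => g (upd ord0 (consC (0, y)) c)) //.
apply/funext => c; congr g; apply/rowP => k.
case: (unliftP ord0 k) => [l|] ->; first by rewrite consCS [RHS]mxE /= consCS.
by rewrite consC0 mxE eqxx.
Qed.

Definition boxCn n (e : R) : set 'rV[R[i]]_n :=
  [set z | forall i, boxC e (z 0 i)].

Lemma measurable_boxCn n e : measurable (@boxCn n e).
Proof.
rewrite (_ : boxCn e = \big[setI/setT]_(i < n) ((fun z : 'rV[R[i]]_n => z 0 i) @^-1` boxC e)).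
  apply: bigsetI_measurable => i _; rewrite -[X in measurable X]setTI.
  by apply: measurable_coord => //; exact: measurable_boxC.
by rewrite -bigcap_seq; apply/seteqP; split=> [z zb i _|z zb i]; apply: zb;
  rewrite /= ?mem_index_enum.
Qed.

Lemma lebCn_box n (e : R) : 0 <= e -> lebCn n (boxCn e) = ((4 * e ^+ 2) ^+ n)%:E.
Proof.
move=> e0; elim: n => [|n ih].
  by rewrite expr0 /= /set_function_of diracE mem_set// => -[].
rewrite lebCnS (_ : _ @^-1` _ = boxC e `*` boxCn e).
  rewrite [LHS]product_measure1E; [|exact: measurable_boxC|exact: measurable_boxCn].
  transitivity ((4 * e ^+ 2)%:E * ((4 * e ^+ 2) ^+ n)%:E)%E.
    by congr (_ * _)%E; [exact: lebC_box|exact: ih].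
  by rewrite -EFinM -exprS.
apply/seteqP; split => -[x y] /=.
  move=> h; split; first by have := h ord0; rewrite consC0.
  by move=> i; have := h (lift ord0 i); rewrite consCS.
move=> [h1 h2] i; case: (unliftP ord0 i) => [j|] ->; first by rewrite consCS; exact: h2.
by rewrite consC0.
Qed.

Lemma cnorm_ge0 n (z : 'rV[R[i]]_n) : 0 <= cnorm z. Proof. exact: sqrtr_ge0. Qed.

Lemma cnorm_sqr n (z : 'rV[R[i]]_n) : cnorm z ^+ 2 = \sum_i normc (z 0 i) ^+ 2.
Proof. by rewrite sqr_sqrtr// sumr_ge0// => i _; exact: sqr_ge0. Qed.

Lemma cnorm_coord n (z : 'rV[R[i]]_n) i : normc (z 0 i) <= cnorm z.
Proof.
rewrite -(@ler_pXn2r _ 2)// ?nnegrE ?normc_ge0 ?cnorm_ge0// cnorm_sqr (bigD1 i)//=.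
by rewrite lerDl sumr_ge0// => j _; exact: sqr_ge0.
Qed.

Lemma unit_ball_fin n : (lebCn n (unit_ball R n) < +oo)%E.
Proof.
apply: (@le_lt_trans _ _ (lebCn n (boxCn 1))); last first.
  by rewrite lebCn_box// ltry.
apply: le_measure; rewrite ?inE; first exact: measurable_unit_ball.
  exact: measurable_boxCn.
move=> z zB i; have h := le_lt_trans (cnorm_coord z i) zB.
by split; [exact: le_lt_trans (Re_le_normc _) h|exact: le_lt_trans (Im_le_normc _) h].
Qed.

Lemma unit_ball_gt0 n : (0 < lebCn n (unit_ball R n))%E.
Proof.
(* With n+1 in place of n, e is meaningful for n = 0 and the box stays inside the ball: n 2e^2 <
   (n+1) 2e^2 = e <= 1/2. *)
pose e : R := n.+1%:R^-1 / 2.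
have e0 : 0 < e by rewrite divr_gt0// invr_gt0 ltr0n.
apply: (@lt_le_trans _ _ (lebCn n (boxCn e))).
  by rewrite lebCn_box ?ltW// lte_fin exprn_gt0// mulr_gt0// exprn_gt0.
apply: le_measure; rewrite ?inE; first exact: measurable_boxCn.
  exact: measurable_unit_ball.
move=> z zb; rewrite /unit_ball /=.
rewrite -(@ltr_pXn2r _ 2)// ?nnegrE ?cnorm_ge0// cnorm_sqr expr1n.
have ne : n.+1%:R * e = 2^-1.
  by rewrite /e mulrA mulfV ?mul1r// pnatr_eq0.
have e1 : e <= 2^-1 by rewrite -ne; apply: ler_peMl; rewrite ?ler1n// ltW.
have sq (x : R) : `|x| < e -> x ^+ 2 <= e ^+ 2.
  move=> xe; rewrite -[x ^+ 2]real_normK ?num_real//.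
  by rewrite ler_pXn2r ?nnegrE ?(ltW xe)// ltW.
apply: (@le_lt_trans _ _ (\sum_(i < n) 2 * e ^+ 2)).
  apply: ler_sum => i _; have [h1 h2] := zb i.
  rewrite sqr_normcE mulr_natl mulr2n lerD//.
    exact: sq.
  exact: sq.
rewrite sumr_const card_ord -[_ *+ n]mulr_natl.
apply: (@lt_le_trans _ _ (n.+1%:R * (2 * e ^+ 2))).
  by rewrite ltr_pM2r ?ltr_nat// mulr_gt0// exprn_gt0.
rewrite (_ : n.+1%:R * (2 * e ^+ 2) = 2 * (n.+1%:R * e) * e); last by ring.
by rewrite ne mulfV ?mul1r ?pnatr_eq0//; lra.
Qed.

Lemma cnorm_eq0 n (z : 'rV[R[i]]_n) : cnorm z = 0 -> z = 0.
Proof.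
move=> z0; apply/rowP => i; rewrite mxE; apply/eqP; rewrite -normc_eq0 eq_le normc_ge0.
by rewrite andbT -z0 cnorm_coord.
Qed.

Lemma lebCn_set0 n : (0 < n)%N -> lebCn n [set 0] = 0%E.
Proof.
case: n => // n _; rewrite lebCnS (_ : _ @^-1` _ = [set 0] `*` [set 0]).
  rewrite [LHS]product_measure1E.
  - by rewrite [X in (X * _)%E]lebC_set0 mul0e.
  - rewrite (_ : [set 0] = @normc R @^-1` [set 0]).
      have mN : measurable_fun [set: R[i]] (@normc R).
        by apply: measurable_fun_normc => //; exact: measurable_id.
      by rewrite -[X in measurable X]setTI; apply: mN.
    apply/seteqP; split => x /=; first by move=> ->; rewrite normc0.
    exact: eq0_normc.
  rewrite (_ : [set 0] = @cnorm R n @^-1` [set 0]).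
    by rewrite -[X in measurable X]setTI; apply: measurable_cnorm.
  apply/seteqP; split => x /=; last exact: cnorm_eq0.
  move=> ->; rewrite /cnorm big1 ?sqrtr0// => i _.
  by rewrite mxE normc0 expr0n.
apply/seteqP; split => -[x y] /=.
  move=> h; split; first by have := consC0 (x, y); rewrite h mxE.
  by apply/rowP => i; have := consCS (x, y) i; rewrite h !mxE.
move=> [-> ->]; apply/rowP => i; case: (unliftP ord0 i) => [j|] ->.
  by rewrite consCS !mxE.
by rewrite consC0 mxE.
Qed.

End lebesgue_Cn.

(** * Rotation invariance of the surface measure *)

Section surface_measure_theory.
Context {R : realType} (n : nat).
Local Notation Cn := 'rV[R[i]]_n.
Local Notation B := (unit_ball R n).
Local Notation S := (unit_sphere R n).

Definition radial (z : Cn) : Cn := (cnorm z)^-1%:C *: z.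

Lemma measurable_radial : measurable_fun setT radial.
Proof.
apply: measurable_fun_rV => i; under eq_fun do rewrite mxE.
apply: measurable_funcM => //; last exact: measurable_coord.
rewrite (_ : (fun _ => _) = fun z => ((cnorm z)%:C)^-1); last first.
  by apply/funext => z; rewrite (fmorphV (real_complex R)).
by apply: measurable_funcV => //; apply: measurable_fun_realc => //; exact: measurable_cnorm.
Qed.

Lemma sigmaE A : sigma R n A =
  ((fine (lebCn n B))^-1%:E * lebCn n (B `&` radial @^-1` A))%E.
Proof. by rewrite /sigma -lebCnE. Qed.

Let v_fin : lebCn n B \is a fin_num.
Proof. by rewrite ge0_fin_numE ?measure_ge0// unit_ball_fin. Qed.

Let v_gt0 : 0 < fine (lebCn n B).
Proof. by rewrite fine_gt0// unit_ball_gt0 unit_ball_fin. Qed.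

Let vV_ge0 : (0 <= (fine (lebCn n B))^-1%:E)%E.
Proof. by rewrite lee_fin invr_ge0 ltW. Qed.

Let m_cone A : measurable A -> measurable (B `&` radial @^-1` A).
Proof.
move=> mA; apply: measurableI; first exact: measurable_unit_ball.
by rewrite -[X in measurable X]setTI; exact: measurable_radial.
Qed.

Let sigma0 : sigma R n set0 = 0%E.
Proof. by rewrite sigmaE preimage_set0 setI0 measure0 mule0. Qed.

Let sigma_ge0 A : (0 <= sigma R n A)%E.
Proof. by rewrite sigmaE mule_ge0. Qed.

Let sigma_semi_sigma_additive : semi_sigma_additive (sigma R n).
Proof.
move=> F mF tF mUF; rewrite sigmaE.
rewrite (_ : (fun _ => _) = fun k => ((fine (lebCn n B))^-1%:E *
    \sum_(0 <= i < k) lebCn n (B `&` radial @^-1` (F i)))%E).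
  apply: cvgeZl; first by [].
  rewrite preimage_bigcup setI_bigcupr.
  apply: measure_semi_sigma_additive.
  - by move=> k; exact: m_cone.
  - apply/trivIsetP => /= i j _ _ ij; rewrite setIACA setIid -preimage_setI.
    by move/trivIsetP : tF => /(_ _ _ _ _ ij) ->//; rewrite preimage_set0 setI0.
  - by rewrite -setI_bigcupr -preimage_bigcup; exact: m_cone.
apply/funext => k; under eq_bigr do rewrite sigmaE.
by rewrite ge0_sume_distrr.
Qed.

HB.instance Definition _ := isMeasure.Build _ _ _ (sigma R n)
  sigma0 sigma_ge0 sigma_semi_sigma_additive.

Let sigma_setT : sigma R n setT = 1%E.
Proof.
by rewrite sigmaE preimage_setT setIT -{2}(fineK v_fin) -EFinM mulVf ?gt_eqF.
Qed.

HB.instance Definition _ := Measure_isProbability.Build _ _ _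
  (sigma R n) sigma_setT.

Lemma cnormZ (a : R[i]) (z : Cn) : cnorm (a *: z) = normc a * cnorm z.
Proof.
rewrite /cnorm -[normc a]ger0_norm ?normc_ge0// -sqrtr_sqr -sqrtrM ?sqr_ge0//.
by congr Num.sqrt; rewrite mulr_sumr; apply: eq_bigr => i _; rewrite mxE normcM exprMn.
Qed.

(** The cone over the sphere is the ball without the origin, as [radial] sends 0 to 0. The origin is
    a null set as soon as 0 < n. *)
Lemma sigma_sphere : (0 < n)%N -> sigma R n S = 1%E.
Proof.
move=> n0; rewrite -sigma_setT !sigmaE preimage_setT setIT; congr (_ * _)%E.
have m0 : measurable [set (0 : Cn)].
  rewrite (_ : [set 0] = @cnorm R n @^-1` [set 0]).
    by rewrite -[X in measurable X]setTI; apply: measurable_cnorm.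
  apply/seteqP; split => x /=; last exact: cnorm_eq0.
  move=> ->; rewrite /cnorm big1 ?sqrtr0// => i _.
  by rewrite mxE normc0 expr0n.
rewrite (_ : B `&` radial @^-1` S = B `\` [set 0]).
  rewrite measureD//; last exact: unit_ball_fin.
  - transitivity (lebCn n B - 0)%E; last exact: sube0.
    congr (_ - _)%E; apply/eqP.
    rewrite eq_le measure_ge0 andbT -(lebCn_set0 n0) le_measure ?inE//.
    by apply: measurableI => //; exact: measurable_unit_ball.
  - exact: measurable_unit_ball.
apply/seteqP; split => z /= [zB].
  move=> zS; split => // z0; move: zS; rewrite /radial z0 scaler0 /unit_sphere /=.
  rewrite /cnorm big1 ?sqrtr0 => [/esym /eqP|i _]; first by rewrite oner_eq0.
  by rewrite mxE normc0 expr0n.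
move=> z0; split => //; rewrite /unit_sphere/= /radial cnormZ normc_real.
have zn0 : cnorm z != 0 by apply/eqP => /cnorm_eq0.
by rewrite normfV ger0_norm ?cnorm_ge0// mulVf.
Qed.

(* The dilated cone over T^-1 A is the preimage under T of the cone over A. *)
Lemma preserving_sigma (T : Cn -> Cn) : preserving (lebCn n) T ->
  (forall (a : R) z, T (a%:C *: z) = a%:C *: T z) ->
  (forall z, cnorm (T z) = cnorm z) ->
  preserving (sigma R n) T.
Proof.
move=> [mT pT] TZ Tn; split=> // A mA; rewrite !sigmaE; congr (_ * _)%E.
rewrite -[in RHS]pT; last exact: m_cone.
congr (lebCn n _); apply/seteqP; split => z /=; rewrite /unit_ball /= /radial Tn TZ//.
Qed.

End surface_measure_theory.

(** * L^1 and L^2 of the sphere *)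

Section sphere_integral_theory.
Context {R : realType} (n : nat).
Local Notation Cn := 'rV[R[i]]_n.
Local Notation S := (unit_sphere R n).
Local Notation mu := (sigma R n).
Implicit Types (f g : Cn -> R[i]).

Definition integrableS f := measurable_fun S f /\ (L1norm f < +oo)%E.

Let mS : measurable S. Proof. exact: measurable_unit_sphere. Qed.
Local Hint Resolve mS : core.

Lemma integrableS_normc f : integrableS f -> mu.-integrable S (EFin \o (normc (R:=R) \o f)).
Proof.
move=> [mf foo]; apply/integrableP; split.
  by apply/measurable_EFinP; exact: measurable_fun_normc.
rewrite (eq_integral (fun x => (normc (f x))%:E)) => [//|x _ /=].
by rewrite ger0_norm// normc_ge0.
Qed.

Lemma integrableS_le f g : measurable_fun S f -> (forall x, S x -> normc (f x) <= normc (g x)) ->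
  integrableS g -> integrableS f.
Proof.
move=> mf fg [mg goo]; split => //; apply: le_lt_trans goo.
apply: ge0_le_integral => //; try by move=> x _; rewrite lee_fin normc_ge0.
- by apply/measurable_EFinP; exact: measurable_fun_normc.
- by apply/measurable_EFinP; exact: measurable_fun_normc.
Qed.

Lemma integrableS_Re f : integrableS f ->
  mu.-integrable S (EFin \o (fun x => complex.Re (f x))).
Proof.
move=> intf; apply: le_integrable (integrableS_normc intf) => //.
  by apply/measurable_EFinP; apply: measurable_funRe; case: intf.
by move=> x _ /=; rewrite lee_fin (ger0_norm (normc_ge0 _)) Re_le_normc.
Qed.

Lemma integrableS_Im f : integrableS f ->
  mu.-integrable S (EFin \o (fun x => complex.Im (f x))).
Proof.
move=> intf; apply: le_integrable (integrableS_normc intf) => //.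
  by apply/measurable_EFinP; apply: measurable_funIm; case: intf.
by move=> x _ /=; rewrite lee_fin (ger0_norm (normc_ge0 _)) Im_le_normc.
Qed.

Lemma L1norm_ge0 f : (0 <= L1norm f)%E.
Proof. by apply: integral_ge0 => x _; rewrite lee_fin normc_ge0. Qed.

Lemma eq_L1norm f g : (forall x, S x -> f x = g x) -> L1norm f = L1norm g.
Proof. by move=> fg; apply: eq_integral => x /set_mem xS; rewrite fg. Qed.

Lemma L1normD f g : integrableS f -> integrableS g ->
  (L1norm (fun x => f x + g x)%R <= L1norm f + L1norm g)%E.
Proof.
move=> [mf foo] [mg goo]; rewrite /L1norm -ge0_integralD//.
- apply: ge0_le_integral => //; try by move=> x _; rewrite -?EFinD lee_fin ?addr_ge0 ?normc_ge0.
  + by apply/measurable_EFinP; apply: measurable_fun_normc => //; exact: measurable_funcD.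
  + by apply: emeasurable_funD; apply/measurable_EFinP; exact: measurable_fun_normc.
  + by move=> x _; rewrite -EFinD lee_fin le_normcD.
- by move=> x _; rewrite lee_fin normc_ge0.
- by apply/measurable_EFinP; exact: measurable_fun_normc.
- by move=> x _; rewrite lee_fin normc_ge0.
- by apply/measurable_EFinP; exact: measurable_fun_normc.
Qed.

Lemma L1normZ (a : R[i]) f : measurable_fun S f ->
  L1norm (fun x => a * f x) = ((normc a)%:E * L1norm f)%E.
Proof.
move=> mf; rewrite /L1norm -ge0_integralZl//.
- by apply: eq_integral => x _; rewrite normcM.
- by apply/measurable_EFinP; exact: measurable_fun_normc.
- by move=> x _; rewrite lee_fin normc_ge0.
- by rewrite lee_fin normc_ge0.
Qed.

Lemma integrableSD f g : integrableS f -> integrableS g ->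
  integrableS (fun x => f x + g x).
Proof.
move=> hf hg; split; first by apply: measurable_funcD => //; [case: hf|case: hg].
by apply: le_lt_trans (L1normD hf hg) _; apply: lte_add_pinfty; [case: hf|case: hg].
Qed.

Lemma integrableSZ (a : R[i]) f : integrableS f -> integrableS (fun x => a * f x).
Proof.
move=> hf; split; first by apply: measurable_funcM => //; case: hf.
rewrite L1normZ; last by case: hf.
by apply: lte_mul_pinfty; rewrite ?lee_fin ?normc_ge0//; case: hf.
Qed.

Lemma eq_sphere_integral f g : (forall x, S x -> f x = g x) ->
  sphere_integral f = sphere_integral g.
Proof.
move=> fg; rewrite /sphere_integral; congr (fine _ +i* fine _);
by apply: eq_integral => x /set_mem xS; rewrite fg.
Qed.

Lemma sphere_integralD f g : integrableS f -> integrableS g ->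
  sphere_integral (fun x => f x + g x) = sphere_integral f + sphere_integral g.
Proof.
move=> hf hg; rewrite /sphere_integral /=; congr Complex.
  rewrite -[RHS]RintegralD//; try exact: integrableS_Re.
  by congr fine; apply: eq_integral => x _; rewrite Re_add.
rewrite -[RHS]RintegralD//; try exact: integrableS_Im.
by congr fine; apply: eq_integral => x _; rewrite Im_add.
Qed.

Lemma sphere_integralZ (a : R[i]) f : integrableS f ->
  sphere_integral (fun x => a * f x) = a * sphere_integral f.
Proof.
move=> hf; have hr := integrableS_Re hf; have hi := integrableS_Im hf.
have zl (r : R) (g : Cn -> R) : mu.-integrable S (EFin \o g) ->
    mu.-integrable S (EFin \o (fun x => r * g x)).
  by move=> ig; exact: (integrableZl _ r ig).
apply/eqP; rewrite eq_complex Re_mul Im_mul /=; apply/andP; split; apply/eqP.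
  rewrite -[X in X - _]RintegralZl// -[X in _ - X]RintegralZl// -RintegralB//; try exact: zl.
  by congr fine; apply: eq_integral => x _; rewrite Re_mul.
rewrite -[X in X + _]RintegralZl// -[X in _ + X]RintegralZl// -RintegralD//; try exact: zl.
by congr fine; apply: eq_integral => x _; rewrite Im_mul.
Qed.

Lemma sphere_integralN f : integrableS f ->
  sphere_integral (fun x => - f x) = - sphere_integral f.
Proof.
move=> hf; rewrite -mulN1r -sphere_integralZ//.
by apply: eq_sphere_integral => x _; rewrite mulN1r.
Qed.

Lemma integrableSN f : integrableS f -> integrableS (fun x => - f x).
Proof.
move=> hf; rewrite (_ : (fun _ => _) = fun x => (-1) * f x).
  exact: integrableSZ.
by apply/funext => x; rewrite mulN1r.
Qed.

Lemma integrableSB f g : integrableS f -> integrableS g ->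
  integrableS (fun x => f x - g x).
Proof. by move=> hf hg; apply: integrableSD => //; exact: integrableSN. Qed.

Lemma sphere_integralB f g : integrableS f -> integrableS g ->
  sphere_integral (fun x => f x - g x) = sphere_integral f - sphere_integral g.
Proof.
move=> hf hg; rewrite sphere_integralD//; last exact: integrableSN.
by rewrite sphere_integralN.
Qed.

Lemma sphere_integral_conj f : integrableS f ->
  sphere_integral (fun x => (f x)^*) = (sphere_integral f)^*.
Proof.
move=> hf; rewrite [RHS]complexEta ReC_conj ImC_conj [LHS]/sphere_integral; congr Complex.
  by congr fine; apply: eq_integral => x _; rewrite ReC_conj.
rewrite -mulN1r -[RHS]RintegralZl//; last exact: integrableS_Im.
by congr fine; apply: eq_integral => x _; rewrite ImC_conj mulN1r.
Qed.

Lemma integrableS0 : integrableS (fun=> 0).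
Proof.
split; first exact: measurable_cst.
by rewrite /L1norm (eq_integral (cst 0%E)) ?integral0// => x _; rewrite normc0.
Qed.

Lemma sphere_integral0 : sphere_integral ((fun=> 0) : Cn -> R[i]) = 0.
Proof.
rewrite -[RHS](mul0r (sphere_integral ((fun=> 0) : Cn -> R[i]))).
rewrite -sphere_integralZ; last exact: integrableS0.
by apply: eq_sphere_integral => x _; rewrite mul0r.
Qed.

Lemma integrableS_sum (I : Type) (s : seq I) (F : I -> Cn -> R[i]) :
  (forall i, integrableS (F i)) -> integrableS (fun x => \sum_(i <- s) F i x).
Proof.
move=> hF; elim: s => [|i s ih].
  rewrite (_ : (fun _ => _) = fun=> 0); first exact: integrableS0.
  by apply/funext => x; rewrite big_nil.
rewrite (_ : (fun _ => _) = fun x => F i x + \sum_(j <- s) F j x).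
  exact: integrableSD.
by apply/funext => x; rewrite big_cons.
Qed.

Lemma sphere_integral_sum (I : Type) (s : seq I) (F : I -> Cn -> R[i]) :
  (forall i, integrableS (F i)) ->
  sphere_integral (fun x => \sum_(i <- s) F i x) = \sum_(i <- s) sphere_integral (F i).
Proof.
move=> hF; elim: s => [|i s ih].
  rewrite big_nil -[RHS]sphere_integral0; apply: eq_sphere_integral => x _.
  by rewrite big_nil.
rewrite big_cons -ih -sphere_integralD//; last exact: integrableS_sum.
by apply: eq_sphere_integral => x _; rewrite big_cons.
Qed.

Lemma le_normc_sphere_integral f : integrableS f ->
  ((normc (sphere_integral f))%:E <= L1norm f)%E.
Proof.
move=> hf; have [->|I0] := eqVneq (sphere_integral f) 0.
  by rewrite normc0 L1norm_ge0.
(* A unimodular factor turning the integral into its modulus, so that real parts can be compared. *)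
pose u := (sphere_integral f)^* / (normc (sphere_integral f))%:C.
have nI : normc (sphere_integral f) != 0 by rewrite normc_eq0.
have uI : u * sphere_integral f = (normc (sphere_integral f))%:C.
  rewrite /u mulrAC [_^* * _]mulrC mulc_conj -(fmorphV (real_complex R)) -rmorphM /=.
  by rewrite expr2 mulfK.
have nu : normc u = 1.
  by rewrite /u normcM normcV normc_conj normc_real ger0_norm ?normc_ge0// mulfV.
have hu := integrableSZ u hf.
have -> : normc (sphere_integral f) = complex.Re (sphere_integral (fun x => u * f x)).
  by rewrite sphere_integralZ// uI.
rewrite /= fineK; last by apply: integrable_fin_num => //; exact: integrableS_Re.
apply: (@le_trans _ _ (\int[mu]_(x in S) (normc (u * f x))%:E)%E).
  apply: le_integral => //; [exact: integrableS_Re|exact: integrableS_normc|].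
  by move=> x _; rewrite /= lee_fin (le_trans _ (Re_le_normc _))// ler_norm.
by rewrite -/(L1norm (fun x => u * f x)) L1normZ ?nu ?mul1e//; case: hf.
Qed.

(** The sphere is its own preimage under [T], and the image measure agrees with [sigma] on
    measurable sets. The change of variables for pushforwards takes f measurable on the whole
    space. *)
Lemma sphere_integral_comp (T : Cn -> Cn) f : preserving mu T ->
  (forall z, cnorm (T z) = cnorm z) -> measurable_fun setT f -> integrableS f ->
  sphere_integral (f \o T) = sphere_integral f.
Proof.
move=> [mT pT] Tn mf hf.
have TS : T @^-1` S = S by apply/seteqP; split => z; rewrite /unit_sphere /= Tn.
have key (g : Cn -> R) : measurable_fun setT g -> mu.-integrable S (EFin \o g) ->
    (\int[mu]_(x in S) (g (T x))%:E = \int[mu]_(x in S) (g x)%:E)%E.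
  move=> mg ig.
  have mg' : measurable_fun setT (EFin \o g) by exact/measurable_EFinP.
  have igT : mu.-integrable (T @^-1` S) ((EFin \o g) \o T).
    apply/integrableP; split.
      by rewrite TS; apply: measurable_funTS; exact: measurableT_comp.
    move/integrableP : (ig) => [_]; apply: le_lt_trans.
    have /= <- := @ge0_integral_pushforward _ _ _ _ _ _ mT mu S (abse \o (EFin \o g)).
    - pose nu := measure_function_pushforward__canonical__measure_function_Measure mu mT.
      rewrite le_eqVlt; apply/orP; left; apply/eqP.
      by apply: (eq_measure_integral mu (m1 := nu)) => A mA _; rewrite /= /pushforward pT.
    - exact: mS.
    - by apply: measurableT_comp => //; exact: measurable_funTS.
    - by move=> x _ /=; rewrite lee_fin.
  have := integral_pushforward mT mg' igT mS.
  rewrite TS => <- /=.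
  pose nu := measure_function_pushforward__canonical__measure_function_Measure mu mT.
  by apply: (eq_measure_integral mu (m1 := nu)) => A mA _; rewrite /= /pushforward pT.
rewrite /sphere_integral; congr (fine _ +i* fine _); apply: key.
- exact: measurable_funRe.
- exact: integrableS_Re.
- exact: measurable_funIm.
- exact: integrableS_Im.
Qed.

End sphere_integral_theory.

Section L2_theory.
Context {R : realType} (n : nat).
Local Notation Cn := 'rV[R[i]]_n.
Local Notation S := (unit_sphere R n).
Local Notation mu := (sigma R n).
Implicit Types (f g : Cn -> R[i]).

Let mS : measurable S. Proof. exact: measurable_unit_sphere. Qed.
Local Hint Resolve mS : core.

Lemma L1norm_bounded f (C : R) : 0 <= C -> measurable_fun S f ->
  (forall x, S x -> normc (f x) <= C) -> (L1norm f <= C%:E)%E.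
Proof.
move=> C0 mf fC; apply: (@le_trans _ _ (\int[mu]_(x in S) C%:E)%E).
  apply: ge0_le_integral => //.
  - by move=> x _; rewrite lee_fin normc_ge0.
  - by apply/measurable_EFinP; exact: measurable_fun_normc.
rewrite integral_cst// -[leRHS]mule1; apply: lee_pmul => //.
exact: probability_le1.
Qed.

Lemma integrableS_bounded f (C : R) : measurable_fun S f ->
  (forall x, S x -> normc (f x) <= C) -> integrableS f.
Proof.
move=> mf fC; split => //; apply: (@le_lt_trans _ _ (Num.max 0 C)%:E); last exact: ltry.
apply: L1norm_bounded => //; first by rewrite le_max lexx.
by move=> x xS; rewrite le_max fC// orbT.
Qed.

(** Complex-valued, so that the results on [L1norm] and [integrableS] apply to |f|^2. *)
Let sqf f : Cn -> R[i] := fun x => (normc (f x) ^+ 2)%:C.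

Let L1norm_sqf f : L1norm (sqf f) = (\int[mu]_(x in S) (normc (f x) ^+ 2)%:E)%E.
Proof.
apply: eq_integral => x _; rewrite normc_real ger0_norm// exprn_ge0//.
exact: normc_ge0.
Qed.

Lemma L2_integrableS_sq f : L2 f <-> measurable_fun S f /\ integrableS (sqf f).
Proof.
split=> [[mf foo]|[mf [_ foo]]]; split => //; last by rewrite -L1norm_sqf.
split; last by rewrite L1norm_sqf.
apply: measurable_fun_realc => //; apply: measurable_funX.
exact: measurable_fun_normc.
Qed.

Lemma L2_measurable f : L2 f -> measurable_fun S f. Proof. by case. Qed.

Lemma L2_bounded f (C : R) : measurable_fun S f ->
  (forall x, S x -> normc (f x) <= C) -> L2 f.
Proof.
move=> mf fC; apply/L2_integrableS_sq; split=> //.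
apply: (@integrableS_bounded _ (C ^+ 2)).
  apply: measurable_fun_realc => //; apply: measurable_funX.
  exact: measurable_fun_normc.
move=> x xS; rewrite normc_real ger0_norm ?exprn_ge0 ?normc_ge0//.
rewrite ler_pXn2r ?nnegrE ?normc_ge0 ?fC// (le_trans _ (fC _ xS))//.
exact: normc_ge0.
Qed.

Lemma L2Z (a : R[i]) f : L2 f -> L2 (fun x => a * f x).
Proof.
move=> /L2_integrableS_sq[mf hf]; apply/L2_integrableS_sq; split.
  by apply: measurable_funcM.
rewrite (_ : sqf _ = fun x => (normc a ^+ 2)%:C * sqf f x); first exact: integrableSZ.
by apply/funext => x; rewrite /sqf normcM exprMn rmorphM.
Qed.

Lemma L2_conj f : L2 f -> L2 (fun x => (f x)^*).
Proof.
move=> /L2_integrableS_sq[mf hf]; apply/L2_integrableS_sq; split.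
  exact: measurable_fun_conj.
rewrite (_ : sqf _ = sqf f)//.
by apply/funext => x; rewrite /sqf normc_conj.
Qed.

Lemma L2D f g : L2 f -> L2 g -> L2 (fun x => f x + g x).
Proof.
move=> /L2_integrableS_sq[mf hf] /L2_integrableS_sq[mg hg].
apply/L2_integrableS_sq; split; first exact: measurable_funcD.
apply: (@integrableS_le _ _ _ (fun x => 2%:R * sqf f x + 2%:R * sqf g x)).
- apply: measurable_fun_realc => //; apply: measurable_funX.
  by apply: measurable_fun_normc => //; exact: measurable_funcD.
- move=> x _; rewrite /sqf normc_real ger0_norm ?exprn_ge0 ?normc_ge0//.
  rewrite -(rmorph_nat (real_complex R)) -!rmorphM -rmorphD normc_real ger0_norm; last first.
    by rewrite addr_ge0// mulr_ge0// exprn_ge0// normc_ge0.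
  have h := le_normcD (f x) (g x).
  apply: (@le_trans _ _ ((normc (f x) + normc (g x)) ^+ 2)).
    by rewrite ler_pXn2r ?nnegrE ?addr_ge0 ?normc_ge0.
  rewrite -subr_ge0 [leRHS](_ : _ = (normc (f x) - normc (g x)) ^+ 2) ?sqr_ge0//.
  by ring.
- by apply: integrableSD; exact: integrableSZ.
Qed.

Lemma L2N f : L2 f -> L2 (fun x => - f x).
Proof.
move=> hf; rewrite (_ : (fun _ => _) = fun x => (-1) * f x); first exact: L2Z.
by apply/funext => x; rewrite mulN1r.
Qed.

Lemma L2B f g : L2 f -> L2 g -> L2 (fun x => f x - g x).
Proof. by move=> hf hg; apply: L2D => //; exact: L2N. Qed.

Lemma L2_cst (c : R[i]) : L2 ((fun=> c) : Cn -> R[i]).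
Proof. by apply: (@L2_bounded _ (normc c)) => //; exact: measurable_cst. Qed.

Lemma L2_sum (I : Type) (s : seq I) (F : I -> Cn -> R[i]) :
  (forall i, L2 (F i)) -> L2 (fun x => \sum_(i <- s) F i x).
Proof.
move=> hF; elim: s => [|i s ih].
  rewrite (_ : (fun _ => _) = fun=> 0); first exact: L2_cst.
  by apply/funext => x; rewrite big_nil.
rewrite (_ : (fun _ => _) = fun x => F i x + \sum_(j <- s) F j x).
  exact: L2D.
by apply/funext => x; rewrite big_cons.
Qed.

(** Integrates |fg| <= (t/2)|f|^2 + (1/2t)|g|^2; the best t yields Cauchy-Schwarz in
    [L1norm_mul]. *)
Let L1norm_mul_le f g (t : R) : 0 < t -> L2 f -> L2 g ->
  (L1norm (fun x => (f x * g x)%R) <= (t / 2)%:E * L1norm (sqf f) +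
     (t^-1 / 2)%:E * L1norm (sqf g))%E.
Proof.
move=> t0 /L2_integrableS_sq[mf hf] /L2_integrableS_sq[mg hg].
have ht : 0 <= t / 2 by rewrite divr_ge0// ltW.
have htV : 0 <= t^-1 / 2 by rewrite divr_ge0// invr_ge0 ltW.
have -> : (t / 2)%:E = (normc (t / 2)%:C)%:E by rewrite normc_real ger0_norm.
have -> : (t^-1 / 2)%:E = (normc (t^-1 / 2)%:C)%:E by rewrite normc_real ger0_norm.
rewrite -L1normZ; last by case: hf.
rewrite -L1normZ; last by case: hg.
apply: (@le_trans _ _ (L1norm (fun x => (t / 2)%:C * sqf f x + (t^-1 / 2)%:C * sqf g x)%R));
  last by apply: L1normD; exact: integrableSZ.
apply: ge0_le_integral => //; try by move=> x _; rewrite lee_fin normc_ge0.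
- by apply/measurable_EFinP; apply: measurable_fun_normc => //; exact: measurable_funcM.
- apply/measurable_EFinP; apply: measurable_fun_normc => //; apply: measurable_funcD => //;
    apply: measurable_funcM => //; [by case: hf|by case: hg].
move=> x _; rewrite lee_fin /sqf -!rmorphM -rmorphD normc_real ger0_norm; last first.
  by rewrite addr_ge0// mulr_ge0// exprn_ge0// normc_ge0.
rewrite normcM.
set a := normc (f x); set b := normc (g x).
rewrite -subr_ge0 [leRHS](_ : _ = (2 * t)^-1 * (t * a - b) ^+ 2).
  by rewrite mulr_ge0 ?sqr_ge0// invr_ge0 mulr_ge0// ltW.
by field; rewrite gt_eqF.
Qed.

Lemma integrableSM f g : L2 f -> L2 g -> integrableS (fun x => f x * g x).
Proof.
move=> hf hg; split; first by apply: measurable_funcM => //; exact: L2_measurable.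
apply: le_lt_trans (L1norm_mul_le ltr01 hf hg) _.
move: hf hg => /L2_integrableS_sq[mf [_ hf]] /L2_integrableS_sq[mg [_ hg]].
apply: lte_add_pinfty; apply: lte_mul_pinfty ; rewrite ?lee_fin ?invr1 ?L1norm_ge0 //; lra.
Qed.

Lemma L2_integrableS f : L2 f -> integrableS f.
Proof.
move=> hf; have := integrableSM hf (L2_cst 1).
by congr integrableS; apply/funext => x; rewrite mulr1.
Qed.

Lemma L2norm_ge0 f : 0 <= L2norm f. Proof. exact: sqrtr_ge0. Qed.

Lemma L2norm_sqr f : L2norm f ^+ 2 = fine (L1norm (sqf f)).
Proof. rewrite /L2norm sqr_sqrtr ?L1norm_sqf// fine_ge0// integral_ge0// => x _.
by rewrite lee_fin sqr_ge0. Qed.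

Let L1norm_sqfE f : L2 f -> L1norm (sqf f) = (L2norm f ^+ 2)%:E.
Proof.
move=> /L2_integrableS_sq[mf [_ foo]]; rewrite L2norm_sqr fineK//.
by rewrite ge0_fin_numE// L1norm_ge0.
Qed.

Lemma L1norm_mul f g : L2 f -> L2 g ->
  (L1norm (fun x => (f x * g x)%R) <= (L2norm f * L2norm g)%:E)%E.
Proof.
move=> hf hg; apply/lee_addgt0Pr => e e0.
have [a0 b0] := (L2norm_ge0 f, L2norm_ge0 g).
set a := L2norm f in a0 *; set b := L2norm g in b0 *.
(* The optimal weight is b/a. Adding d to both norms keeps it defined and positive when one of them
   vanishes, and costs (a + d)(b + d) - ab = d(d + a + b) <= e. *)
pose d := Num.min 1 (e / (1 + a + b)).
have ab1 : 0 < 1 + a + b by lra.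
have d0 : 0 < d by rewrite lt_min ltr01 divr_gt0.
have de : d * (1 + a + b) <= e by rewrite -ler_pdivlMr// ge_min lexx orbT.
have d1 : d <= 1 by rewrite ge_min lexx.
have t0 : 0 < (b + d) / (a + d) by rewrite divr_gt0//; lra.
apply: le_trans (L1norm_mul_le t0 hf hg) _.
rewrite !L1norm_sqfE// -/a -/b -!EFinM -!EFinD lee_fin invf_div.
apply: (@le_trans _ _ ((a + d) * (b + d))).
  have h1 : (b + d) / (a + d) / 2 * a ^+ 2 <= (b + d) * (a + d) / 2.
    rewrite [leRHS](_ : _ = (b + d) / (a + d) / 2 * (a + d) ^+ 2); last first.
      by field; rewrite gt_eqF//; lra.
    rewrite ler_wpM2l//; first by rewrite divr_ge0// ltW.
    by rewrite ler_pXn2r ?nnegrE//; lra.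
  have h2 : (a + d) / (b + d) / 2 * b ^+ 2 <= (b + d) * (a + d) / 2.
    rewrite [leRHS](_ : _ = (a + d) / (b + d) / 2 * (b + d) ^+ 2); last first.
      by field; rewrite gt_eqF//; lra.
    rewrite ler_wpM2l//; first by rewrite divr_ge0// divr_ge0//; lra.
    by rewrite ler_pXn2r ?nnegrE//; lra.
  by apply: le_trans (lerD h1 h2) _; rewrite le_eqVlt; apply/orP; left; apply/eqP; field.
have -> : (a + d) * (b + d) = a * b + d * (d + a + b) by ring.
rewrite lerD2l (le_trans _ de)// ler_wpM2l//; first exact: ltW.
by lra.
Qed.

Lemma cauchy_schwarz f g : L2 f -> L2 g ->
  normc (sphere_integral (fun x => f x * g x)) <= L2norm f * L2norm g.
Proof.
move=> hf hg; rewrite -lee_fin (le_trans (le_normc_sphere_integral _))//.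
  exact: integrableSM.
exact: L1norm_mul.
Qed.

(** An inequality only: for n = 0 the sphere is empty. *)
Lemma L2norm_cst1 : L2norm ((fun=> 1) : Cn -> R[i]) <= 1.
Proof.
rewrite -(@ler_pXn2r _ 2)// ?nnegrE ?L2norm_ge0// L2norm_sqr expr1n.
rewrite -lee_fin fineK; last first.
  by have /L2_integrableS_sq[_ [_ h]] := L2_cst 1; rewrite ge0_fin_numE// L1norm_ge0.
apply: L1norm_bounded => //; first exact: measurable_cst.
by move=> x _; rewrite /sqf normc1 expr1n normc_real normr1.
Qed.

Lemma L1norm_le_L2norm f : L2 f -> (L1norm f <= (L2norm f)%:E)%E.
Proof.
move=> hf; have := L1norm_mul hf (L2_cst 1).
rewrite (_ : (fun _ => _) = f); last by apply/funext => x; rewrite mulr1.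
move/le_trans; apply; rewrite lee_fin ler_piMr ?L2norm_ge0//.
exact: L2norm_cst1.
Qed.

Lemma L2norm_bounded f (C : R) : 0 <= C -> measurable_fun S f ->
  (forall x, S x -> normc (f x) <= C) -> L2norm f <= C.
Proof.
move=> C0 mf fC; have hf := L2_bounded mf fC.
rewrite -(@ler_pXn2r _ 2)// ?nnegrE ?L2norm_ge0// -lee_fin -L1norm_sqfE//.
apply: L1norm_bounded; first exact: exprn_ge0.
  by have /L2_integrableS_sq[_ []] := hf.
move=> x xS; rewrite normc_real ger0_norm ?exprn_ge0 ?normc_ge0//.
by rewrite ler_pXn2r ?nnegrE ?normc_ge0 ?fC.
Qed.

Lemma L2ip_self f : L2 f -> L2ip f f = (L2norm f ^+ 2)%:C.
Proof.
move=> hf; have /L2_integrableS_sq[mf hs] := hf.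
rewrite /L2ip (eq_sphere_integral (g := sqf f)); last by move=> x _; rewrite mulc_conj.
rewrite L2norm_sqr /sphere_integral /= L1norm_sqf; congr Complex.
by rewrite integral0_eq// => x _.
Qed.

Lemma eq_L2norm f g : (forall x, S x -> f x = g x) -> L2norm f = L2norm g.
Proof.
move=> fg; rewrite /L2norm; congr (Num.sqrt (fine _)).
by apply: eq_integral => x /set_mem xS; rewrite fg.
Qed.

Lemma L2norm_conj f : L2norm (fun x => (f x)^*) = L2norm f.
Proof.
rewrite /L2norm; congr (Num.sqrt (fine _)).
by apply: eq_integral => x _; rewrite normc_conj.
Qed.

Lemma L2ip_bound f g : L2 f -> L2 g -> normc (L2ip f g) <= L2norm f * L2norm g.
Proof.
by move=> hf hg; rewrite -(L2norm_conj g); apply: cauchy_schwarz => //; exact: L2_conj.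
Qed.

Lemma L2normD f g : L2 f -> L2 g ->
  L2norm (fun x => f x + g x) <= L2norm f + L2norm g.
Proof.
move=> hf hg; have hfg := L2D hf hg.
set c := L2norm (fun x => f x + g x).
have [c0|c0] := leP c 0.
  by rewrite (le_trans c0)// addr_ge0 ?L2norm_ge0.
suff : c * c <= (L2norm f + L2norm g) * c by rewrite ler_pM2r.
have -> : c * c = normc (L2ip (fun x => f x + g x) (fun x => f x + g x)).
  by rewrite L2ip_self// normc_real ger0_norm ?sqr_ge0// expr2.
have -> : L2ip (fun x => f x + g x) (fun x => f x + g x) =
  L2ip f (fun x => f x + g x) + L2ip g (fun x => f x + g x).
  rewrite /L2ip -sphere_integralD; try by apply: integrableSM => //; exact: L2_conj.
  by apply: eq_sphere_integral => x _; rewrite mulrDl.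
rewrite (le_trans (le_normcD _ _))// mulrDl lerD//; exact: L2ip_bound.
Qed.

End L2_theory.

(** * Integration by parts on the sphere *)

Section rotations.
Context {R : realType} (n : nat).
Local Notation Cn := 'rV[R[i]]_n.
Local Notation S := (unit_sphere R n).
Local Notation mu := (sigma R n).

(** A unitary rotation in the (i, j) plane, with s the sine of the angle. On holomorphic f its
    derivative at s = 0 is u z_i D_j f - u^* z_j D_i f, and the two phases u = 1 and u = ['i%C]
    suffice to separate these terms after integration. *)
Definition rot (i j : 'I_n) (u : R[i]) (s : R) (z : Cn) : Cn :=
  \row_k if k == i then (Num.sqrt (1 - s ^+ 2))%:C * z 0 i - s%:C * u^* * z 0 j
         else if k == j then s%:C * u * z 0 i + (Num.sqrt (1 - s ^+ 2))%:C * z 0 j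
         else z 0 k.

Definition phase (i : 'I_n) (s : R) (z : Cn) : Cn :=
  upd i z ((Num.sqrt (1 - s ^+ 2) +i* s) * z 0 i).

Definition isometric (T : Cn -> Cn) := [/\ preserving (lebCn n) T,
  forall (a : R) z, T (a%:C *: z) = a%:C *: T z & forall z, cnorm (T z) = cnorm z].

Lemma preserving_shear (i j : 'I_n) (t : R[i]) : i != j ->
  preserving (lebCn n) (fun z => upd i z (z 0 i + t * z 0 j)).
Proof.
move=> ij; apply: (@preserving_upd _ _ i (fun z => z 0 i + t * z 0 j)).
  apply: measurable_funcD => //; first exact: measurable_coord.
  apply: measurable_funcM => //; exact: measurable_coord.
move=> z; rewrite (_ : (fun _ => _) = fun c => c + t * z 0 j).
  exact: preserving_translationC.
by apply/funext => c; rewrite !mxE eqxx (eq_sym j) (negbTE ij).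
Qed.

Lemma sqrt_1Bsqr (s : R) : `|s| <= 1 / 2 ->
  [/\ 0 <= Num.sqrt (1 - s ^+ 2), Num.sqrt (1 - s ^+ 2) ^+ 2 = 1 - s ^+ 2 &
      `|Num.sqrt (1 - s ^+ 2) - 1| <= s ^+ 2].
Proof.
move=> s2; have s1 : s ^+ 2 <= 1.
  by rewrite -real_normK ?num_real// expr_le1// (le_trans s2)//; lra.
have c0 : 0 <= Num.sqrt (1 - s ^+ 2) by exact: sqrtr_ge0.
have c2 : Num.sqrt (1 - s ^+ 2) ^+ 2 = 1 - s ^+ 2 by rewrite sqr_sqrtr// subr_ge0.
split=> //; set c := Num.sqrt _ in c0 c2 *.
have s20 := sqr_ge0 s.
by rewrite ler_norml; apply/andP; split; nra.
Qed.

Lemma cnorm_eqP (z w : Cn) : \sum_i normc (z 0 i) ^+ 2 = \sum_i normc (w 0 i) ^+ 2 ->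
  cnorm z = cnorm w.
Proof. by rewrite /cnorm => ->. Qed.

Lemma isometric_rot (i j : 'I_n) (u : R[i]) (s : R) : i != j -> normc u = 1 ->
  `|s| <= 1 / 2 -> isometric (rot i j u s).
Proof.
move=> ij u1 s2; have [c0 c2 _] := sqrt_1Bsqr s2.
have uu : u * u^* = 1 by rewrite mulc_conj u1 expr1n.
rewrite /rot; set c := Num.sqrt _ in c0 c2 *.
have ji : (j == i) = false by rewrite eq_sym (negbTE ij).
split.
(* Again the tangent of the half-angle; the phase enters the middle shear as u and the outer ones as
   its conjugate. *)
- pose t := s / (1 + c).
  have c1 : 1 + c != 0 by rewrite gt_eqF// ltr_wpDr.
  have ts : s * t = 1 - c.
    apply: (mulIf c1); rewrite /t mulrA divfK//.
    by rewrite -expr2; transitivity (1 - c ^+ 2); [rewrite c2; ring|ring].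
  have tc : t * (1 + c) = s by rewrite /t divfK.
  rewrite (_ : (fun _ => _) =
    (fun z : Cn => upd i z (z 0 i + (- (t%:C * u^*)) * z 0 j)) \o
    (fun z : Cn => upd j z (z 0 j + (s%:C * u) * z 0 i)) \o
    (fun z : Cn => upd i z (z 0 i + (- (t%:C * u^*)) * z 0 j))).
    apply: preserving_comp; first apply: preserving_comp.
    + exact: preserving_shear.
    + by apply: preserving_shear; rewrite eq_sym.
    + exact: preserving_shear.
  have tsC : s%:C * t%:C = 1 - c%:C by rewrite -rmorphM ts rmorphB rmorph1.
  have tcC : t%:C * (1 + c%:C) = s%:C by rewrite -[1](rmorph1 (real_complex R)) -rmorphD -rmorphM tc.
  apply/funext => z; apply/rowP => k; rewrite !mxE !eqxx ji (negbTE ij) /=.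
  set a := z 0 i; set b := z 0 j.
  case: eqVneq => [_|_].
    transitivity ((1 - s%:C * t%:C * (u * u^*)) * a -
      t%:C * (1 + (1 - s%:C * t%:C * (u * u^*))) * u^* * b); last by ring.
    by rewrite uu mulr1 tsC subKr tcC.
  case: eqVneq => [_|//].
  transitivity (s%:C * u * a + (1 - s%:C * t%:C * (u * u^*)) * b); last by ring.
  by rewrite uu mulr1 tsC subKr.
- move=> a z; apply/rowP => k; rewrite !mxE.
  case: eqVneq => [_|_]; first by ring.
  by case: eqVneq => [_|_] //; ring.
- move=> z; apply: cnorm_eqP.
  rewrite (bigD1 i)//= (bigD1 j) ?ji//= [RHS](bigD1 i)//= [in RHS](bigD1 j) ?ji//=.
  rewrite !addrA; congr (_ + _); last first.
    by apply: eq_bigr => k /andP[ki kj]; rewrite mxE (negbTE ki) (negbTE kj).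
  rewrite !mxE !eqxx ji; apply: complexI.
  rewrite !rmorphD /= -!mulc_conj.
  have conjr (x : R) : (x%:C)^* = x%:C :> R[i] by exact: conjc_real.
  rewrite !(rmorphB, rmorphD, rmorphM) /= !conjr !conjCK.
  set a := z 0 i; set b := z 0 j.
  have c2C : c%:C ^+ 2 = 1 - s%:C ^+ 2 by rewrite -!rmorphXn c2 rmorphB rmorph1.
  transitivity ((c%:C ^+ 2 + s%:C ^+ 2 * (u * u^*)) * (a * a^* + b * b^*)).
    by ring.
  by rewrite uu c2C; ring.
Qed.

Lemma isometric_phase (i : 'I_n) (s : R) : `|s| <= 1 / 2 -> isometric (phase i s).
Proof.
move=> s2; have [c0 c2 _] := sqrt_1Bsqr s2.
rewrite /phase; set c := Num.sqrt _ in c0 c2 *.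
have u1 : normc (c +i* s) = 1 by rewrite /= c2 subrK sqrtr1.
split.
- apply: (@preserving_upd _ _ i (fun z => (c +i* s) * z 0 i)).
    by apply: measurable_funcM => //; exact: measurable_coord.
  move=> z; rewrite (_ : (fun _ => _) = fun x => (c +i* s) * x).
    apply: preserving_rotationC => //; apply/eqP => /(congr1 (@complex.Re R)) /= cN1.
    by move: c0; rewrite cN1; lra.
  by apply/funext => x; rewrite mxE eqxx.
- move=> a z; apply/rowP => k; rewrite !mxE; case: ifP => // _; ring.
- move=> z; apply: cnorm_eqP; apply: eq_bigr => k _; rewrite !mxE.
  by case: eqVneq => [->|//]; rewrite normcM u1 mul1r.
Qed.

Lemma isometric_sphere_integral (T : Cn -> Cn) f : isometric T ->
  measurable_fun setT f -> integrableS f ->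
  sphere_integral (f \o T) = sphere_integral f.
Proof.
by move=> [pT TZ Tn] mf hf; apply: sphere_integral_comp => //; exact: preserving_sigma.
Qed.

Lemma isometric_measurable (T : Cn -> Cn) : isometric T -> measurable_fun setT T.
Proof. by case=> -[]. Qed.

Lemma isometric_sphere (T : Cn -> Cn) z : isometric T -> S z -> S (T z).
Proof. by case=> _ _ h; rewrite /unit_sphere /= h. Qed.

(** Measurable everywhere, because rotated functions are composed on the whole space; bounded on the
    sphere only, because coordinates are unbounded elsewhere. *)
Definition bdm (f : Cn -> R[i]) := measurable_fun setT f /\
  exists C : R, forall z, S z -> normc (f z) <= C.

Lemma eq_bdm f g : bdm f -> (forall z, f z = g z) -> bdm g.
Proof. by move=> + fg; have -> : f = g by exact/funext. Qed.

Lemma bdm_L2 f : bdm f -> L2 f.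
Proof. by move=> [mf [C fC]]; apply: (L2_bounded _ fC); exact: measurable_funTS. Qed.

Lemma bdm_integrableS f : bdm f -> integrableS f.
Proof. by move=> hf; apply: L2_integrableS; exact: bdm_L2. Qed.

Lemma bdmP f : bdm f -> exists2 C : R, 0 <= C & forall z, S z -> normc (f z) <= C.
Proof.
move=> [_ [C fC]]; exists (Num.max 0 C) => [|z zS]; first by rewrite le_max lexx.
by rewrite le_max fC// orbT.
Qed.

Lemma bdmD f g : bdm f -> bdm g -> bdm (fun z => f z + g z).
Proof.
move=> [mf [C fC]] [mg [D gD]]; split; first exact: measurable_funcD.
by exists (C + D) => z zS; rewrite (le_trans (le_normcD _ _))// lerD ?fC ?gD.
Qed.

Lemma bdmM f g : bdm f -> bdm g -> bdm (fun z => f z * g z).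
Proof.
move=> hf hg; have [C C0 fC] := bdmP hf; have [D D0 gD] := bdmP hg.
split; first by apply: measurable_funcM => //; [case: hf|case: hg].
by exists (C * D) => z zS; rewrite normcM ler_pM ?normc_ge0 ?fC ?gD.
Qed.

Lemma bdm_conj f : bdm f -> bdm (fun z => (f z)^*).
Proof.
move=> [mf [C fC]]; split; first exact: measurable_fun_conj.
by exists C => z zS; rewrite normc_conj fC.
Qed.

Lemma bdm_cst (c : R[i]) : bdm (fun=> c).
Proof. by split; [exact: measurable_cst|exists (normc c)]. Qed.

Lemma bdm_coord (i : 'I_n) : bdm (fun z => z 0 i).
Proof.
split; first exact: measurable_coord.
by exists 1 => z <-; exact: cnorm_coord.
Qed.

Lemma bdm_sum (I : Type) (s : seq I) (F : I -> Cn -> R[i]) :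
  (forall i, bdm (F i)) -> bdm (fun x => \sum_(i <- s) F i x).
Proof.
move=> hF; elim: s => [|i s ih].
  rewrite (_ : (fun _ => _) = fun=> 0); first exact: bdm_cst.
  by apply/funext => x; rewrite big_nil.
rewrite (_ : (fun _ => _) = fun x => F i x + \sum_(j <- s) F j x).
  exact: bdmD.
by apply/funext => x; rewrite big_cons.
Qed.

Lemma bdmX f k : bdm f -> bdm (fun z => f z ^+ k).
Proof.
move=> hf; elim: k => [|k ih]; first exact: bdm_cst.
rewrite (_ : (fun _ => _) = fun x => f x * f x ^+ k); first exact: bdmM.
by apply/funext => x; rewrite exprS.
Qed.

(* [G] is the derivative at [s = 0] of [F] along the flow [T s], uniformly on the sphere. *)
Definition uderiv (T : R -> Cn -> Cn) (F G : Cn -> R[i]) := exists2 C : R, 0 <= C &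
  forall (s : R) z, `|s| <= 1 / 2 -> S z ->
    normc (F (T s z) - F z - s%:C * G z) <= C * s ^+ 2.

(** The integral of F along the flow does not depend on s, so |s| times the modulus of the integral
    of G is at most C s^2; divide by s and let it tend to 0. *)
Lemma sphere_integral_uderiv T F G :
  (forall s, `|s| <= 1 / 2 -> isometric (T s)) -> bdm F -> bdm G ->
  uderiv T F G -> sphere_integral G = 0.
Proof.
move=> iT hF hG [C C0 h]; apply: eq0_normc; apply/eqP.
rewrite eq_le normc_ge0 andbT; apply/ler_addgt0Pr => e e0; rewrite add0r.
pose s := Num.min (1 / 2) (e / (C + 1)).
have C1 : 0 < C + 1 by lra.
have s0 : 0 < s by rewrite lt_min divr_gt0//= divr_gt0.
have s2 : `|s| <= 1 / 2 by rewrite ger0_norm ?(ltW s0)// /s ge_min lexx.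
have Cse : C * s <= e.
  apply: (@le_trans _ _ ((C + 1) * s)); first by rewrite ler_wpM2r ?ltW//; lra.
  by rewrite mulrC -ler_pdivlMr// /s ge_min lexx orbT.
apply: le_trans Cse; rewrite -(ler_pM2l s0) mulrCA -expr2.
have iF := bdm_integrableS hF; have iG := bdm_integrableS hG.
have hFT : bdm (F \o T s).
  split; first by apply: measurableT_comp; [case: hF|exact: (isometric_measurable (iT _ s2))].
  by have [_ [D FD]] := hF; exists D => z zS; apply: FD; apply: isometric_sphere => //; exact: iT.
have iFT := bdm_integrableS hFT.
have E : sphere_integral (fun z => F (T s z) - F z - s%:C * G z) = - (s%:C * sphere_integral G).
  rewrite sphere_integralB; [|exact: integrableSB|exact: integrableSZ].
  rewrite sphere_integralB// sphere_integralZ//.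
  have -> : sphere_integral (fun z => F (T s z)) = sphere_integral F.
    by apply: (isometric_sphere_integral (iT _ s2)) => //; case: hF.
  by rewrite subrr sub0r.
have -> : s * normc (sphere_integral G) = normc (- (s%:C * sphere_integral G)).
  by rewrite normcN normcM normc_real gtr0_norm.
rewrite -E -lee_fin; apply: le_trans (le_normc_sphere_integral _) _.
  by apply: integrableSB; [exact: integrableSB|exact: integrableSZ].
apply: L1norm_bounded.
- by rewrite mulr_ge0// sqr_ge0.
- apply: L2_measurable; apply: L2B; last by apply: L2Z; exact: bdm_L2.
  by apply: L2B; exact: bdm_L2.
- by move=> z zS; exact: h.
Qed.

Lemma eq_uderiv T F G G' : uderiv T F G -> (forall z, G z = G' z) -> uderiv T F G'.
Proof. by move=> + GG; have -> : G = G' by exact/funext. Qed.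

Lemma uderivD T F G F' G' : uderiv T F G -> uderiv T F' G' ->
  uderiv T (fun z => F z + F' z) (fun z => G z + G' z).
Proof.
move=> [C C0 h] [D D0 h']; exists (C + D); first exact: addr_ge0.
move=> s z s2 zS; rewrite mulrDl; apply: le_trans (lerD (h s z s2 zS) (h' s z s2 zS)).
apply: le_trans (le_normcD _ _); rewrite le_eqVlt; apply/orP; left; apply/eqP.
by congr normc; ring.
Qed.

Lemma uderivM T F G F' G' : bdm F -> bdm G -> bdm F' -> bdm G' ->
  uderiv T F G -> uderiv T F' G' ->
  uderiv T (fun z => F z * F' z) (fun z => G z * F' z + F z * G' z).
Proof.
move=> /bdmP[A A0 hA] /bdmP[B B0 hB] /bdmP[A' A'0 hA'] /bdmP[B' B'0 hB'].
move=> [C C0 h] [D D0 h'].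
(* The first two terms come from the remainders of the two factors. The last bounds the product of
   the increments, each at most a constant times |s| since s^2 <= |s|. *)
exists (C * A' + A * D + (B + C) * (B' + D)).
  by rewrite !addr_ge0// mulr_ge0// addr_ge0.
move=> s z s2 zS.
set d := F (T s z) - F z - s%:C * G z.
set d' := F' (T s z) - F' z - s%:C * G' z.
have -> : F (T s z) * F' (T s z) - F z * F' z - s%:C * (G z * F' z + F z * G' z) =
  d * F' z + F z * d' + (s%:C * G z + d) * (s%:C * G' z + d').
  by rewrite /d /d'; ring.
have s20 : 0 <= s ^+ 2 by exact: sqr_ge0.
have ss : s ^+ 2 <= `|s|.
  rewrite -real_normK ?num_real// expr2 ler_piMr// (le_trans s2)//; lra.
have hd : normc d <= C * s ^+ 2 by exact: h.
have hd' : normc d' <= D * s ^+ 2 by exact: h'.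
have hG : normc (s%:C * G z + d) <= (B + C) * `|s|.
  rewrite (le_trans (le_normcD _ _))// normcM normc_real mulrDl lerD//.
    by rewrite mulrC ler_wpM2r// hB.
  by rewrite (le_trans hd)// ler_wpM2l.
have hG' : normc (s%:C * G' z + d') <= (B' + D) * `|s|.
  rewrite (le_trans (le_normcD _ _))// normcM normc_real mulrDl lerD//.
    by rewrite mulrC ler_wpM2r// hB'.
  by rewrite (le_trans hd')// ler_wpM2l.
rewrite (mulrDl (C * A' + A * D)) (mulrDl (C * A')) (le_trans (le_normcD _ _))// lerD//.
  rewrite (le_trans (le_normcD _ _))// lerD// normcM.
    by rewrite mulrAC ler_pM ?normc_ge0// hA'.
  by rewrite -mulrA ler_pM ?normc_ge0// hA.
rewrite normcM; apply: (@le_trans _ _ ((B + C) * `|s| * ((B' + D) * `|s|))).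
  by rewrite ler_pM ?normc_ge0.
by rewrite mulrACA -expr2 real_normK ?num_real.
Qed.

Lemma uderiv_conj T F G : uderiv T F G ->
  uderiv T (fun z => (F z)^*) (fun z => (G z)^*).
Proof.
move=> [C C0 h]; exists C => // s z s2 zS.
have conjr (x : R) : (x%:C)^* = x%:C :> R[i] by exact: conjc_real.
have <- : (F (T s z) - F z - s%:C * G z)^* = (F (T s z))^* - (F z)^* - s%:C * (G z)^*.
  by rewrite !rmorphB rmorphM /= conjr.
by rewrite normc_conj h.
Qed.

Lemma uderiv_cst T c : uderiv T (fun=> c) (fun=> 0).
Proof.
by exists 0 => // s z _ _; rewrite subrr sub0r mulr0 oppr0 normc0 mul0r.
Qed.

Lemma uderiv_rot (i j k : 'I_n) (u : R[i]) : i != j ->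
  uderiv (rot i j u) (fun z => z 0 k)
    (fun z => u * z 0 i * (k == j)%:R - u^* * z 0 j * (k == i)%:R).
Proof.
move=> ij; exists 1 => // s z s2 zS; rewrite mul1r mxE.
have [_ _ c1] := sqrt_1Bsqr s2.
have sqrtB1 : (Num.sqrt (1 - s ^+ 2))%:C - 1 = (Num.sqrt (1 - s ^+ 2) - 1)%:C :> R[i].
  by rewrite rmorphB rmorph1.
have ji : (j == i) = false by rewrite eq_sym (negbTE ij).
have zk l : normc (z 0 l) <= 1 by rewrite -[leRHS]zS cnorm_coord.
have key l : normc (((Num.sqrt (1 - s ^+ 2))%:C - 1) * z 0 l) <= s ^+ 2.
  rewrite normcM sqrtB1 normc_real.
  by rewrite -[leRHS]mulr1 ler_pM ?normc_ge0.
have [->|ki] := eqVneq k i.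
  rewrite (negbTE ij) mulr0 sub0r mulr1.
  by apply: le_trans (key i); rewrite le_eqVlt; apply/orP; left; apply/eqP; congr normc; ring.
have [->|kj] := eqVneq k j.
  rewrite mulr0 subr0 mulr1.
  by apply: le_trans (key j); rewrite le_eqVlt; apply/orP; left; apply/eqP; congr normc; ring.
by rewrite subrr !mulr0 subrr mulr0 subrr normc0 sqr_ge0.
Qed.

Lemma uderiv_phase (i k : 'I_n) :
  uderiv (phase i) (fun z => z 0 k) (fun z => 'i%C * z 0 i * (k == i)%:R).
Proof.
exists 1 => // s z s2 zS; rewrite mul1r mxE.
have [_ _ c1] := sqrt_1Bsqr s2.
have sqrtB1 : (Num.sqrt (1 - s ^+ 2))%:C - 1 = (Num.sqrt (1 - s ^+ 2) - 1)%:C :> R[i].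
  by rewrite rmorphB rmorph1.
have [->|ki] := eqVneq k i; last first.
  by rewrite subrr mulr0 sub0r mulr0 oppr0 normc0 sqr_ge0.
have zk : normc (z 0 i) <= 1 by rewrite -[leRHS]zS cnorm_coord.
have -> : (Num.sqrt (1 - s ^+ 2) +i* s) * z 0 i - z 0 i - s%:C * ('i%C * z 0 i * 1) =
  ((Num.sqrt (1 - s ^+ 2))%:C - 1) * z 0 i.
  rewrite [_ +i* s]complexE /=; ring.
rewrite normcM sqrtB1 normc_real.
by rewrite -[leRHS]mulr1 ler_pM ?normc_ge0.
Qed.

(* [f] behaves as a holomorphic polynomial with partial derivatives [df]. *)
Definition hol (f : Cn -> R[i]) (df : 'I_n -> Cn -> R[i]) :=
  [/\ bdm f, forall k, bdm (df k),
     forall i j u, i != j -> normc u = 1 -> uderiv (rot i j u) f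
       (fun z => u * z 0 i * df j z - u^* * z 0 j * df i z) &
     forall i, uderiv (phase i) f (fun z => 'i%C * z 0 i * df i z)].

Lemma bdm_rotfield (i j : 'I_n) (u : R[i]) (df : 'I_n -> Cn -> R[i]) :
  (forall k, bdm (df k)) -> bdm (fun z => u * z 0 i * df j z - u^* * z 0 j * df i z).
Proof.
move=> hdf; apply: (@eq_bdm (fun z => u * z 0 i * df j z + (- u^*) * z 0 j * df i z)).
  by apply: bdmD; apply: bdmM => //; apply: bdmM;
    [exact: bdm_cst|exact: bdm_coord|exact: bdm_cst|exact: bdm_coord].
by move=> z; rewrite !mulNr.
Qed.

Lemma bdm_phasefield (i : 'I_n) (df : 'I_n -> Cn -> R[i]) :
  (forall k, bdm (df k)) -> bdm (fun z => 'i%C * z 0 i * df i z).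
Proof.
by move=> hdf; apply: bdmM => //; apply: bdmM; [exact: bdm_cst|exact: bdm_coord].
Qed.

Lemma hol_cst c : hol (fun=> c) (fun=> fun=> 0).
Proof.
split=> [|k|i j u _ _|i]; try exact: bdm_cst.
  by apply: eq_uderiv (uderiv_cst _ _) _ => z; rewrite !mulr0 subrr.
by apply: eq_uderiv (uderiv_cst _ _) _ => z; rewrite !mulr0.
Qed.

Lemma hol_coord k : hol (fun z => z 0 k) (fun l => fun=> (k == l)%:R).
Proof.
split=> [|l|i j u ij _|i]; [exact: bdm_coord|exact: bdm_cst|exact: uderiv_rot|].
exact: uderiv_phase.
Qed.

Lemma holD f df g dg : hol f df -> hol g dg ->
  hol (fun z => f z + g z) (fun k z => df k z + dg k z).
Proof.
move=> [bf bdf rf pf] [bg bdg rg pg]; split=> [|k|i j u ij u1|i].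
- exact: bdmD.
- exact: bdmD.
- by apply: eq_uderiv (uderivD (rf _ _ _ ij u1) (rg _ _ _ ij u1)) _ => z; ring.
- by apply: eq_uderiv (uderivD (pf i) (pg i)) _ => z; ring.
Qed.

Lemma holM f df g dg : hol f df -> hol g dg ->
  hol (fun z => f z * g z) (fun k z => df k z * g z + f z * dg k z).
Proof.
move=> [bf bdf rf pf] [bg bdg rg pg]; split=> [|k|i j u ij u1|i].
- exact: bdmM.
- by apply: bdmD; exact: bdmM.
- apply: eq_uderiv (uderivM _ _ _ _ (rf _ _ _ ij u1) (rg _ _ _ ij u1)) _ => //;
    try exact: bdm_rotfield.
  by move=> z; ring.
- apply: eq_uderiv (uderivM _ _ _ _ (pf i) (pg i)) _ => //;
    try exact: bdm_phasefield.
  by move=> z; ring.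
Qed.

Lemma hol_ext f df g dg : (forall z, f z = g z) -> (forall k z, df k z = dg k z) ->
  hol f df -> hol g dg.
Proof.
move=> fg dfg; have -> : f = g by exact/funext.
by have -> : df = dg by apply/funext => k; apply/funext => z.
Qed.

Lemma hol_sum (I : Type) (s : seq I) (f : I -> Cn -> R[i]) (df : I -> 'I_n -> Cn -> R[i]) :
  (forall i, hol (f i) (df i)) ->
  hol (fun z => \sum_(i <- s) f i z) (fun k z => \sum_(i <- s) df i k z).
Proof.
move=> hf; elim: s => [|i s ih].
  by apply: hol_ext (hol_cst 0) => [z|k z]; rewrite big_nil.
by apply: hol_ext (holD (hf i) ih) => [z|k z]; rewrite big_cons.
Qed.

Lemma holX f df k : hol f df ->
  hol (fun z => f z ^+ k) (fun i z => k%:R * f z ^+ k.-1 * df i z).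
Proof.
move=> hf; elim: k => [|k ih].
  by apply: hol_ext (hol_cst 1) => [z|i z]; rewrite ?expr0 ?mul0r.
apply: hol_ext (holM hf ih) => [z|i z]; first by rewrite exprS.
case: k {ih} => [|k] /=; first by rewrite !expr0; ring.
by rewrite -[in RHS]natr1 exprS; ring.
Qed.

(** Apply [sphere_integral_uderiv] to f times the conjugate of g. Along [rot i j u] this gives a
    relation, linear in u and its conjugate, between the integrals for (i, j) and (j, i); u = 1 and
    u = ['i%C] yield two equations whose sum is twice the claim. For i = j the rotation is replaced
    by [phase i]. *)
Lemma hol_by_parts f df g dg i j : hol f df -> hol g dg ->
  sphere_integral (fun z => z 0 i * df j z * (g z)^*) =
  sphere_integral (fun z => f z * (z 0 j * dg i z)^*).
Proof.
move=> [bf bdf rf pf] [bg bdg rg pg].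
pose A i j := sphere_integral (fun z => z 0 i * df j z * (g z)^*).
pose Q i j := sphere_integral (fun z => f z * (z 0 j * dg i z)^*).
have bA k l : bdm (fun z => z 0 k * df l z * (g z)^*).
  by apply: bdmM; [apply: bdmM => //; exact: bdm_coord|exact: bdm_conj].
have bQ k l : bdm (fun z => f z * (z 0 l * dg k z)^*).
  by apply: bdmM => //; apply: bdm_conj; apply: bdmM => //; exact: bdm_coord.
rewrite -/(A i j) -/(Q i j).
have [<-|ij] := eqVneq i j.
  have := @sphere_integral_uderiv (phase i) (fun z => f z * (g z)^*) _
    (isometric_phase i) (bdmM bf (bdm_conj bg)) _
    (uderivM bf (bdm_phasefield i bdf) (bdm_conj bg)
      (bdm_conj (bdm_phasefield i bdg)) (pf i) (uderiv_conj (pg i))).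
  rewrite (eq_sphere_integral (g := fun z => 'i%C * (z 0 i * df i z * (g z)^*) +
     (- 'i%C) * (f z * (z 0 i * dg i z)^*))); last first.
    move=> z _; rewrite -(mulrA 'i%C (z 0 i) (dg i z)).
    have -> : ('i%C * (z 0 i * dg i z))^* = - 'i%C * (z 0 i * dg i z)^*.
      rewrite rmorphM; congr (_ * _).
      by apply/eqP; rewrite eq_complex /= oppr0 !eqxx.
    by ring.
  rewrite sphere_integralD; try by apply: integrableSZ; exact: bdm_integrableS.
  rewrite !sphere_integralZ; try exact: bdm_integrableS.
  move=> /(_ _)/eqP; rewrite mulNr subr_eq0 => E.
  have i0 : 'i%C != 0 :> R[i] by rewrite eq_complex /= oner_eq0 andbF.
  apply: (mulfI i0); apply/eqP; apply: E.
  exact: (bdmD (bdmM (bdm_phasefield i bdf) (bdm_conj bg))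
    (bdmM bf (bdm_conj (bdm_phasefield i bdg)))).
have key u : normc u = 1 -> u * A i j - u^* * A j i + u^* * Q j i - u * Q i j = 0.
  move=> u1; have := @sphere_integral_uderiv (rot i j u) (fun z => f z * (g z)^*) _
    (fun s => @isometric_rot i j u s ij u1) (bdmM bf (bdm_conj bg)) _
    (uderivM bf (bdm_rotfield i j u bdf) (bdm_conj bg)
      (bdm_conj (bdm_rotfield i j u bdg)) (rf _ _ _ ij u1) (uderiv_conj (rg _ _ _ ij u1))).
  rewrite (eq_sphere_integral (g := fun z => u * (z 0 i * df j z * (g z)^*) +
     (- u^*) * (z 0 j * df i z * (g z)^*) + u^* * (f z * (z 0 i * dg j z)^*) +
     (- u) * (f z * (z 0 j * dg i z)^*))); last first.
    by move=> z _; rewrite !(rmorphB, rmorphM) /= conjCK; ring.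
  have bZ c h : bdm h -> bdm (fun z : Cn => c * h z) by move=> ?; apply: bdmM => //; exact: bdm_cst.
  have b2 := bdmD (bZ u _ (bA i j)) (bZ (- u^*) _ (bA j i)).
  have b3 := bdmD b2 (bZ u^* _ (bQ j i)).
  have b4 := bdmD b3 (bZ (- u) _ (bQ i j)).
  move=> /(_ (eq_bdm b4 _)) E; rewrite -E//; last first.
    by move=> z; rewrite !(rmorphB, rmorphM) /= conjCK; ring.
  move=> {E}.
  rewrite sphere_integralD; [|exact: bdm_integrableS|exact/bdm_integrableS/bZ].
  rewrite sphere_integralD; [|exact: bdm_integrableS|exact/bdm_integrableS/bZ].
  rewrite sphere_integralD; [|exact/bdm_integrableS/bZ|exact/bdm_integrableS/bZ].
  by rewrite !sphere_integralZ; try exact: bdm_integrableS; rewrite -/(A _ _) !mulNr.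
have k1 := key 1 (@normc1 _).
have ki := key 'i%C.
rewrite (_ : ('i%C)^* = - 'i%C) in ki; last by apply/eqP; rewrite eq_complex /= oppr0 !eqxx.
have i0 : 'i%C != 0 :> R[i] by rewrite eq_complex /= oner_eq0 andbF.
have {}ki : A i j + A j i - Q j i - Q i j = 0.
  by apply: (mulfI i0); rewrite mulr0 -ki; [ring|rewrite /= expr0n expr1n add0r sqrtr1].
rewrite conjC1 !mul1r in k1.
apply/eqP; rewrite -subr_eq0; apply/eqP; apply: (@mulfI _ 2%:R); first by rewrite pnatr_eq0.
rewrite mulr0 -[RHS](addr0 0) -[in X in _ = X + _]k1 -[X in _ = _ + X]ki; ring.
Qed.

End rotations.

(** * The reproducing property of the Szego kernel *)

Section words.
Context {R : realType} (n : nat).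
Local Notation Cn := 'rV[R[i]]_n.
Local Notation S := (unit_sphere R n).
Implicit Types (s : seq 'I_n) (p : seq (R[i] * seq 'I_n)) (z w : Cn).

(* Monomials are indexed by words in the coordinates, polynomials by lists of weighted words. *)
Definition mono s z : R[i] := \prod_(l <- s) z 0 l.

Definition weval p z : R[i] := \sum_(t <- p) t.1 * mono t.2 z.

(* [weval (dw i s)] is the i-th partial derivative of [mono s]. *)
Fixpoint dw (i : 'I_n) s : seq (R[i] * seq 'I_n) :=
  if s is l :: s' then ((l == i)%:R, s') :: [seq (t.1, l :: t.2) | t <- dw i s']
  else [::].

Lemma mono_nil z : mono [::] z = 1. Proof. by rewrite /mono big_nil. Qed.
Lemma mono_cons l s z : mono (l :: s) z = z 0 l * mono s z.
Proof. by rewrite /mono big_cons. Qed.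
Lemma mono_cat s t z : mono (s ++ t) z = mono s z * mono t z.
Proof. by rewrite /mono big_cat. Qed.

Lemma weval_cons t p z : weval (t :: p) z = t.1 * mono t.2 z + weval p z.
Proof. by rewrite /weval big_cons. Qed.

Lemma weval_dw_nil i z : weval (dw i [::]) z = 0.
Proof. by rewrite /weval big_nil. Qed.

Lemma weval_dw_cons i l s z : weval (dw i (l :: s)) z =
  (l == i)%:R * mono s z + z 0 l * weval (dw i s) z.
Proof.
rewrite /= weval_cons /=; congr (_ + _).
rewrite /weval big_map mulr_sumr; apply: eq_bigr => t _ /=.
by rewrite mono_cons mulrCA.
Qed.

Lemma size_dw i s t : t \in dw i s -> size s = (size t.2).+1.
Proof.
elim: s t => [//|l s ih] t; rewrite inE => /orP[/eqP -> //|/mapP[u us ->]] /=.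
by rewrite (ih u us).
Qed.

Lemma hol_mono s : hol (mono s) (fun i => weval (dw i s)).
Proof.
elim: s => [|l s ih].
  by apply: hol_ext (hol_cst _ 1) => [z|k z]; rewrite ?mono_nil ?weval_dw_nil.
by apply: hol_ext (holM (hol_coord l) ih) => [z|k z]; rewrite ?mono_cons ?weval_dw_cons.
Qed.

Lemma euler_mono s z : \sum_i z 0 i * weval (dw i s) z = (size s)%:R * mono s z.
Proof.
elim: s => [|l s ih].
  by rewrite mul0r big1// => i _; rewrite weval_dw_nil mulr0.
under eq_bigr do rewrite weval_dw_cons mulrDr mulrCA [X in _ + X]mulrCA.
rewrite big_split /= -mulr_sumr ih (bigD1 l)//= eqxx big1 ?addr0; last first.
  by move=> i il; rewrite eq_sym (negbTE il) mul0r.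
by rewrite mul1r mono_cons -(natr1 (size s)); ring.
Qed.

Lemma hol_hip w : hol (fun z => hip z w) (fun i => fun=> (w 0 i)^*).
Proof.
have h (l : 'I_n) : hol (fun z => z 0 l * (w 0 l)^*) (fun i => fun=> (l == i)%:R * (w 0 l)^*).
  by apply: hol_ext (holM (hol_coord l) (hol_cst _ (w 0 l)^*)) => [//|k z]; rewrite mulr0 addr0.
apply: hol_ext (hol_sum (index_enum _) h) => // k z.
rewrite (bigD1 k)//= eqxx mul1r big1 ?addr0// => i ik.
by rewrite (negbTE ik) mul0r.
Qed.

Lemma hol_hipX w k : hol (fun z => hip z w ^+ k) (fun i z => k%:R * hip z w ^+ k.-1 * (w 0 i)^*).
Proof. exact: holX (hol_hip w). Qed.

Lemma euler_hipX w k z :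
  \sum_i z 0 i * (k%:R * hip z w ^+ k.-1 * (w 0 i)^*) = k%:R * hip z w ^+ k.
Proof.
under eq_bigr do rewrite mulrCA.
rewrite -mulr_sumr -/(hip z w); case: k => [|k]; first by rewrite !mul0r.
by rewrite /= -mulrA -exprSr.
Qed.

Lemma sphere_sum_sqr z : S z -> \sum_i z 0 i * (z 0 i)^* = 1.
Proof.
move=> zS; under eq_bigr do rewrite mulc_conj.
by rewrite -rmorph_sum -cnorm_sqr (zS : cnorm z = 1) expr1n.
Qed.

(** Integrate by parts with z_j f in place of f and sum over j. On one side Euler's identity
    produces n + d, on the other the factors |z_j|^2 add up to 1 on the sphere. On degree d,
    multiplication by z_i is thus adjoint to the i-th derivative divided by n + d. *)
Lemma hol_adjoint f df (d : nat) g dg i :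
  hol f df -> (forall z, \sum_j z 0 j * df j z = d%:R * f z) -> hol g dg ->
  (n + d)%:R * sphere_integral (fun z => z 0 i * f z * (g z)^*) =
  sphere_integral (fun z => f z * (dg i z)^*).
Proof.
move=> hf ef hg; have [bf bdf _ _] := hf; have [bg bdg _ _] := hg.
(* The factor [(j == j)%:R] is the derivative of z_j in the form produced by [holM] and
   [hol_coord]. *)
pose F (j : 'I_n) z := z 0 i * ((j == j)%:R * f z + z 0 j * df j z) * (g z)^*.
pose G (j : 'I_n) z := z 0 j * f z * (z 0 j * dg i z)^*.
have FG j : sphere_integral (F j) = sphere_integral (G j).
  exact: (hol_by_parts i j (holM (hol_coord j) hf) hg).
have iF j : integrableS (F j).
  apply: bdm_integrableS; apply: bdmM; last exact: bdm_conj.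
  apply: bdmM; first exact: bdm_coord.
  apply: bdmD; apply: bdmM => //; [exact: bdm_cst|exact: bdm_coord].
have iG j : integrableS (G j).
  apply: bdm_integrableS; apply: bdmM; first by apply: bdmM => //; exact: bdm_coord.
  by apply: bdm_conj; apply: bdmM => //; exact: bdm_coord.
transitivity (\sum_j sphere_integral (F j)).
  rewrite -sphere_integral_sum// -sphere_integralZ; last first.
    apply: bdm_integrableS; apply: bdmM; last exact: bdm_conj.
    by apply: bdmM => //; exact: bdm_coord.
  apply: eq_sphere_integral => z _; rewrite -mulr_suml -mulr_sumr big_split /= ef.
  under eq_bigr do rewrite eqxx mul1r.
  by rewrite sumr_const card_ord natrD -[X in _ * (X + _)]mulr_natl; ring.
rewrite (eq_bigr _ (fun j _ => FG j)) -sphere_integral_sum//.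
apply: eq_sphere_integral => z zS; rewrite -[RHS]mul1r -(sphere_sum_sqr zS) mulr_suml.
by apply: eq_bigr => j _; rewrite /G rmorphM /=; ring.
Qed.

(** By [hol_by_parts] with i = j the Euler operator is symmetric, and f and g are eigenvectors for
    distinct eigenvalues. *)
Lemma hol_degree_orthogonal f df (d : nat) g dg (e : nat) :
  hol f df -> (forall z, \sum_j z 0 j * df j z = d%:R * f z) ->
  hol g dg -> (forall z, \sum_j z 0 j * dg j z = e%:R * g z) -> d != e ->
  sphere_integral (fun z => f z * (g z)^*) = 0.
Proof.
move=> hf ef hg eg de; have [bf bdf _ _] := hf; have [bg bdg _ _] := hg.
have bfg := bdm_integrableS (bdmM bf (bdm_conj bg)).
have : d%:R * sphere_integral (fun z => f z * (g z)^*) =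
       e%:R * sphere_integral (fun z => f z * (g z)^*).
  rewrite -!sphere_integralZ//.
  transitivity (\sum_i sphere_integral (fun z => z 0 i * df i z * (g z)^*)).
    rewrite -sphere_integral_sum; last first.
      move=> i; apply: bdm_integrableS; apply: bdmM; last exact: bdm_conj.
      by apply: bdmM => //; exact: bdm_coord.
    by apply: eq_sphere_integral => z _; rewrite -mulr_suml ef mulrA.
  rewrite (eq_bigr _ (fun i _ => hol_by_parts i i hf hg)) -sphere_integral_sum; last first.
    move=> i; apply: bdm_integrableS; apply: bdmM => //; apply: bdm_conj.
    by apply: bdmM => //; exact: bdm_coord.
  apply: eq_sphere_integral => z _.
  by rewrite -mulr_sumr -rmorph_sum eg rmorphM /= rmorph_nat; ring.
move/eqP; rewrite -subr_eq0 -mulrBl mulf_eq0 => /orP[|/eqP//].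
by rewrite subr_eq0 eqr_nat (negbTE de).
Qed.

Lemma sphere_integral1 : (0 < n)%N -> sphere_integral ((fun=> 1) : Cn -> R[i]) = 1.
Proof.
move=> n0; rewrite /sphere_integral /= !integral_cst; try exact: measurable_unit_sphere.
by have h := sigma_sphere n0; rewrite [X in fine (1 * X)%E]h mule1 mul0e.
Qed.

(** The binomial is the coefficient of x^k in (1 - x)^-n, so this is the reproducing property for
    the part of degree k of the kernel. Different degrees are orthogonal; within one degree the
    proof is by induction on the word, [hol_adjoint] moving its first letter onto the kernel. *)
Lemma mono_hipX s w k : (0 < n)%N ->
  'C(n.-1 + k, k)%:R * sphere_integral (fun z => mono s z * (hip z w ^+ k)^*) =
  if size s == k then mono s w else 0.
Proof.
move=> n0; case: eqVneq => [<-{k}|sk]; last first.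
  rewrite (hol_degree_orthogonal (hol_mono s) (euler_mono s) (hol_hipX w k) (euler_hipX w k) sk).
  by rewrite mulr0.
elim: s => [|i s ih].
  rewrite addn0 bin0 mul1r mono_nil -[RHS](sphere_integral1 n0).
  by apply: eq_sphere_integral => z _; rewrite mono_nil expr0 conjC1 mulr1.
have := hol_adjoint i (hol_mono s) (euler_mono s) (hol_hipX w (size s).+1).
rewrite mono_cons -ih [X in _ = X -> _](eq_sphere_integral (g := fun z =>
  ((size s).+1%:R * w 0 i) * (mono s z * (hip z w ^+ (size s))^*))); last first.
  by move=> z _; rewrite !rmorphM /= conjCK rmorph_nat; ring.
rewrite sphere_integralZ; last first.
  apply: bdm_integrableS; apply: bdmM; first by case: (hol_mono s).
  by apply: bdm_conj; case: (hol_hipX w (size s)).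
rewrite (eq_sphere_integral (g := fun z => mono (i :: s) z * (hip z w ^+ (size s).+1)^*));
  last by move=> z _; rewrite mono_cons.
rewrite /=; set I := sphere_integral _; set J := sphere_integral _ => E.
have nz : (n + size s)%:R != 0 :> R[i] by rewrite pnatr_eq0 -lt0n addn_gt0 n0.
apply: (mulfI nz); rewrite mulrCA E.
(* With k = [size s], (n + k) C(n - 1 + k, k) = (k + 1) C(n + k, k + 1) matches the factor n + k of
   [hol_adjoint] with the factor k + 1 from differentiating the power. *)
have := mul_bin_diag (n + size s) (size s).
have -> : (n + size s).-1 = (n.-1 + size s)%N by lia.
have -> : (n.-1 + (size s).+1)%N = (n + size s)%N by lia.
move/(congr1 (fun k => k%:R : R[i])); rewrite !natrM => E'.
transitivity (((size s).+1%:R * 'C(n + size s, (size s).+1)%:R) * (w 0 i * J)); first by ring.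
by rewrite -E'; ring.
Qed.

End words.

(** * The negative binomial series, with a geometric rate of convergence *)

Section negative_binomial.
Context {R : realType}.

(** Partial sum of the series of (1 - x)^-(m+1); the Szego kernel is the case m = n - 1. *)
Definition nbsum (F : pzRingType) m N (x : F) : F := \sum_(k < N) 'C(m + k, k)%:R * x ^+ k.

Lemma nbsum0 (F : comPzRingType) N (x : F) : (1 - x) * nbsum 0 N x = 1 - x ^+ N.
Proof.
rewrite /nbsum; under eq_bigr do rewrite add0n binn mul1r.
by rewrite -opprB mulNr -subrX1 opprB.
Qed.

(** By Pascal's rule, multiplication by 1 - x lowers the exponent by one up to a truncation term;
    the bound and the convergence below are inductions on m along this identity. *)
Lemma nbsumS (F : comPzRingType) m N (x : F) :
  (1 - x) * nbsum m.+1 N.+1 x = nbsum m N.+1 x - 'C(m.+1 + N, N)%:R * x ^+ N.+1.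
Proof.
elim: N => [|N ih].
  by rewrite /nbsum !big_ord_recr !big_ord0 /= !addn0 !bin0 expr1 expr0; ring.
rewrite /nbsum big_ord_recr /= mulrDr -/(nbsum _ _ _) ih [in RHS]big_ord_recr /= -/(nbsum _ _ _).
have -> : (m + N.+1)%N = (m.+1 + N)%N by rewrite addnS.
have -> : (m.+1 + N.+1)%N = (m.+1 + N).+1 by rewrite addnS.
by rewrite binS natrD (exprS x N.+1); ring.
Qed.

Lemma nbsum_ge0 m N (r : R) : 0 <= r -> 0 <= nbsum m N r.
Proof. by move=> r0; apply: sumr_ge0 => k _; rewrite mulr_ge0 ?exprn_ge0. Qed.

Lemma nbsum_le m N (r : R) : 0 <= r < 1 -> nbsum m N r <= (1 - r) ^- m.+1.
Proof.
move=> /andP[r0 r1]; have r1' : 0 < 1 - r by rewrite subr_gt0.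
elim: m => [|m ih].
  rewrite expr1 -(ler_pM2l r1') nbsum0 mulfV ?gt_eqF// gerBl exprn_ge0//.
case: N ih => [|N] ih; first by rewrite /nbsum big_ord0 invr_ge0 exprn_ge0// ltW.
have -> : (1 - r) ^- m.+2 = (1 - r)^-1 * (1 - r) ^- m.+1 by rewrite exprS invfM.
rewrite -(ler_pM2l r1') nbsumS mulrA mulfV ?gt_eqF// mul1r.
by rewrite (le_trans _ ih)// gerBl mulr_ge0// exprn_ge0.
Qed.

Lemma nbcoef_le m k (r : R) : 0 <= r < 1 -> 'C(m + k, k)%:R * r ^+ k <= (1 - r) ^- m.+1.
Proof.
move=> r01; apply: le_trans (nbsum_le m k.+1 r01).
by rewrite /nbsum big_ord_recr /= lerDr nbsum_ge0//; case/andP: r01.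
Qed.

Lemma normc1B (x : R[i]) : 1 - normc x <= normc (1 - x).
Proof.
rewrite lerBlDr -[leLHS](normc1 R); apply: le_trans (le_normcD _ _).
by rewrite subrK.
Qed.

Lemma nbsum_cvg m (rho : R) : 0 <= rho < 1 ->
  exists2 C : R, 0 <= C & exists2 q : R, 0 <= q < 1 & forall N (x : R[i]), normc x <= rho ->
    normc (nbsum m N x - (1 - x) ^- m.+1) <= C * q ^+ N.
Proof.
(* An intermediate radius: by [nbcoef_le] the binomial coefficients grow at most like r^-k, so the
   truncation term at radius rho decays like (rho / r)^N. The same q serves for all m; only C
   changes in the induction. *)
move=> /andP[rho0 rho1]; pose r := (1 + rho) / 2.
have r0 : 0 < r by rewrite /r; lra.
have r1 : r < 1 by rewrite /r; lra.
pose q := rho / r; have q0 : 0 <= q by rewrite divr_ge0// ltW.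
have q1 : q < 1 by rewrite ltr_pdivrMr// mul1r /r; lra.
have rq : rho <= q by rewrite ler_pdivlMr// ler_piMr// ltW.
have qr : q * r = rho by rewrite divfK// gt_eqF.
suff [C C0 h] : exists2 C : R, 0 <= C & forall N (x : R[i]), normc x <= rho ->
    normc (nbsum m N x - (1 - x) ^- m.+1) <= C * q ^+ N.
  by exists C => //; exists q => //; rewrite q0.
have inv_le (x : R[i]) : normc x <= rho -> normc (1 - x)^-1 <= (1 - rho)^-1.
  move=> xr; rewrite normcV lef_pV2 ?posrE ?subr_gt0//.
    by apply: le_trans (normc1B x); rewrite lerB.
  by apply: lt_le_trans (normc1B x); rewrite subr_gt0 (le_lt_trans xr).
have x1 (x : R[i]) : normc x <= rho -> 1 - x != 0.
  move=> xr; rewrite -normc_gt0; apply: lt_le_trans (normc1B x).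
  by rewrite subr_gt0 (le_lt_trans xr).
elim: m => [|m [C C0 ih]].
  exists (1 - rho)^-1; first by rewrite invr_ge0 subr_ge0 ltW.
  move=> N x xr; rewrite expr1.
  have -> : nbsum 0 N x - (1 - x)^-1 = (1 - x)^-1 * - x ^+ N.
    by apply: (mulfI (x1 _ xr)); rewrite mulrBr nbsum0 mulrA mulfV ?x1// mul1r; ring.
  rewrite normcM normcN normcX ler_pM ?normc_ge0 ?exprn_ge0 ?normc_ge0//; first exact: inv_le.
  by rewrite lerXn2r ?nnegrE ?normc_ge0// (le_trans xr).
have ir : 0 <= (1 - rho)^-1 by rewrite invr_ge0 subr_ge0 ltW.
have irm : 0 <= (1 - rho) ^- m.+2 by rewrite invr_ge0 exprn_ge0// subr_ge0 ltW.
pose M := (1 - r) ^- m.+2; have M0 : 0 <= M by rewrite invr_ge0 exprn_ge0// subr_ge0 ltW.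
(* The last summand covers N = 0, which [nbsumS] leaves out. *)
exists ((1 - rho)^-1 * (C + M) + (1 - rho) ^- m.+2).
  by rewrite addr_ge0// mulr_ge0// addr_ge0.
case=> [|N] x xr.
  rewrite /nbsum big_ord0 sub0r normcN expr0 mulr1 -exprVn normcX.
  rewrite -[leLHS]add0r lerD//; first by rewrite mulr_ge0// addr_ge0.
  by rewrite -exprVn lerXn2r ?nnegrE ?normc_ge0 ?inv_le.
have -> : nbsum m.+1 N.+1 x - (1 - x) ^- m.+2 = (1 - x)^-1 *
    ((nbsum m N.+1 x - (1 - x) ^- m.+1) - 'C(m.+1 + N, N)%:R * x ^+ N.+1).
  apply: (mulfI (x1 _ xr)); rewrite mulrBr nbsumS mulrA mulfV ?x1// mul1r.
  by rewrite (exprS _ m.+1) invfM mulrA mulfV ?x1//; ring.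
rewrite mulrDl -[leLHS]addr0 lerD//; last first.
  by rewrite mulr_ge0// exprn_ge0.
rewrite normcM -mulrA ler_pM ?normc_ge0 ?inv_le//.
rewrite (le_trans (le_normcB _ _))// mulrDl lerD ?ih//.
rewrite normcM normcX -(rmorph_nat (real_complex R)) normc_real ger0_norm//.
apply: (@le_trans _ _ ('C(m.+1 + N, N)%:R * (q * r) ^+ N.+1)).
  by rewrite ler_wpM2l// qr lerXn2r ?nnegrE ?normc_ge0.
rewrite exprMn mulrCA mulrC ler_wpM2r ?exprn_ge0//.
have rr : 0 <= r < 1 by rewrite (ltW r0).
apply: le_trans (nbcoef_le m.+1 N rr); rewrite exprSr mulrA.
by apply: ler_piMr; rewrite ?(ltW r1)// mulr_ge0// exprn_ge0// ltW.
Qed.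

Lemma expr_cvg0 (C q e : R) : 0 <= q < 1 -> 0 < e -> exists N0, forall N, (N0 <= N)%N -> C * q ^+ N < e.
Proof.
move=> /andP[q0 q1] e0.
have h : C * q ^+ N @[N --> \oo] --> C * 0.
  by apply: cvgMl_tmp; apply: cvg_expr; rewrite ger0_norm.
rewrite mulr0 in h; have /cvgrPdist_lt /(_ e e0)[N0 _ hN] := h.
exists N0 => N NN; have := hN N NN; rewrite sub0r normrN.
by apply: le_lt_trans; exact: ler_norm.
Qed.

End negative_binomial.

(** * Polynomial approximation of the Szego kernel *)

Section szego_kernel.
Context {R : realType} (n : nat).
Local Notation Cn := 'rV[R[i]]_n.
Local Notation S := (unit_sphere R n).
Implicit Types (z w : Cn) (f : Cn -> R[i]).

Lemma hip_le z w : normc (hip z w) <= cnorm z * cnorm w.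
Proof.
have [z0|z0] := eqVneq (cnorm z) 0.
  rewrite z0 mul0r (cnorm_eq0 z0) /hip big1 ?normc0// => i _.
  by rewrite mxE mul0r.
have [w0|w0] := eqVneq (cnorm w) 0.
  rewrite w0 mulr0 (cnorm_eq0 w0) /hip big1 ?normc0// => i _.
  by rewrite mxE conjC0 mulr0.
have zp : 0 < cnorm z by rewrite lt_neqAle eq_sym z0 cnorm_ge0.
have wp : 0 < cnorm w by rewrite lt_neqAle eq_sym w0 cnorm_ge0.
apply: (le_trans (normc_sum _ _ _)).
(* The weight for which ab <= (t a^2 + t^-1 b^2)/2, summed over the coordinates, gives the product
   of the norms. *)
pose t := cnorm w / cnorm z; have t0 : 0 < t by rewrite divr_gt0.
apply: (@le_trans _ _ (\sum_i (t / 2 * normc (z 0 i) ^+ 2 + t^-1 / 2 * normc (w 0 i) ^+ 2))).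
  apply: ler_sum => i _; rewrite normcM normc_conj.
  set a := normc (z 0 i); set b := normc (w 0 i).
  rewrite -subr_ge0 [leRHS](_ : _ = (2 * t)^-1 * (t * a - b) ^+ 2).
    by rewrite mulr_ge0 ?sqr_ge0// invr_ge0 mulr_ge0// ltW.
  by field; rewrite gt_eqF.
rewrite big_split /= -!mulr_sumr -!cnorm_sqr /t le_eqVlt; apply/orP; left; apply/eqP.
by field; rewrite z0 w0.
Qed.

Lemma hip_conj z w : (hip z w)^* = hip w z.
Proof.
by rewrite /hip rmorph_sum; apply: eq_bigr => i _; rewrite rmorphM /= conjCK mulrC.
Qed.

Lemma szego_conj z w : (szego z w)^* = szego w z.
Proof.
rewrite /szego fmorphV rmorphXn rmorphB rmorph1 /=.
by rewrite -[in RHS](hip_conj z w).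
Qed.

Lemma measurable_hip w : measurable_fun setT (fun z => hip z w).
Proof. by have [[]] := hol_hip w. Qed.

Lemma measurable_szego w : measurable_fun setT (fun z => szego z w).
Proof.
apply: measurable_funcV => //; apply: measurable_funcX => //.
apply: (@eq_measurable_fun _ _ _ _ _ (fun z => 1 + (- 1) * hip z w)).
  by move=> z _; rewrite mulN1r.
apply: measurable_funcD => //; apply: measurable_funcM => //.
exact: measurable_hip.
Qed.

Lemma hip_lt1 z w : cnorm z <= 1 -> cnorm w < 1 -> normc (hip z w) <= cnorm w.
Proof.
move=> z1 w1; apply: le_trans (hip_le z w) _.
by rewrite ler_piMl// cnorm_ge0.
Qed.

Lemma onesubhip_neq0 z w : cnorm z <= 1 -> cnorm w < 1 -> 1 - hip z w != 0.
Proof.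
move=> z1 w1; rewrite -normc_gt0; apply: lt_le_trans (normc1B _).
by rewrite subr_gt0 (le_lt_trans (hip_lt1 z1 w1)).
Qed.

Lemma szego_le z w : cnorm z <= 1 -> cnorm w < 1 ->
  normc (szego z w) <= (1 - cnorm w) ^- n.
Proof.
move=> z1 w1; rewrite /szego -!exprVn normcX lerXn2r ?nnegrE ?normc_ge0//.
  by rewrite invr_ge0 subr_ge0 ltW.
rewrite normcV lef_pV2 ?posrE ?subr_gt0//; last by rewrite normc_gt0 onesubhip_neq0.
by apply: le_trans (normc1B _); rewrite lerB// hip_lt1.
Qed.

Lemma bdm_szego w : cnorm w < 1 -> bdm (fun z => szego z w).
Proof.
move=> w1; split; first exact: measurable_szego.
by exists ((1 - cnorm w) ^- n) => z zS; apply: szego_le => //; rewrite zS.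
Qed.

Definition szego_sum N z w : R[i] := nbsum n.-1 N (hip z w).

Lemma szego_approx w : (0 < n)%N -> cnorm w < 1 -> exists2 C : R, 0 <= C &
  exists2 q : R, 0 <= q < 1 & forall N z, cnorm z <= 1 ->
    normc (szego_sum N z w - szego z w) <= C * q ^+ N.
Proof.
move=> n0 w1.
have [|C C0 [q q01 h]] := @nbsum_cvg R n.-1 (cnorm w); first by rewrite cnorm_ge0.
exists C => //; exists q => // N z z1; have := h N (hip z w) (hip_lt1 z1 w1).
by rewrite prednK.
Qed.

Lemma bdm_mono s : bdm (@mono R n s). Proof. by have [] := @hol_mono R n s. Qed.

Lemma bdm_weval p : bdm (@weval R n p).
Proof.
apply: bdm_sum => t; apply: bdmM; [exact: bdm_cst|exact: bdm_mono].
Qed.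

Lemma bdm_szego_sum N w : bdm (fun z => szego_sum N z w).
Proof.
apply: bdm_sum => k; apply: bdmM; first exact: bdm_cst.
by case: (hol_hipX w k).
Qed.

Lemma L2ip_uniform_limit f g (h : nat -> Cn -> R[i]) (C q : R) (l : R[i]) :
  L2 f -> L2 g -> (forall N, L2 (h N)) -> 0 <= C -> 0 <= q < 1 ->
  (forall N z, S z -> normc (h N z - g z) <= C * q ^+ N) ->
  (exists N0, forall N, (N0 <= N)%N -> L2ip f (h N) = l) -> L2ip f g = l.
Proof.
move=> hf hg hh C0 q01 hC [N0 hl]; apply/eqP; rewrite -subr_eq0 -normc_eq0.
rewrite eq_le normc_ge0 andbT; apply/ler_addgt0Pr => e e0; rewrite add0r.
have [N1 hN1] := expr_cvg0 (L2norm f * C) q01 e0.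
pose N := maxn N0 N1; rewrite -(hl N (leq_maxl _ _)).
have hB : L2 (fun z => h N z - g z) by exact: L2B.
have -> : L2ip f g - L2ip f (h N) = - L2ip f (fun z => h N z - g z).
  rewrite /L2ip -opprB -sphere_integralB; try by apply: integrableSM => //; exact: L2_conj.
  congr (- _); apply: eq_sphere_integral => z _.
  by rewrite rmorphB /= mulrBr.
rewrite normcN (le_trans (L2ip_bound hf hB))//.
apply: le_trans (ltW (hN1 N (leq_maxr _ _))); rewrite -mulrA.
rewrite ler_wpM2l ?L2norm_ge0//; apply: L2norm_bounded.
- by rewrite mulr_ge0// exprn_ge0//; case/andP: q01.
- exact: L2_measurable.
- exact: hC.
Qed.

Lemma mono_reproducing s w : (0 < n)%N -> cnorm w < 1 ->
  L2ip (mono s) (fun z => szego z w) = mono s w.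
Proof.
move=> n0 w1; have [C C0 [q q01 hC]] := szego_approx n0 w1.
apply: (L2ip_uniform_limit (h := fun N z => szego_sum N z w) (C := C) (q := q)) => //.
- exact/bdm_L2/bdm_mono.
- exact/bdm_L2/bdm_szego.
- by move=> N; exact/bdm_L2/bdm_szego_sum.
- by move=> N z zS; apply: hC; rewrite zS.
(* Once N exceeds the degree of the monomial, the truncated kernel reproduces it exactly. *)
exists (size s).+1 => N sN; rewrite /L2ip.
rewrite (eq_sphere_integral (g := fun z => \sum_(k < N)
    'C(n.-1 + k, k)%:R * (mono s z * (hip z w ^+ k)^*))); last first.
  move=> z _; rewrite /szego_sum /nbsum rmorph_sum mulr_sumr; apply: eq_bigr => k _.
  by rewrite rmorphM /= rmorph_nat mulrCA.
have ih k : integrableS (fun z => mono s z * (hip z w ^+ k)^*).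
  apply: bdm_integrableS; apply: bdmM; first exact: bdm_mono.
  by apply: bdm_conj; case: (hol_hipX w k).
rewrite sphere_integral_sum; last by move=> k; exact: integrableSZ.
under eq_bigr do rewrite sphere_integralZ// mono_hipX//.
rewrite (bigD1 (Ordinal sN))//= eqxx big1 ?addr0// => k kN.
by rewrite ifN// eq_sym.
Qed.

Lemma weval_reproducing p w : (0 < n)%N -> cnorm w < 1 ->
  L2ip (weval p) (fun z => szego z w) = weval p w.
Proof.
move=> n0 w1; rewrite /L2ip (eq_sphere_integral (g := fun z => \sum_(t <- p)
  t.1 * (mono t.2 z * (szego z w)^*))); last first.
  by move=> z _; rewrite /weval mulr_suml; apply: eq_bigr => t _; rewrite mulrA.
have ih (t : R[i] * seq 'I_n) : integrableS (fun z => mono t.2 z * (szego z w)^*).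
  apply: bdm_integrableS; apply: bdmM; first exact: bdm_mono.
  by apply: bdm_conj; exact: bdm_szego.
rewrite sphere_integral_sum; last by move=> k; exact: integrableSZ.
apply: eq_bigr => t _; rewrite sphere_integralZ// -[in RHS](mono_reproducing t.2 n0 w1).
by [].
Qed.

End szego_kernel.

(** * The ball algebra and the Hardy space *)

Section polynomials.
Context {R : realType} (n : nat).
Local Notation Cn := 'rV[R[i]]_n.
Local Notation S := (unit_sphere R n).
Implicit Types (s : seq 'I_n) (p : seq (R[i] * seq 'I_n)) (z w : Cn) (f g : Cn -> R[i]).
Implicit Types (a : {ffun 'I_n -> nat}).

Definition ispoly f := exists p, forall z, f z = weval p z.

Lemma ispoly_weval p : ispoly (weval p). Proof. by exists p. Qed.

Lemma ispolyD f g : ispoly f -> ispoly g -> ispoly (fun z => f z + g z).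
Proof.
by move=> [p hp] [q hq]; exists (p ++ q) => z; rewrite hp hq /weval big_cat.
Qed.

Lemma ispoly_cst c : ispoly (fun=> c).
Proof. by exists [:: (c, [::])] => z; rewrite /weval big_seq1 /= mono_nil mulr1. Qed.

Lemma ispolyM f g : ispoly f -> ispoly g -> ispoly (fun z => f z * g z).
Proof.
move=> [p hp] [q hq].
exists [seq (t.1 * u.1, t.2 ++ u.2) | t <- p, u <- q] => z.
rewrite hp hq /weval big_allpairs_dep mulr_suml; apply: eq_bigr => t _.
rewrite mulr_sumr; apply: eq_bigr => u _ /=; rewrite mono_cat; ring.
Qed.

Lemma ispoly_coord (i : 'I_n) : ispoly (fun z => z 0 i).
Proof.
by exists [:: (1, [:: i])] => z; rewrite /weval big_seq1 /= mono_cons mono_nil mulr1 mul1r.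
Qed.

Lemma ispoly_sum (I : Type) (r : seq I) (F : I -> Cn -> R[i]) :
  (forall i, ispoly (F i)) -> ispoly (fun z => \sum_(i <- r) F i z).
Proof.
move=> hF; elim: r => [|i r ih].
  by have [p hp] := ispoly_cst 0; exists p => z; rewrite -hp big_nil.
have [p hp] := ispolyD (hF i) ih; exists p => z; rewrite -hp big_cons//.
Qed.

Lemma ispoly_prod (I : Type) (r : seq I) (F : I -> Cn -> R[i]) :
  (forall i, ispoly (F i)) -> ispoly (fun z => \prod_(i <- r) F i z).
Proof.
move=> hF; elim: r => [|i r ih].
  by have [p hp] := ispoly_cst 1; exists p => z; rewrite -hp big_nil.
have [p hp] := ispolyM (hF i) ih; exists p => z; rewrite -hp big_cons//.
Qed.

Lemma ispolyX f k : ispoly f -> ispoly (fun z => f z ^+ k).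
Proof.
move=> hf; elim: k => [|k ih]; first by have [p hp] := ispoly_cst 1; exists p => z; rewrite -hp.
by have [p hp] := ispolyM hf ih; exists p => z; rewrite -hp exprS.
Qed.

Lemma ispoly_hip w : ispoly (fun z => hip z w).
Proof.
apply: ispoly_sum => i; apply: ispolyM; [exact: ispoly_coord|exact: ispoly_cst].
Qed.

Lemma ispoly_szego_sum N w : ispoly (fun z => szego_sum N z w).
Proof.
apply: ispoly_sum => k; apply: ispolyM; first exact: ispoly_cst.
exact/ispolyX/ispoly_hip.
Qed.

Definition content s : {ffun 'I_n -> nat} := [ffun i => count_mem i s].

Lemma prod_content (V : comPzSemiRingType) (y : 'I_n -> V) s :
  \prod_(l <- s) y l = \prod_i y i ^+ content s i.
Proof.
elim: s => [|l s ih]; first by rewrite big_nil big1// => i _; rewrite ffunE.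
rewrite big_cons ih (bigD1 l)//= mulrA [RHS](bigD1 l)//= !ffunE /= eqxx exprS.
congr (_ * _); apply: eq_bigr => i il; rewrite !ffunE /= eq_sym (negbTE il).
by rewrite add0n.
Qed.

Lemma mono_content s z : mono s z = \prod_i z 0 i ^+ content s i.
Proof. exact: prod_content. Qed.

Definition degree a : nat := (\sum_i a i)%N.

Lemma degree_content s : degree (content s) = size s.
Proof.
elim: s => [|l s ih]; first by rewrite /degree big1// => i _; rewrite ffunE.
rewrite /= -ih /degree (bigD1 l)//= ffunE /= eqxx add1n addSn; congr _.+1.
rewrite [in RHS](bigD1 l)//= ffunE; congr (_ + _)%N; apply: eq_bigr => i il.
by rewrite !ffunE /= eq_sym (negbTE il).
Qed.

(** The index set of [box_sum] with entries read as natural numbers, so that boxes of different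
    sizes can be compared. *)
Definition boxset N : seq {ffun 'I_n -> nat} :=
  map (fun b : {ffun 'I_n -> 'I_N} => [ffun i => (b i : nat)]) (enum {: {ffun 'I_n -> 'I_N}}).

Lemma box_sumE (c : {ffun 'I_n -> nat} -> R[i]) N z :
  box_sum c N z = \sum_(a <- boxset N) monomial_term c z a.
Proof. by rewrite /boxset big_map big_enum. Qed.

Lemma boxset_uniq N : uniq (boxset N).
Proof.
rewrite map_inj_uniq ?enum_uniq// => a b ab; apply/ffunP => i; apply: val_inj.
by have := congr1 (fun f : {ffun 'I_n -> nat} => f i) ab; rewrite !ffunE.
Qed.

Lemma mem_boxset N a : (a \in boxset N) = [forall i, (a i < N)%N].
Proof.
apply/mapP/forallP => [[b _ -> i]|aN]; first by rewrite ffunE.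
by exists [ffun i => Ordinal (aN i)]; rewrite ?mem_enum//; apply/ffunP => i; rewrite !ffunE.
Qed.

Lemma le_degree a i : (a i <= degree a)%N.
Proof. by rewrite /degree (bigD1 i)//= leq_addr. Qed.

Lemma ispoly_box_sum c N : ispoly (@box_sum R n c N).
Proof.
have [p hp] : ispoly (fun z => \sum_(a <- boxset N) monomial_term c z a).
  apply: ispoly_sum => a; apply: ispolyM; first exact: ispoly_cst.
  by apply: ispoly_prod => i; apply: ispolyX; exact: ispoly_coord.
by exists p => z; rewrite box_sumE.
Qed.

Lemma weval_box_sum p : exists N c, forall z, weval p z = box_sum c N z.
Proof.
(* An exponent of a word never exceeds its length, so this box contains all exponent vectors; words
   with the same content are merged into one coefficient. *)
pose N := (\max_(t <- p) size t.2).+1.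
exists N, (fun a => \sum_(t <- p | content t.2 == a) t.1) => z.
rewrite box_sumE /monomial_term.
under eq_bigr do rewrite mulr_suml big_mkcond.
rewrite exchange_big /= /weval [LHS]big_seq [RHS]big_seq; apply: eq_bigr => t tp.
have ct : content t.2 \in boxset N.
  rewrite mem_boxset; apply/forallP => i; rewrite ltnS.
  apply: leq_trans (le_degree _ i) _; rewrite degree_content.
  by apply: (@leq_bigmax_seq _ p xpredT (fun t => size t.2) t).
rewrite (bigD1_seq (content t.2)) ?boxset_uniq//= eqxx mono_content.
rewrite [X in _ = _ + X]big1_seq ?addr0// => a /andP[ac _].
by rewrite eq_sym (negbTE ac).
Qed.

End polynomials.

Section hardy.
Context {R : realType} (n : nat).
Local Notation Cn := 'rV[R[i]]_n.
Local Notation S := (unit_sphere R n).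
Implicit Types (p : seq (R[i] * seq 'I_n)) (z w : Cn) (f g : Cn -> R[i]).

Hypothesis n0 : (0 < n)%N.

Lemma ispoly_bdm f : ispoly f -> bdm f.
Proof. by move=> [p hp]; apply: eq_bdm (bdm_weval p) _ => z; rewrite hp. Qed.

(** Uniform approximation on the closed ball controls point values inside and integrals on the
    sphere at once, for polynomials and kernels alike. *)
Definition ball_alg f := bdm f /\ forall e : R, 0 < e ->
  exists p, forall z, cnorm z <= 1 -> normc (f z - weval p z) <= e.

Lemma ball_alg_ispoly f : ispoly f -> ball_alg f.
Proof.
move=> hf; split; first exact: ispoly_bdm.
by move=> e e0; have [p hp] := hf; exists p => z _; rewrite hp subrr normc0 ltW.
Qed.

Lemma ball_algD f g : ball_alg f -> ball_alg g -> ball_alg (fun z => f z + g z).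
Proof.
move=> [bf hf] [bg hg]; split; first exact: bdmD.
move=> e e0; have e2 : 0 < e / 2 by rewrite divr_gt0.
have [p hp] := hf _ e2; have [q hq] := hg _ e2.
exists (p ++ q) => z z1; rewrite /weval big_cat /= -!/(weval _ z).
rewrite opprD addrACA (le_trans (le_normcD _ _))//.
by rewrite [e]splitr lerD ?hp ?hq.
Qed.

Lemma ball_algZ (a : R[i]) f : ball_alg f -> ball_alg (fun z => a * f z).
Proof.
move=> [bf hf]; split; first by apply: bdmM => //; exact: bdm_cst.
move=> e e0; have a1 : 0 < normc a + 1 by rewrite ltr_wpDl ?normc_ge0.
have [p hp] := hf (e / (normc a + 1)) (divr_gt0 e0 a1).
have [q hq] := ispolyM (ispoly_cst n a) (ispoly_weval p).
exists q => z z1; rewrite -hq -mulrBr normcM.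
apply: (@le_trans _ _ ((normc a + 1) * (e / (normc a + 1)))).
  by rewrite ler_pM ?normc_ge0 ?hp// lerDl.
by rewrite mulrCA divff ?mulr1// gt_eqF.
Qed.

Lemma ball_alg_cst c : ball_alg (fun=> c).
Proof. exact/ball_alg_ispoly/ispoly_cst. Qed.

Lemma ball_alg_sum (I : Type) (r : seq I) (F : I -> Cn -> R[i]) :
  (forall i, ball_alg (F i)) -> ball_alg (fun z => \sum_(i <- r) F i z).
Proof.
move=> hF; elim: r => [|i r ih].
  rewrite (_ : (fun _ => _) = fun=> 0); first exact: ball_alg_cst.
  by apply/funext => z; rewrite big_nil.
rewrite (_ : (fun _ => _) = fun z => F i z + \sum_(j <- r) F j z).
  exact: ball_algD.
by apply/funext => z; rewrite big_cons.
Qed.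

Lemma ball_alg_szego w : cnorm w < 1 -> ball_alg (fun z => szego z w).
Proof.
move=> w1; split; first exact: bdm_szego.
move=> e e0; have [C C0 [q q01 hC]] := szego_approx n0 w1.
have [N hN] := expr_cvg0 C q01 e0.
have [p hp] := ispoly_szego_sum N w.
exists p => z z1; rewrite -hp normc_sub (le_trans (hC _ _ z1))// ltW// hN//.
Qed.

Lemma reproducing f w : ball_alg f -> cnorm w < 1 -> L2ip f (fun z => szego z w) = f w.
Proof.
move=> [bf hf] w1; apply/eqP; rewrite -subr_eq0 -normc_eq0 eq_le normc_ge0 andbT.
apply/ler_addgt0Pr => e e0; rewrite add0r.
pose K := L2norm (fun z => szego z w); have K0 : 0 <= K by exact: L2norm_ge0.
have K1 : 0 < K + 1 by rewrite ltr_wpDl.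
have [p hp] := hf (e / (K + 1)) (divr_gt0 e0 K1).
have sp z : S z -> normc (f z - weval p z) <= e / (K + 1) by move=> zS; rewrite hp// zS.
have lf := bdm_L2 bf; have lp := bdm_L2 (bdm_weval p).
have lK := bdm_L2 (bdm_szego w1).
have -> : L2ip f (fun z => szego z w) - f w =
    L2ip (fun z => f z - weval p z) (fun z => szego z w) - (f w - weval p w).
  rewrite -(weval_reproducing p n0 w1) /L2ip.
  rewrite (eq_sphere_integral (f := fun z => (f z - weval p z) * (szego z w)^*)
    (g := fun z => f z * (szego z w)^* - weval p z * (szego z w)^*));
    last by move=> z _; rewrite mulrBl.
  rewrite sphere_integralB; try by apply: integrableSM => //; exact: L2_conj.
  by ring.
have ek : 0 <= e / (K + 1) by rewrite divr_ge0// ltW.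
rewrite (le_trans (le_normcB _ _))//.
apply: (@le_trans _ _ (e / (K + 1) * K + e / (K + 1))).
  apply: lerD; last by rewrite hp// ltW.
  apply: le_trans (L2ip_bound _ lK) _; first exact: L2B.
  rewrite ler_wpM2r//; apply: L2norm_bounded => //.
  exact: L2_measurable (L2B lf lp).
by rewrite -[X in _ + X]mulr1 -mulrDr divfK// gt_eqF.
Qed.

Lemma H2_ball_alg f : ball_alg f -> H2 f.
Proof.
move=> [bf hf]; split; first exact: bdm_L2.
move=> e e0; have e2 : 0 < e / 2 by rewrite divr_gt0.
have [p hp] := hf _ e2.
have [N [c hc]] := weval_box_sum p; exists N, c.
apply: (@le_lt_trans _ _ (e / 2)); last lra.
apply: L2norm_bounded; first lra.
  rewrite (_ : (fun _ => _) = fun z => f z - weval p z).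
    by apply: L2_measurable; apply: L2B; apply: bdm_L2 => //; exact: bdm_weval.
  by apply/funext => z; rewrite hc.
by move=> z zS; rewrite -hc hp// zS.
Qed.

Lemma H2_L2 f : H2 f -> L2 f. Proof. by case. Qed.

Lemma H2_approx f : H2 f -> forall e : R, 0 < e ->
  exists p, L2norm (fun z => f z - weval p z) < e.
Proof.
move=> [_ hf] e e0; have [N [c hc]] := hf e e0.
have [p hp] := ispoly_box_sum c N; exists p.
by rewrite (_ : (fun _ => _) = fun x => f x - box_sum c N x)//; apply/funext => z; rewrite hp.
Qed.

Lemma sphere_integral_weval p : sphere_integral (weval p) = weval p 0.
Proof.
have c0 : cnorm (0 : Cn) < 1.
  by rewrite /cnorm big1 ?sqrtr0// => i _; rewrite mxE normc0 expr0n.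
rewrite -[RHS](weval_reproducing p n0 c0) /L2ip; apply: eq_sphere_integral => z _.
rewrite /szego (_ : hip z 0 = 0) ?subr0 ?expr1n ?invr1 ?conjC1 ?mulr1//.
by rewrite /hip big1// => i _; rewrite mxE conjC0 mulr0.
Qed.

Lemma sphere_integral_wevalM p q : sphere_integral (fun z => weval p z * weval q z) =
  sphere_integral (weval p) * sphere_integral (weval q).
Proof.
have [r hr] := ispolyM (ispoly_weval p) (ispoly_weval q).
rewrite (eq_sphere_integral (g := weval r)); last by move=> z _; rewrite hr.
by rewrite !sphere_integral_weval -hr.
Qed.

(* Evaluation at the center is multiplicative on polynomials, hence on the Hardy space. *)
Lemma sphere_integral_H2M f g : H2 f -> H2 g ->
  sphere_integral (fun z => f z * g z) = sphere_integral f * sphere_integral g.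
Proof.
move=> hf hg; apply/eqP; rewrite -subr_eq0 -normc_eq0 eq_le normc_ge0 andbT.
apply/ler_addgt0Pr => e e0; rewrite add0r.
pose F := L2norm f; pose G := L2norm g.
have F0 : 0 <= F by exact: L2norm_ge0. have G0 : 0 <= G by exact: L2norm_ge0.
have fg0 : 0 < 2 * (F + G + 1) by lra.
(* Replacing f and g by polynomials within d costs four terms of total 2d(F + G + d), at most e. *)
pose d := Num.min 1 (e / (2 * (F + G + 1))).
have d0 : 0 < d by rewrite lt_min ltr01 divr_gt0.
have d1 : d <= 1 by rewrite /d ge_min lexx.
have de : d * (2 * (F + G + 1)) <= e by rewrite -ler_pdivlMr// /d ge_min lexx orbT.
have [p hp] := H2_approx hf d0; have [q hq] := H2_approx hg d0.
have [lf lg] := (H2_L2 hf, H2_L2 hg).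
have lp := bdm_L2 (bdm_weval p); have lq := bdm_L2 (bdm_weval q).
have lfp := L2B lf lp; have lgq := L2B lg lq.
have np : L2norm (weval p) <= F + d.
  rewrite (eq_L2norm (g := fun z => f z + (- (f z - weval p z)))); last by move=> z _; ring.
  apply: le_trans (L2normD lf (L2N lfp)) _; rewrite lerD2l.
  rewrite (_ : L2norm _ = L2norm (fun z => f z - weval p z)) ?ltW//.
  rewrite /L2norm; congr (Num.sqrt (fine _)); apply: eq_integral => x _.
  by rewrite normcN.
have i1 : integrableS (fun z => (f z - weval p z) * g z) by exact: integrableSM.
have i2 : integrableS (fun z => weval p z * (g z - weval q z)) by exact: integrableSM.
have i3 : integrableS (fun z => weval p z * weval q z) by exact: integrableSM.
have fE : sphere_integral f = sphere_integral (fun z => f z - weval p z) +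
    sphere_integral (weval p).
  by rewrite sphere_integralB ?subrK//; exact: L2_integrableS.
have gE : sphere_integral g = sphere_integral (fun z => g z - weval q z) +
    sphere_integral (weval q).
  by rewrite sphere_integralB ?subrK//; exact: L2_integrableS.
have bnd (h : Cn -> R[i]) : L2 h -> normc (sphere_integral h) <= L2norm h.
  move=> hh; rewrite -lee_fin (le_trans (le_normc_sphere_integral (L2_integrableS hh)))//.
  exact: L1norm_le_L2norm.
have -> : sphere_integral (fun z => f z * g z) - sphere_integral f * sphere_integral g =
   sphere_integral (fun z => (f z - weval p z) * g z) +
   sphere_integral (fun z => weval p z * (g z - weval q z)) -
   (sphere_integral (fun z => f z - weval p z) * sphere_integral g +
    sphere_integral (weval p) * sphere_integral (fun z => g z - weval q z)).
  rewrite (eq_sphere_integral (f := fun z => f z * g z) (g := fun z =>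
     (f z - weval p z) * g z + weval p z * (g z - weval q z) + weval p z * weval q z));
     last by move=> z _; ring.
  rewrite (sphere_integralD (integrableSD i1 i2) i3) (sphere_integralD i1 i2) sphere_integral_wevalM [in LHS]fE [in LHS]gE [in RHS]gE; ring.
apply: (@le_trans _ _ (d * G + (F + d) * d + (d * G + (F + d) * d))).
  rewrite (le_trans (le_normcB _ _))// lerD// (le_trans (le_normcD _ _))// lerD//.
  - apply: le_trans (cauchy_schwarz lfp lg) _.
    by rewrite ler_wpM2r// ltW.
  - apply: le_trans (cauchy_schwarz lp lgq) _.
    by rewrite ler_pM ?L2norm_ge0// ltW.
  - rewrite normcM ler_pM ?normc_ge0//; last exact: bnd.
    by rewrite (le_trans (bnd _ lfp))// ltW.
  - rewrite normcM ler_pM ?normc_ge0//; first exact: le_trans (bnd _ lp) _.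
    by rewrite (le_trans (bnd _ lgq))// ltW.
apply: le_trans de; nra.
Qed.

Lemma H20_H2_integral f g : H20 f -> H2 g -> sphere_integral (fun z => g z * f z) = 0.
Proof.
move=> [hf f1] hg; rewrite sphere_integral_H2M//.
have := f1 (fun=> 1) erefl; rewrite /L2ip (eq_sphere_integral (g := f)) => [->|z _].
  by rewrite mulr0.
by rewrite conjC1 mulr1.
Qed.

Lemma H2_0 : H2 ((fun=> 0) : Cn -> R[i]).
Proof. exact/H2_ball_alg/ball_alg_cst. Qed.

Lemma MS_L2 f : MS f -> L2 f. Proof. by case. Qed.

Lemma MS_H2_integral f g : MS f -> H2 g -> sphere_integral (fun z => g z * f z) = 0.
Proof.
move=> [lf hf] hg; have := hf (fun z => 0 + (g z)^*).
rewrite /L2ip (eq_sphere_integral (g := fun z => g z * f z)).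
  apply; exists (fun=> 0); first exact: H2_0.
  by exists (fun z => (g z)^*) => //; exists g.
by move=> z _; rewrite add0r conjCK mulrC.
Qed.

(** * Interpolation by combinations of kernels *)

Section interpolation.
Variables (m : nat) (Z : 'I_m -> Cn).
Hypothesis Zball : forall i, unit_ball R n (Z i).

Lemma ball_alg_QZ q : QZ Z q -> ball_alg q.
Proof.
move=> [c ->]; apply: ball_alg_sum => j; apply: ball_algZ.
by apply: ball_alg_szego; exact: Zball.
Qed.

Lemma sphere_integral_QZ g (c : 'I_m -> R[i]) : ball_alg g ->
  sphere_integral (fun z => g z * (\sum_j c j * szego z (Z j))^*) =
  \sum_j (c j)^* * g (Z j).
Proof.
move=> hg; rewrite (eq_sphere_integral (g := fun z => \sum_j (c j)^* * (g z * (szego z (Z j))^*))).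
  rewrite sphere_integral_sum; last first.
    move=> j; apply: integrableSZ; apply: bdm_integrableS; apply: bdmM; first by case: hg.
    by apply: bdm_conj; apply: bdm_szego; exact: Zball.
  apply: eq_bigr => j _; rewrite sphere_integralZ; last first.
    apply: bdm_integrableS; apply: bdmM; first by case: hg.
    by apply: bdm_conj; apply: bdm_szego; exact: Zball.
  by rewrite -[in RHS](reproducing hg (Zball j)).
move=> z _; rewrite rmorph_sum mulr_sumr; apply: eq_bigr => j _.
by rewrite rmorphM mulrCA.
Qed.

Lemma MQ_pairing f : MQ Z f -> L2 f /\ exists c : 'I_m -> R[i], forall g, ball_alg g ->
  sphere_integral (fun z => g z * f z) = \sum_j (c j)^* * g (Z j).
Proof.
move=> [_ [q qQ <-] [_ [u uM [h hH <-]] <-]].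
have lq : L2 (fun z => (q z)^*).
  by apply: L2_conj; apply: bdm_L2; case: (ball_alg_QZ qQ).
have lu := MS_L2 uM; have lh : L2 h by apply: H2_L2; case: hH.
split; first by apply: L2D => //; exact: L2D.
have [c qE] := qQ; exists c => g hg.
have gH := H2_ball_alg hg; have lg := H2_L2 gH.
rewrite -(sphere_integral_QZ c hg).
rewrite (eq_sphere_integral (f := fun z => g z * ((q z)^* + (u z + h z)))
  (g := fun z => g z * (q z)^* + (g z * u z + g z * h z))); last first.
  by move=> z _; rewrite !mulrDr.
have i1 := integrableSM lg lq; have i2 := integrableSM lg lu; have i3 := integrableSM lg lh.
rewrite (sphere_integralD i1 (integrableSD i2 i3)) (sphere_integralD i2 i3).
by rewrite (MS_H2_integral uM gH) (H20_H2_integral hH gH) !addr0 qE.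
Qed.

Hypothesis Zinj : injective Z.

Lemma lagrange_poly i : exists p, forall j, weval p (Z j) = (j == i)%:R.
Proof.
(* A coordinate separating Z i from Z j; the default, available since 0 < n, is met for j = i
   only. *)
pose k j := odflt (cast_ord (prednK n0) 0) [pick k | Z i 0 k != Z j 0 k].
have kP j : j != i -> Z i 0 (k j) - Z j 0 (k j) != 0.
  move=> ji; rewrite /k; case: pickP => [l|h] /=; first by rewrite subr_eq0.
  suff ij : Z i = Z j by move: ji; rewrite (Zinj ij) eqxx.
  by apply/rowP => l; apply/eqP; have := h l; move/negbT; rewrite negbK.
pose F j (z : Cn) := if j == i then 1 else
   (z 0 (k j) + (- Z j 0 (k j))) * (Z i 0 (k j) - Z j 0 (k j))^-1.
have [p hp] : ispoly (fun z => \prod_j F j z).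
  apply: ispoly_prod => j; rewrite /F; case: eqP => _; first exact: ispoly_cst.
  apply: ispolyM; last exact: ispoly_cst.
  by apply: ispolyD; [exact: ispoly_coord|exact: ispoly_cst].
exists p => j; rewrite -hp; have [->|ji] := eqVneq j i.
  rewrite big1// => l _; rewrite /F; case: eqVneq => // li.
  by rewrite mulfV// kP.
by rewrite (bigD1 j)//= {1}/F (negbTE ji) subrr mul0r mul0r.
Qed.

Let G := \matrix_(i, j) szego (Z i) (Z j).

(* If [v] is in the left kernel of the Gram matrix, the corresponding
   combination of kernels has norm zero, hence annihilates all polynomials. *)
Lemma szego_gram_unit : G \in unitmx.
Proof.
rewrite -row_free_unit -kermx_eq0; apply/eqP/row_matrixP => i0.
rewrite row0; set v := row i0 (kermx G).
have vG : v *m G = 0 by apply/sub_kermxP; exact: row_sub.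
pose f z := \sum_i (v 0 i)^* * szego z (Z i).
have fQ : QZ Z f by exists (fun i => (v 0 i)^*).
have hf := ball_alg_QZ fQ; have lf := H2_L2 (H2_ball_alg hf).
have fZ j : f (Z j) = 0.
  rewrite -[f _]conjCK -[RHS]conjC0; congr (_^*).
  have /matrixP/(_ 0 j) := vG; rewrite !mxE => <-.
  rewrite /f rmorph_sum; apply: eq_bigr => i _.
  by rewrite rmorphM /= conjCK szego_conj [G i j]mxE.
have pair g : ball_alg g -> L2ip g f = \sum_j v 0 j * g (Z j).
  move=> hg; rewrite /L2ip /f sphere_integral_QZ//.
  by apply: eq_bigr => j _; rewrite conjCK.
have nf : L2norm f = 0.
  apply/eqP; rewrite -sqrf_eq0; apply/eqP; apply: (@complexI R).
  by rewrite -L2ip_self// pair// big1// => j _; rewrite fZ mulr0.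
apply/rowP => i; rewrite [RHS]mxE.
(* Pairing f with a polynomial that is 1 at Z i and 0 at the other points isolates the entry v_i. *)
have [p hp] := lagrange_poly i.
have hpb := ball_alg_ispoly (ispoly_weval p).
have := L2ip_bound (H2_L2 (H2_ball_alg hpb)) lf; rewrite nf mulr0 pair//.
rewrite (bigD1 i)//= hp eqxx mulr1 big1 ?addr0; last first.
  by move=> j ji; rewrite hp (negbTE ji) mulr0.
move=> vi; apply: eq0_normc; apply/eqP; rewrite eq_le vi; exact: normc_ge0.
Qed.

Lemma psiZW_interpolates (W : 'I_m -> R[i]) i : psiZW Z W (Z i) = W i.
Proof.
have : (G *m (invmx G *m \col_j W j)) i 0 = W i.
  by rewrite mulmxA mulmxV ?szego_gram_unit// mul1mx mxE.
rewrite mxE => <-; apply: eq_bigr => j _; rewrite [in RHS]mxE mulrC.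
by [].
Qed.

Lemma QZ_psiZW (W : 'I_m -> R[i]) : QZ Z (psiZW Z W).
Proof. by exists (fun j => (invmx G *m \col_j W j) j 0). Qed.

End interpolation.

End hardy.

(** * Power series of bounded analytic functions on the disc *)

Section power_series.
Context {R : realType}.
Local Notation C := R[i].
Implicit Types (a b : nat -> C) (g : C -> C) (P : {poly C}) (r s M : R).

Lemma geom_sum_le N (x : R) : 0 <= x < 1 -> \sum_(k < N) x ^+ k <= (1 - x)^-1.
Proof.
move=> /andP[x0 x1]; have h : 0 < 1 - x by rewrite subr_gt0.
rewrite -[leRHS]mul1r ler_pdivlMr// mulrC -opprB mulNr -subrX1 opprB.
by rewrite gerBl exprn_ge0.
Qed.

(** The limit is the supremum of the lower bounds u_K - B q^K. Each of them is below every upper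
    bound u_K + B q^K, which gives the rate together with the limit. *)
Lemma geom_cauchy_real (u : nat -> R) (B q : R) :
  (forall K K', (K <= K')%N -> `|u K' - u K| <= B * q ^+ K) ->
  exists l, forall K, `|l - u K| <= B * q ^+ K.
Proof.
move=> hu; pose E := [set u K - B * q ^+ K | K in [set: nat]].
have lub K K' : u K - B * q ^+ K <= u K' + B * q ^+ K'.
  have [KK|KK] := leqP K K'.
    have := hu _ _ KK; have := hu K' K' (leqnn _); rewrite subrr normr0.
    by rewrite !ler_norml; lra.
  have := hu _ _ (ltnW KK); have := hu K K (leqnn _); rewrite subrr normr0.
  by rewrite !ler_norml; lra.
have E0 : E !=set0 by exists (u 0%N - B * q ^+ 0); exists 0%N.
exists (sup E) => K.
have h1 : u K - B * q ^+ K <= sup E.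
  apply: ub_le_sup; last by exists K.
  by exists (u 0%N + B * q ^+ 0) => _ [K' _ <-].
have h2 : sup E <= u K + B * q ^+ K.
  by apply: ge_sup => // _ [K' _ <-].
by rewrite ler_norml; lra.
Qed.

Lemma geom_cauchy (u : nat -> C) (B q : R) :
  (forall K K', (K <= K')%N -> normc (u K' - u K) <= B * q ^+ K) ->
  exists l, forall K, normc (l - u K) <= 2 * B * q ^+ K.
Proof.
move=> hu.
have [x hx] : exists l, forall K, `|l - complex.Re (u K)| <= B * q ^+ K.
  apply: geom_cauchy_real => K K' KK; apply: le_trans (hu _ _ KK).
  by rewrite -raddfB; exact: Re_le_normc.
have [y hy] : exists l, forall K, `|l - complex.Im (u K)| <= B * q ^+ K.
  apply: geom_cauchy_real => K K' KK; apply: le_trans (hu _ _ KK).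
  by rewrite -raddfB; exact: Im_le_normc.
exists (x +i* y) => K; apply: le_trans (normc_le_ReIm _) _.
by rewrite !raddfB /= -mulrA mulr_natl mulr2n lerD.
Qed.

(** X^N - 1 splits into distinct linear factors, and N distinct N-th roots of unity include a
    primitive one. *)
Lemma prim_root_complex N : (0 < N)%N -> exists z : C, N.-primitive_root z.
Proof.
pose p : {poly C} := 'X^N - 1; have [rs Dp] := closed_field_poly_normal p => N0.
rewrite (monicP _) ?monicXnsubC // scale1r in Dp.
have rn1 : all N.-unity_root rs by apply/allP => z; rewrite -root_prod_XsubC -Dp.
have sz_r : (N < (size rs).+1)%N by rewrite -(size_prod_XsubC rs id) -Dp size_XnsubC.
have [|z] := hasP (cyclic.has_prim_root N0 rn1 _ sz_r); last by exists z.
by rewrite -separable.separable_prod_XsubC -Dp cyclotomic.separable_Xn_sub_1// pnatr_eq0 -lt0n.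
Qed.

(* Averaging [P] against the N-th roots of unity isolates one coefficient. *)
Lemma poly_cauchy P r M k : 0 <= r ->
  (forall z, normc z = r -> normc P.[z] <= M) -> normc P`_k * r ^+ k <= M.
Proof.
(* N exceeds k and every exponent i of P, so i + (N - k) is a multiple of N for i = k only. *)
move=> r0 hP; pose N := maxn (size P) k.+1.
have N0 : (0 < N)%N by rewrite /N leq_max ltn0Sn orbT.
have kN : (k < N)%N by rewrite /N leq_max leqnn orbT.
have [w pw] := prim_root_complex N0.
have wN := prim_expr_order pw.
have w1 : normc w = 1.
  have : normc w ^+ N == 1 by rewrite -normcX wN normc1.
  by rewrite pexprn_eq1 ?normc_ge0// -[(N == 0)%N]negbK -lt0n N0 => /eqP.
have avg : \sum_(j < N) P.[r%:C * w ^+ j] * w ^+ (j * (N - k)) = N%:R * (P`_k * r%:C ^+ k).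
  under eq_bigr => j _ do rewrite (horner_coef_wide (n := N)) ?leq_maxl// mulr_suml.
  rewrite exchange_big /= (bigD1 (Ordinal kN))//= [X in _ + X]big1 ?addr0.
    rewrite (eq_bigr (fun=> P`_k * r%:C ^+ k)); first by rewrite sumr_const card_ord mulr_natl.
    move=> j _; rewrite exprMn -mulrA -mulrA -exprM -exprD -mulnDr subnKC ?(ltnW kN)//.
    by rewrite mulnC exprM wN expr1n mulr1.
  move=> i /eqP ik; set d := (i + (N - k))%N.
  rewrite (eq_bigr (fun j : 'I_N => P`_i * r%:C ^+ i * (w ^+ d) ^+ j)); last first.
    move=> j _; rewrite exprMn -!mulrA -[(w ^+ j) ^+ i]exprM -exprD -mulnDr -exprM.
    by rewrite [(d * j)%N]mulnC.
  rewrite -mulr_sumr; have wd : w ^+ d - 1 != 0.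
    rewrite subr_eq0 -(prim_order_dvd pw); apply/negP => /dvdnP[c hc].
    apply: ik; apply: val_inj => /=; have := ltn_ord i; move: hc kN; rewrite /d.
    move: (N) (i : nat) => n' j'; case: c => [|[|c]]; rewrite ?mulSn; lia.
  suff -> : \sum_(j < N) (w ^+ d) ^+ j = 0 by rewrite mulr0.
  apply/eqP; rewrite -(mulrI_eq0 _ (mulfI wd)) -subrX1 -exprM mulnC exprM wN expr1n subrr.
  by [].
have NR : 0 < N%:R :> R by rewrite ltr0n.
have -> : normc P`_k * r ^+ k = normc (P`_k * r%:C ^+ k).
  by rewrite normcM normcX normc_real ger0_norm.
rewrite -(ler_pM2l NR) mulrC -[X in _ * X](@ger0_norm _ N%:R) ?ler0n// -normc_real.
rewrite -normcM mulrC rmorph_nat -avg (le_trans (normc_sum _ _ _))//.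
rewrite mulr_natl -[in leRHS](card_ord N) -sumr_const; apply: ler_sum => j _.
rewrite normcM normcX w1 expr1n mulr1 hP// normcM normcX w1 expr1n mulr1.
by rewrite normc_real ger0_norm.
Qed.

Definition tpoly a K : {poly C} := \poly_(l < K) a l.

(** Convergence on smaller discs is stated with a geometric rate uniform in h, so that limits can be
    taken inside inequalities by [le_of_geom]. *)
Definition power_series g a r := forall s, 0 <= s < r ->
  exists B q : R, [/\ 0 <= B, 0 <= q < 1 & forall K h, normc h <= s ->
    normc (g h - (tpoly a K).[h]) <= B * q ^+ K].

Lemma power_series_le g a r r' : r' <= r -> power_series g a r -> power_series g a r'.
Proof. by move=> rr hg s /andP[s0 sr]; apply: hg; rewrite s0 (lt_le_trans sr). Qed.

Lemma eq_power_series g g' a r : (forall h, normc h < r -> g h = g' h) ->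
  power_series g a r -> power_series g' a r.
Proof.
move=> e hg s /andP[s0 sr]; have [|B [q [B0 q01 hB]]] := hg s; first by rewrite s0.
by exists B, q; split => // K h hs; rewrite -e ?hB//; exact: le_lt_trans sr.
Qed.

Lemma le_of_geom (x y B q : R) (K0 : nat) : 0 <= q < 1 ->
  (forall K, (K0 <= K)%N -> x <= y + B * q ^+ K) -> x <= y.
Proof.
move=> q01 h; apply/ler_addgt0Pr => e e0; have [N hN] := expr_cvg0 B q01 e0.
apply: le_trans (h (maxn N K0) (leq_maxr _ _)) _; rewrite lerD2l ltW// hN// leq_maxl//.
Qed.

(** Cauchy's estimate for the truncations of order K > k, whose k-th coefficient is already a_k, up
    to an error that vanishes as K grows. *)
Lemma power_series_coef_le g a r s M k : power_series g a r -> 0 <= s < r ->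
  (forall h, normc h <= s -> normc (g h) <= M) -> normc (a k) * s ^+ k <= M.
Proof.
move=> hg s01 hM; have [s0 sr] := andP s01; have [B [q [B0 q01 hB]]] := hg s s01.
apply: (@le_of_geom _ _ B q k.+1) => // K kK.
have -> : a k = (tpoly a K)`_k by rewrite coef_poly kK.
apply: poly_cauchy => // z zs; have zs' : normc z <= s by rewrite zs.
rewrite -[X in normc X](subKr (g z)) (le_trans (le_normcB _ _))// lerD ?hM//.
exact: hB.
Qed.

Lemma power_series_bound g a r s : power_series g a r -> 0 <= s < r ->
  exists M, forall k, normc (a k) * s ^+ k <= M.
Proof.
move=> hg s01; have [B [q [B0 q01 hB]]] := hg s s01.
exists B => k; apply: (power_series_coef_le _ hg s01) => h hs.
by have := hB 0%N h hs; rewrite /tpoly poly_def big_ord0 horner0 subr0 expr0 mulr1.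
Qed.

Lemma power_series_uniq g a b r : 0 < r -> power_series g a r -> power_series g b r ->
  forall k, a k = b k.
Proof.
move=> r0 ha hb k; pose s := r / 2.
have s01 : 0 <= s < r by rewrite /s; lra.
have [A [q [A0 q01 hA]]] := ha s s01; have [B [p [B0 p01 hB]]] := hb s s01.
apply/eqP; rewrite -subr_eq0 -normc_eq0; have s0 : 0 < s ^+ k by rewrite exprn_gt0// /s; lra.
have sn0 : s ^+ k != 0 by rewrite gt_eqF.
rewrite -(mulIr_eq0 _ (mulIf sn0)) eq_le mulr_ge0 ?normc_ge0 ?(ltW s0)// andbT.
apply: (@le_of_geom _ _ A q k.+1) => // K kK; apply: (@le_of_geom _ _ B p K) => // L KL.
have -> : a k - b k = (tpoly a K - tpoly b L)`_k.
  by rewrite coefB !coef_poly kK (leq_trans kK).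
apply: poly_cauchy => [|z zs]; first by case/andP: s01.
have zs' : normc z <= s by rewrite zs.
rewrite hornerD hornerN (_ : _ - _ = (g z - (tpoly b L).[z]) - (g z - (tpoly a K).[z])); last by ring.
by rewrite add0r (le_trans (le_normcB _ _))// addrC lerD ?hA ?hB.
Qed.

Lemma power_series_agree g g' a b r z : power_series g a r -> power_series g' b r ->
  (forall k, a k = b k) -> normc z < r -> g z = g' z.
Proof.
move=> ha hb ab zr; have s01 : 0 <= normc z < r by rewrite normc_ge0.
have [A [p [A0 p01 hA]]] := ha _ s01; have [B [q [B0 q01 hB]]] := hb _ s01.
apply/eqP; rewrite -subr_eq0 -normc_eq0 eq_le normc_ge0 andbT.
apply/ler_addgt0Pr => e e0; rewrite add0r; have e2 : 0 < e / 2 by lra.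
have [N hN] := expr_cvg0 A p01 e2; have [N' hN'] := expr_cvg0 B q01 e2.
pose K := maxn N N'.
have -> : g z - g' z = (g z - (tpoly a K).[z]) - (g' z - (tpoly b K).[z]).
  have -> : tpoly a K = tpoly b K by apply/polyP => i; rewrite !coef_poly ab.
  by ring.
rewrite (le_trans (le_normcB _ _))// [e]splitr lerD//.
  by apply: le_trans (hA K z (lexx _)) _; rewrite ltW// hN// leq_maxl.
by apply: le_trans (hB K z (lexx _)) _; rewrite ltW// hN'// leq_maxr.
Qed.

Lemma tpoly_diff a K K' s t M h : (K <= K')%N -> 0 <= s < t -> normc h <= s ->
  (forall k, normc (a k) * t ^+ k <= M) ->
  normc ((tpoly a K').[h] - (tpoly a K).[h]) <= M * (1 - s / t)^-1 * (s / t) ^+ K.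
Proof.
move=> KK /andP[s0 st] hs hM; have t0 : 0 < t by apply: le_lt_trans st.
have q01 : 0 <= s / t < 1 by rewrite divr_ge0 ?(ltW t0)//= ltr_pdivrMr// mul1r.
have M0 : 0 <= M by apply: le_trans (hM 0%N); rewrite mulr_ge0 ?normc_ge0// exprn_ge0// ltW.
rewrite !horner_poly -!(big_mkord xpredT (fun l => a l * h ^+ l)) (big_cat_nat (leq0n K) KK)/=.
rewrite addrAC subrr add0r (le_trans (normc_sum _ _ _))//.
have -> : M * (1 - s / t)^-1 * (s / t) ^+ K = (M * (s / t) ^+ K) * (1 - s / t)^-1 by ring.
apply: (@le_trans _ _ (M * (s / t) ^+ K * \sum_(k < K' - K) (s / t) ^+ k)); last first.
  by rewrite ler_wpM2l ?geom_sum_le// mulr_ge0// exprn_ge0//; case/andP: q01.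
rewrite -{1}[K]add0n big_addn big_mkord mulr_sumr; apply: ler_sum => k _.
rewrite normcM normcX -mulrA -exprD addnC.
apply: (@le_trans _ _ (normc (a (K + k)%N) * s ^+ (K + k))).
  by rewrite ler_wpM2l ?normc_ge0// lerXn2r ?nnegrE ?normc_ge0.
rewrite expr_div_n mulrA ler_pdivlMr ?exprn_gt0// mulrAC ler_wpM2r ?exprn_ge0//.
Qed.

Lemma power_series_exists a r : 0 < r ->
  (forall s, 0 <= s < r -> exists M, forall k, normc (a k) * s ^+ k <= M) ->
  exists g, power_series g a r.
Proof.
move=> r0 ha.
have cau s : 0 <= s < r -> exists B q : R, [/\ 0 <= B, 0 <= q < 1 &
    forall h, normc h <= s -> forall K K', (K <= K')%N ->
    normc ((tpoly a K').[h] - (tpoly a K).[h]) <= B * q ^+ K].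
  move=> /andP[s0 sr]; pose t := (s + r) / 2.
  have st : s < t by rewrite /t; lra.
  have tr : 0 <= t < r by rewrite /t; lra.
  have t0 : 0 < t by apply: le_lt_trans st.
  have [M hM] := ha t tr; exists (M * (1 - s / t)^-1), (s / t).
  have q01 : 0 <= s / t < 1 by rewrite divr_ge0 ?(ltW t0)//= ltr_pdivrMr// mul1r.
  split=> //; last by move=> h hs K K' KK; apply: tpoly_diff => //; rewrite s0.
  rewrite mulr_ge0 ?invr_ge0 ?subr_ge0 ?(ltW (proj2 (andP q01)))//.
  by apply: le_trans (hM 0%N); rewrite expr0 mulr1 normc_ge0.
have lim h : exists l, normc h < r -> exists B q : R, 0 <= q < 1 /\ forall K, normc (l - (tpoly a K).[h]) <= B * q ^+ K.
  have [hr|] := boolP (normc h < r); last by exists 0.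
  have [|B [q [B0 q01 hB]]] := cau (normc h); first by rewrite normc_ge0.
  have [l hl] := geom_cauchy (hB h (lexx _)); exists l => _; exists (2 * B), q; split => //.
have [g hg] := choice lim; exists g => s s01; have [s0 sr] := andP s01.
have [B [q [B0 q01 hB]]] := cau s s01; exists B, q; split => // K h hs.
have [B' [q' [q01' hB']]] := hg h (le_lt_trans hs sr).
apply: (@le_of_geom _ _ B' q' K) => // K' KK.
rewrite (_ : g h - _ = ((tpoly a K').[h] - (tpoly a K).[h]) + (g h - (tpoly a K').[h])); last by ring.
by rewrite (le_trans (le_normcD _ _))// lerD// hB.
Qed.

(** The k-th divided derivative of P at d is the k-th coefficient of P(d + h) as a polynomial in h,
    so [poly_cauchy] applies to its difference with Q. *)
Lemma taylor_cauchy P (Q : {poly C}) d s M k : 0 <= s ->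
  (forall h, normc h = s -> normc (P.[d + h] - Q.[h]) <= M) ->
  normc (P^`N(k).[d] - Q`_k) * s ^+ k <= M.
Proof.
move=> s0 hP; pose N := maxn (size P) k.+1.
have -> : P^`N(k).[d] - Q`_k = (\poly_(i < N) P^`N(i).[d] - Q)`_k.
  by rewrite coefB coef_poly /N leq_max leqnn orbT.
apply: poly_cauchy => // h hs; rewrite hornerD hornerN horner_poly.
by rewrite -(nderiv_taylor_wide (x := d)) ?hP// ?leq_maxl//; exact: mulrC.
Qed.

Lemma power_series_taylor g b r P d s t M k : power_series (fun h => g (d + h)) b r ->
  0 <= s < r -> normc d + s <= t -> (forall h, normc h <= t -> normc (g h - P.[h]) <= M) ->
  normc (P^`N(k).[d] - b k) * s ^+ k <= M.
Proof.
move=> hg s01 dst hM; have [s0 _] := andP s01; have [B [q [B0 q01 hB]]] := hg s s01.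
apply: (@le_of_geom _ _ B q k.+1) => // K kK.
have -> : b k = (tpoly b K)`_k by rewrite coef_poly kK.
apply: taylor_cauchy => // h hs.
rewrite (_ : _ - _ = (g (d + h) - (tpoly b K).[h]) - (g (d + h) - P.[d + h])); last by ring.
rewrite (le_trans (le_normcB _ _))// addrC lerD//; first by rewrite hM// (le_trans (le_normcD _ _))// hs.
by rewrite hB// hs.
Qed.

(** The new coefficients are the limits of the Taylor coefficients at d of the truncations
    [tpoly a K]. Cauchy's estimate on a circle of radius s turns uniform closeness of the
    truncations into closeness of these coefficients, in place of rearranging a double series. *)
Lemma power_series_translate g a r d : power_series g a r -> normc d < r ->
  exists b, power_series (fun h => g (d + h)) b (r - normc d).
Proof.
move=> hg dr; have d0 := normc_ge0 d.
pose bK k K := (tpoly a K)^`N(k).[d].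
have cau s : 0 <= s < r - normc d -> exists B q : R, [/\ 0 <= B, 0 <= q < 1,
    (forall h K, normc h <= s -> normc (g (d + h) - (tpoly a K).[d + h]) <= B * q ^+ K) &
    forall k K K', (K <= K')%N -> normc (bK k K' - bK k K) * s ^+ k <= 2 * B * q ^+ K].
  move=> /andP[s0 sr]; have [|B [q [B0 q01 hB]]] := hg (normc d + s); first lra.
  have [q0 q1] := andP q01; exists B, q; split => // [h K hs|k K K' KK].
    by apply: hB; apply: le_trans (le_normcD _ _) _; rewrite lerD2l.
  rewrite (_ : bK k K' - bK k K = (tpoly a K' - tpoly a K)^`N(k).[d] - (0 : {poly C})`_k); last first.
    by rewrite coef0 subr0 nderivnB hornerD hornerN.
  apply: taylor_cauchy => // h hs; rewrite horner0 subr0 hornerD hornerN.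
  have dh : normc (d + h) <= normc d + s by rewrite -hs le_normcD.
  rewrite (_ : _ - _ = (g (d + h) - (tpoly a K).[d + h]) - (g (d + h) - (tpoly a K').[d + h])); last by ring.
  rewrite (le_trans (le_normcB _ _))// -mulrA mulr_natl mulr2n lerD ?hB//.
  by rewrite (le_trans (hB _ _ _))// ler_wpM2l// ler_wiXn2l// ltW.
have bex k : exists l, exists B q : R, 0 <= q < 1 /\ forall K, normc (l - bK k K) <= B * q ^+ K.
  pose s := (r - normc d) / 2; have s0 : 0 < s by rewrite /s; lra.
  have [|B [q [B0 q01 _ hB]]] := cau s; first by rewrite /s; lra.
  have [l hl] : exists l, forall K, normc (l - bK k K) <= 2 * (2 * B / s ^+ k) * q ^+ K.
    apply: geom_cauchy => K K' KK; rewrite mulrAC ler_pdivlMr ?exprn_gt0//.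
    exact: hB.
  by exists l, (2 * (2 * B / s ^+ k)), q.
have [b hb] := choice bex; exists b => s' /andP[s0' sr'].
pose s := (s' + (r - normc d)) / 2; have ss : s' < s by rewrite /s; lra.
have s0 : 0 < s by apply: le_lt_trans ss.
have [|B [q [B0 q01 hB hbK]]] := cau s; first by rewrite /s; lra.
have [q0 q1] := andP q01.
have bb k K : normc (b k - bK k K) * s ^+ k <= 2 * B * q ^+ K.
  have [B' [q' [q01' hB']]] := hb k.
  apply: (@le_of_geom _ _ (B' * s ^+ k) q' K) => // K' KK.
  rewrite (_ : b k - _ = (bK k K' - bK k K) + (b k - bK k K')); last by ring.
  apply: (@le_trans _ _ ((normc (bK k K' - bK k K) + normc (b k - bK k K')) * s ^+ k)).
    by rewrite ler_wpM2r ?exprn_ge0 ?(ltW s0)// le_normcD.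
  by rewrite mulrDl lerD ?hbK// mulrAC ler_wpM2r ?exprn_ge0 ?(ltW s0).
have x01 : 0 <= s' / s < 1 by rewrite divr_ge0 ?(ltW s0)//= ltr_pdivrMr// mul1r.
exists (B + 2 * B * (1 - s' / s)^-1), q.
have i0 : 0 <= (1 - s' / s)^-1 by rewrite invr_ge0; lra.
split => // [|K h hs]; first by rewrite addr_ge0// mulr_ge0// mulr_ge0.
(* Both series are cut at the same K: there remain the error of g against [tpoly a K] and the errors
   of K coefficients, summed as a geometric series of ratio s'/s. *)
have -> : g (d + h) - (tpoly b K).[h] = (g (d + h) - (tpoly a K).[d + h]) -
    \sum_(k < K) (b k - bK k K) * h ^+ k.
  rewrite (nderiv_taylor_wide (n := K)) ?size_poly//; last exact: mulrC.
  rewrite horner_poly -addrA -opprD -big_split /=; congr (_ - _).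
  by apply: eq_bigr => k _; rewrite mulrBl addrC subrK.
rewrite (le_trans (le_normcB _ _))// mulrDl lerD//; first by rewrite hB// (le_trans hs)// ltW.
rewrite (le_trans (normc_sum _ _ _))//.
apply: (@le_trans _ _ (2 * B * q ^+ K * \sum_(k < K) (s' / s) ^+ k)).
  rewrite mulr_sumr; apply: ler_sum => k _; rewrite normcM normcX.
  rewrite expr_div_n mulrA ler_pdivlMr ?exprn_gt0// mulrAC.
  by rewrite ler_pM ?mulr_ge0 ?exprn_ge0 ?normc_ge0 ?(ltW s0)// lerXn2r ?nnegrE ?normc_ge0.
rewrite [leRHS]mulrAC ler_wpM2l ?geom_sum_le// mulr_ge0 ?exprn_ge0// mulr_ge0//.
Qed.

(** A Lebesgue number argument. The disc sits in the compact square of side 2 rho, and [P] asks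
    nothing at points of the square outside the disc. *)
Lemma uniform_radius (Q : R -> C -> Prop) rho :
  (forall r r' p, r' <= r -> Q r p -> Q r' p) ->
  (forall p, normc p <= rho -> exists r, 0 < r /\ forall p', normc (p' - p) < r -> Q r p') ->
  exists2 d : R, 0 < d & forall p, normc p <= rho -> Q d p.
Proof.
move=> Qanti Qloc; pose K := `[- rho, rho]%classic `*` `[- rho, rho]%classic : set (R * R)%type.
have cK : compact K by apply: compact_setX; exact: segment_compact.
pose P (d : R) (v : R * R) := normc (v.1 +i* v.2) <= rho -> Q d (v.1 +i* v.2).
have /compact_near_coveringP/(_ R 0^'+ P _) cov := cK.
have : \forall d \near 0^'+, K `<=` P d.
  apply: cov => -[x y] _.
  have [r [r0 hr]] : exists r, 0 < r /\ forall p', normc (p' - (x +i* y)) < r -> normc p' <= rho -> Q r p'.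
    have [xy|xy] := leP (normc (x +i* y)) rho.
      by have [r [r0 hr]] := Qloc _ xy; exists r; split => // p' h _; exact: hr.
    (* A neighbourhood that misses the disc, where the claim is vacuous. *)
    exists (normc (x +i* y) - rho); rewrite subr_gt0; split => // p' h pr.
    have := ler_dist_normc p' (x +i* y); rewrite ler_norml => /andP[h1 h2].
    by exfalso; lra.
  have r2 : 0 < r / 2 by rewrite divr_gt0.
  have N1 : \forall v \near nbhs (x, y), `|v.1 - x| < r / 2.
    exists (ball x (r / 2), setT) => [|-[u w] [/= h _]]; last by rewrite distrC.
    by split; [exact: nbhsx_ballx|exact: filterT].
  have N2 : \forall v \near nbhs (x, y), `|v.2 - y| < r / 2.
    exists (setT, ball y (r / 2)) => [|-[u w] [/= _ h]]; last by rewrite distrC.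
    by split; [exact: filterT|exact: nbhsx_ballx].
  near=> v d.
  rewrite /P /= => hv; have dr : d <= r by near: d; exact: nbhs_right_le.
  apply: (Qanti r) => //.
  apply: hr => //; apply: le_lt_trans (normc_le_ReIm _) _ => /=.
  have h1 : `|v.1 - x| < r / 2 by near: v; exact: N1.
  have h2 : `|v.2 - y| < r / 2 by near: v; exact: N2.
  lra.
move=> h; have [d [d0 hd]] : exists d : R, 0 < d /\ K `<=` P d.
  near (0 : R)^'+ => d; exists d; split; last by near: d.
  by near: d; exact: nbhs_right_gt.
exists d => // p pr; rewrite [p]complexEta.
apply: (hd (complex.Re p, complex.Im p)); last by move: pr; rewrite {1}[p]complexEta.
have := Re_le_normc p; have := Im_le_normc p.
by rewrite !ler_norml => /andP[? ?] /andP[? ?]; split; rewrite /= in_itv /=; apply/andP; split; lra.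
Unshelve. all: by end_near.
Qed.

(* The coefficients at [d], |d| = r, are bounded by M tau^-k; they are the
   values at [d] of the polynomials [tpoly a K]^`N(k) up to a small error. *)
Lemma binomial_coef_le g a (rho r delta tau M : R) l k : power_series g a rho ->
  0 < r < rho -> 0 < tau < delta ->
  (forall d, normc d = r -> (exists b, power_series (fun h => g (d + h)) b delta) /\
     forall h, normc h < delta -> normc (g (d + h)) <= M) ->
  (k <= l)%N -> normc (a l) * 'C(l, k)%:R * r ^+ (l - k) * tau ^+ k <= M.
Proof.
move=> ha /andP[r0 rr] /andP[t0 td] hg kl.
pose s := (r + rho) / 2; have s01 : 0 <= s < rho by rewrite /s; lra.
have [B [q [B0 q01 hB]]] := ha s s01.
(* Points within sg of the circle |d| = r stay in the disc of radius s, where the truncations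
   converge uniformly to g. *)
pose sg := Num.min (s - r) tau.
have sg0 : 0 < sg by rewrite lt_min t0 andbT /s; lra.
have sgt : sg <= tau by rewrite /sg ge_min lexx orbT.
have sgs : sg <= s - r by rewrite /sg ge_min lexx.
rewrite -ler_pdivlMr ?exprn_gt0//.
apply: (@le_of_geom _ _ (B / sg ^+ k) q l.+1) => // K lK.
have -> : normc (a l) * 'C(l, k)%:R * r ^+ (l - k) = normc ((tpoly a K)^`N(k))`_(l - k) * r ^+ (l - k).
  rewrite coef_nderivn subnKC// coef_poly lK -[a l *+ _]mulr_natr normcM.
  by rewrite -[in RHS](rmorph_nat (real_complex R)) normc_real ger0_norm.
apply: poly_cauchy => [|d dr]; first exact: ltW.
have [[b hb] hM] := hg d dr.
have bk : normc (b k) * tau ^+ k <= M.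
  apply: (power_series_coef_le _ hb) => [|h ht]; first by rewrite (ltW t0).
  exact/hM/(le_lt_trans ht).
have tk : normc ((tpoly a K)^`N(k).[d] - b k) * sg ^+ k <= B * q ^+ K.
  apply: (power_series_taylor (g := g) (r := delta) (t := s)) => //.
  - by rewrite (ltW sg0) (le_lt_trans sgt).
  - by rewrite dr; lra.
  - by move=> h hs; exact: hB.
rewrite -[X in normc X](subrK (b k)) (le_trans (le_normcD _ _))// addrC lerD//.
  by rewrite ler_pdivlMr ?exprn_gt0.
by rewrite mulrAC ler_pdivlMr ?exprn_gt0.
Qed.

(* If the radius were rho < 1, Cauchy's estimates at the points of the circles
   |d| = r, r < rho, where the local radius is at least delta, would give
   |a_l| (r + delta / 2)^l <= 3 M for all l. *)
Lemma power_series_disc g a M r0 : 0 < r0 ->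
  power_series g a r0 ->
  (forall p, normc p < 1 -> exists r b, 0 < r /\ power_series (fun h => g (p + h)) b r) ->
  (forall p, normc p < 1 -> normc (g p) <= M) ->
  power_series g a 1.
Proof.
move=> r00 ha0 hloc hM.
pose E := [set r | 0 < r <= 1 /\ power_series g a r].
have ubE : has_ubound E by exists 1 => r [/andP[_ ->]].
have E0 : E (Num.min r0 1).
  rewrite /E /= ge_min lexx orbT lt_min r00 ltr01; split => //.
  by apply: power_series_le ha0; rewrite ge_min lexx.
pose rho := sup E.
have rho0 : 0 < rho.
  by apply: lt_le_trans (ub_le_sup ubE E0); rewrite lt_min r00 ltr01.
have rho1 : rho <= 1 by apply: ge_sup => [|r [/andP[_ ->]]//]; exists (Num.min r0 1).
have ha : power_series g a rho.
  move=> s /andP[s0 sr].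
  have [r Er sr'] : exists2 r, E r & s < r.
    have supE : has_sup E by split => //; exists (Num.min r0 1).
    have rs : 0 < rho - s by rewrite subr_gt0.
    by have [r ? h] := sup_adherent rs supE; exists r => //; move: h; rewrite -/rho opprB addrCA subrr addr0.
  by apply: Er.2; rewrite s0.
have [rho_eq|rhon1] := eqVneq rho 1; first by move: ha; rewrite rho_eq.
have rholt : rho < 1 by rewrite lt_neqAle rhon1.
pose Q (r : R) p := r <= 1 - normc p /\ exists b, power_series (fun h => g (p + h)) b r.
have [delta delta0 hdelta] : exists2 d : R, 0 < d & forall p, normc p <= rho -> Q d p.
  apply: uniform_radius => [r r' p rr' [h1 [b hb]]|p prho].
    by split; [exact: le_trans h1|exists b; exact: power_series_le hb].
  have p1 : normc p < 1 by exact: le_lt_trans rholt.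
  have [r [b [r0' hb]]] := hloc p p1.
  pose r1 := Num.min (r / 2) ((1 - normc p) / 2).
  have r10 : 0 < r1 by rewrite lt_min; apply/andP; split; lra.
  have r1r : r1 <= r / 2 by rewrite ge_min lexx.
  have r1p : r1 <= (1 - normc p) / 2 by rewrite ge_min lexx orbT.
  exists r1; split => // p' hp'.
  have := ler_dist_normc p' p; rewrite ler_norml => /andP[h1 h2].
  split; first lra.
  have [|b' hb'] := @power_series_translate _ _ _ (p' - p) hb; first lra.
  exists b'; apply: (@power_series_le _ _ (r - normc (p' - p))); first lra.
  by apply: eq_power_series hb' => h _; rewrite addrA addrCA subrr addr0.
have al r l : 0 < r < rho -> normc (a l) * (r + delta / 2) ^+ l <= 3 * M.
  (* The factor 3/4 keeps tau below delta, while delta / 2 = (2/3) tau bounds the binomial expansion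
     of (r + delta / 2)^l by a geometric series of sum 3. *)
  move=> r01; have [r0' rr] := andP r01; pose tau := delta * (3/4).
  have t0 : 0 < tau < delta by rewrite /tau; lra.
  have key k : (k <= l)%N -> normc (a l) * 'C(l, k)%:R * r ^+ (l - k) * tau ^+ k <= M.
    apply: (binomial_coef_le ha r01 t0) => // d dr.
    have [|h1 hb] := hdelta d; first by rewrite dr ltW.
    split => // h hd; apply: hM; apply: le_lt_trans (le_normcD _ _) _; lra.
  have M0 : 0 <= M by apply: le_trans (hM 0 _); rewrite ?normc_ge0// normc0.
  have x01 : 0 <= (2/3 : R) < 1 by lra.
  rewrite exprDn mulr_sumr; apply: (@le_trans _ _ (\sum_(k < l.+1) M * (2/3) ^+ k)).
    apply: ler_sum => -[k /= kl] _; rewrite ltnS in kl.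
    have -> : delta / 2 = tau * (2/3) by rewrite /tau; field.
    rewrite exprMn -mulr_natr.
    have -> : normc (a l) * (r ^+ (l - k) * (tau ^+ k * (2 / 3) ^+ k) * 'C(l, k)%:R) =
      normc (a l) * 'C(l, k)%:R * r ^+ (l - k) * tau ^+ k * (2 / 3) ^+ k by ring.
    by rewrite ler_wpM2r ?key// exprn_ge0//; lra.
  rewrite -mulr_sumr mulrC ler_wpM2r//.
  apply: le_trans (geom_sum_le _ x01) _.
  by rewrite le_eqVlt; apply/orP; left; apply/eqP; field.
(* The bound yields the sum h0 of the same series on a larger disc. It equals g for |x| < rho;
   extending the equality to the annulus contradicts the choice of rho. *)
pose rho' := rho + delta / 2.
have rho'0 : 0 < rho' by rewrite /rho'; lra.
have [h0 hh] : exists g', power_series g' a rho'.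
  apply: power_series_exists => // s /andP[s0 sr]; exists (3 * M) => k.
  pose r := Num.max (rho / 2) (s - delta / 2).
  have r1 : 0 < r < rho.
    by rewrite lt_max gt_max; apply/andP; split; [apply/orP; left; lra|apply/andP; split; move: sr; rewrite /rho'; lra].
  have rs : s <= r + delta / 2.
    have : s - delta / 2 <= r by rewrite le_max lexx orbT.
    lra.
  apply: le_trans (al r k r1); rewrite ler_wpM2l ?normc_ge0// lerXn2r ?nnegrE//.
  by case/andP: r1; lra.
have gh x : normc x < rho -> g x = h0 x.
  by move=> xr; apply: (power_series_agree (r := rho) ha _ _ xr) => //; apply: power_series_le hh; rewrite /rho'; lra.
have rhod : rho' <= 1.
  have [] := hdelta rho%:C; rewrite normc_real gtr0_norm// => h1 _.
  by rewrite /rho'; lra.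
have hrho' : power_series g a rho'.
  apply: (eq_power_series _ hh) => z zr; have [zr'|zr'] := ltP (normc z) rho; first by rewrite gh.
  (* The modulus of a point p on the segment from 0 to z: below rho, so that g = h0 near p, and
     above |z| - delta / 2, so that z lies in the disc around p where g has its own expansion. *)
  pose t := Num.max (rho / 2) ((normc z - delta / 2 + rho) / 2).
  have zr2 : normc z < rho + delta / 2 by [].
  have t0 : 0 < t by rewrite lt_max; apply/orP; left; lra.
  have t1 : t < rho by rewrite gt_max; apply/andP; split; lra.
  have t2 : normc z - delta / 2 < t by rewrite lt_max; apply/orP; right; lra.
  have z0 : 0 < normc z by exact: lt_le_trans zr'.
  pose p := (t / normc z)%:C * z.
  have pt : normc p = t.
    by rewrite normcM normc_real ger0_norm ?divr_ge0 ?(ltW t0) ?(ltW z0)// divfK// gt_eqF.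
  have zp : normc (z - p) = normc z - t.
    have -> : z - p = (1 - t / normc z)%:C * z by rewrite rmorphB rmorph1 mulrBl mul1r.
    have tz : t / normc z <= 1 by rewrite ler_pdivrMr// mul1r (le_trans (ltW t1)).
    by rewrite normcM normc_real ger0_norm ?subr_ge0// mulrBl mul1r divfK// gt_eqF.
  have [|_ [b hb]] := hdelta p; first by rewrite pt ltW.
  have [|b' hb'] := power_series_translate hh (d := p); first by rewrite pt; lra.
  rewrite pt in hb'.
  pose r := Num.min delta (rho - t).
  have r_gt0 : 0 < r by rewrite lt_min delta0 subr_gt0.
  have rd : r <= delta by rewrite ge_min lexx.
  have rt : r <= rho - t by rewrite ge_min lexx orbT.
  have bb' k : b' k = b k.
    have e1 := power_series_le rd hb.
    have rr : r <= rho' - t by rewrite /rho'; lra.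
    have e2 := power_series_le rr hb'.
    apply: (power_series_uniq r_gt0 e2); apply: eq_power_series e1 => h hr.
    by apply: gh; apply: le_lt_trans (le_normcD _ _) _; rewrite pt; lra.
  rewrite (_ : z = p + (z - p)); last by rewrite addrC subrK.
  pose u := Num.min delta (rho' - t).
  apply: (power_series_agree (r := u) (g := fun h => h0 (p + h)) (g' := fun h => g (p + h)) _ _ bb').
  - by apply: power_series_le hb'; rewrite ge_min lexx orbT.
  - by apply: power_series_le hb; rewrite ge_min lexx.
  - by rewrite zp lt_min /rho'; apply/andP; split; lra.
have : rho' <= rho by apply: ub_le_sup => //; split => //; rewrite rho'0.
by rewrite /rho'; lra.
Qed.

End power_series.

(** * Interpolants bound the functional *)

Section degree_sums.
Context {R : realType} (n : nat).
Local Notation Cn := 'rV[R[i]]_n.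
Implicit Types (a : {ffun 'I_n -> nat}) (c : {ffun 'I_n -> nat} -> R[i]) (z w h : Cn).

Lemma boxset_degree_sum (V : nmodType) (F : {ffun 'I_n -> nat} -> V) N k : (k < N)%N ->
  \sum_(a <- boxset n N | degree a == k) F a = \sum_(a <- boxset n k.+1 | degree a == k) F a.
Proof.
move=> kN; rewrite -big_filter -[RHS]big_filter; apply: perm_big.
apply: uniq_perm; rewrite ?filter_uniq ?boxset_uniq// => a.
rewrite !mem_filter !mem_boxset; apply: andb_id2l => /eqP ak.
have h M : (k < M)%N -> [forall i, (a i < M)%N].
  by move=> kM; apply/forallP => i; apply: leq_ltn_trans (le_degree a i) _; rewrite ak.
by rewrite !h.
Qed.

Lemma degree_sumE (V : nmodType) (F : {ffun 'I_n -> nat} -> V) N K : (K <= N)%N ->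
  \sum_(k < K) \sum_(a <- boxset n k.+1 | degree a == k) F a =
  \sum_(a <- boxset n N | (degree a < K)%N) F a.
Proof.
move=> KN; rewrite (eq_bigr (fun k : 'I_K => \sum_(a <- boxset n N | degree a == k) F a)); last first.
  by move=> k _; rewrite [RHS]boxset_degree_sum// (leq_trans (ltn_ord k)).
under eq_bigr do rewrite big_mkcond.
rewrite exchange_big [RHS]big_mkcond /=; apply: eq_bigr => a _.
rewrite -big_mkcond /=; under eq_bigl do rewrite eq_sym.
by rewrite (big_ord1_eq _ (fun=> F a)).
Qed.

(** The homogeneous part of degree k; all multi-indices of that degree lie in the box of side k +
    1. *)
Definition degpart c z k : R[i] := \sum_(a <- boxset n k.+1 | degree a == k) monomial_term c z a.

Lemma monomial_termZ c (t : R[i]) z a :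
  monomial_term c (t *: z) a = t ^+ degree a * monomial_term c z a.
Proof.
rewrite /monomial_term mulrCA; congr (_ * _); rewrite /degree -prodrXr -big_split /=.
by apply: eq_bigr => i _; rewrite mxE exprMn.
Qed.

Lemma degpartZ c (t : R[i]) z k : degpart c (t *: z) k = degpart c z k * t ^+ k.
Proof.
rewrite /degpart mulr_suml; apply: eq_bigr => a /eqP ak.
by rewrite monomial_termZ ak mulrC.
Qed.

Lemma ispoly_degpart c k : ispoly (fun z => degpart c z k).
Proof.
have [p hp] : ispoly (fun z => \sum_(a <- [seq a <- boxset n k.+1 | degree a == k]) monomial_term c z a).
  apply: ispoly_sum => a; apply: ispolyM; first exact: ispoly_cst.
  by apply: ispoly_prod => i; apply: ispolyX; exact: ispoly_coord.
by exists p => z; rewrite -hp big_filter.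
Qed.

Lemma summable_le c z : summable setT (fun a => (normc (monomial_term c z a))%:E) ->
  exists B : R, forall N (P : pred {ffun 'I_n -> nat}),
    \sum_(a <- boxset n N | P a) normc (monomial_term c z a) <= B.
Proof.
rewrite /summable => h; set e := (X in (X < _)%E) in h.
have e0 : (0 <= e)%E by apply: esum_ge0.
exists (fine e) => N P; rewrite -lee_fin fineK ?ge0_fin_numE// -big_filter.
have u : uniq [seq a <- boxset n N | P a] by rewrite filter_uniq ?boxset_uniq.
apply: esum_ge; exists [set` [seq a <- boxset n N | P a]]; first by split => //; exact: finite_seq.
rewrite -fsbig_seq// -sumEFin big_seq [leRHS]big_seq; apply: lee_sum => a _.
by rewrite abse_EFin lee_fin ler_norm.
Qed.

End degree_sums.

Section slices.
Context {R : realType} (n : nat).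
Local Notation Cn := 'rV[R[i]]_n.
Implicit Types (phi : Cn -> R[i]) (c : {ffun 'I_n -> nat} -> R[i]) (z w p : Cn).

Lemma slice_power_series phi c p w (r : R) : 0 < r -> cnorm w <= 1 ->
  (forall h, cnorm h < r -> summable setT (fun a => (normc (monomial_term c h a))%:E) /\
     normc (phi (p + h) - box_sum c N h) @[N --> \oo] --> (0 : R)) ->
  power_series (fun t => phi (p + t *: w)) (degpart c w) r.
Proof.
move=> r0 w1 hc s /andP[s0 sr]; pose t := (s + r) / 2.
have st : s < t by rewrite /t; lra.
have t0 : 0 < t by apply: le_lt_trans st.
have tr : t < r by rewrite /t; lra.
have tw : cnorm (t%:C *: w) < r.
  rewrite cnormZ normc_real gtr0_norm// (le_lt_trans _ tr)//.
  by rewrite ler_piMr// ltW.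
have [B hB] := summable_le (hc _ tw).1.
have q01 : 0 <= s / t < 1 by rewrite divr_ge0 ?(ltW t0)//= ltr_pdivrMr// mul1r.
have B0 : 0 <= B by apply: le_trans (hB 0%N pred0); rewrite big_pred0_eq.
exists B, (s / t); split => // K h hs.
have hw : cnorm (h *: w) < r.
  rewrite cnormZ (le_lt_trans _ sr)// (le_trans _ hs)//.
  by rewrite ler_piMr// normc_ge0.
have tE N : (K <= N)%N -> (tpoly (degpart c w) K).[h] =
    \sum_(a <- boxset n N | (degree a < K)%N) monomial_term c (h *: w) a.
  move=> KN; rewrite horner_poly -(degree_sumE _ KN); apply: eq_bigr => k _.
  by rewrite -degpartZ.
have bnd N : (K <= N)%N -> normc (box_sum c N (h *: w) - (tpoly (degpart c w) K).[h]) <= B * (s / t) ^+ K.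
  move=> KN; rewrite (tE N KN) box_sumE (bigID (fun a => (degree a < K)%N))/= addrAC subrr add0r.
  rewrite (le_trans (normc_sum _ _ _))//.
  apply: (@le_trans _ _ (\sum_(a <- boxset n N | ~~ (degree a < K)%N)
    normc (monomial_term c (t%:C *: w) a) * (s / t) ^+ K)).
    apply: ler_sum => a; rewrite -leqNgt => Ka.
    rewrite !monomial_termZ normcM [normc (t%:C ^+ _ * _)]normcM !normcX normc_real gtr0_norm//.
    apply: (@le_trans _ _ (s ^+ degree a * normc (monomial_term c w a))).
      by rewrite ler_wpM2r ?normc_ge0// lerXn2r ?nnegrE ?normc_ge0.
    rewrite mulrAC ler_wpM2r ?normc_ge0//.
    rewrite -[s in leLHS](@divfK _ t) ?gt_eqF// exprMn mulrC.
    rewrite ler_wpM2l ?exprn_ge0 ?(ltW t0)// ler_wiXn2l//; last exact: ltW (proj2 (andP q01)).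
    by case/andP: q01.
  by rewrite -mulr_suml ler_wpM2r ?hB// exprn_ge0//; case/andP: q01.
apply/ler_addgt0Pr => e e0.
have /cvgrPdist_lt/(_ e e0)[N0 _ hN] := (hc _ hw).2.
pose N := maxn N0 K.
have := hN N (leq_maxl _ _); rewrite /= sub0r normrN ger0_norm ?normc_ge0// => hNe.
rewrite (_ : _ - _ = (box_sum c N (h *: w) - (tpoly (degpart c w) K).[h]) +
  (phi (p + h *: w) - box_sum c N (h *: w))); last by ring.
by rewrite (le_trans (le_normcD _ _))// lerD ?bnd ?leq_maxr ?(ltW hNe).
Qed.

Lemma power_series_continuous (g : R[i] -> R[i]) b r : 0 < r -> power_series g b r ->
  forall e : R, 0 < e -> exists2 d : R, 0 < d & forall x, normc x <= d -> normc (g x - g 0) <= e.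
Proof.
move=> r0 hg e e0; pose t := r / 2; have t0 : 0 < t by rewrite /t; lra.
have [|M hM] := @power_series_bound _ g b r t hg; first by rewrite /t; lra.
have M0 : 0 <= M by apply: le_trans (hM 0%N); rewrite mulr_ge0 ?normc_ge0 ?exprn_ge0 ?(ltW t0).
have T1 x : (tpoly b 1).[x] = b 0%N by rewrite horner_poly big_ord1 expr0 mulr1.
have key x : normc x < t -> normc (g x - b 0%N) <= M * (1 - normc x / t)^-1 * (normc x / t).
  move=> xt; have xr : 0 <= normc x < r by rewrite normc_ge0 (lt_trans xt)// /t; lra.
  have [B [q [B0 q01 hB]]] := hg (normc x) xr.
  apply: (@le_of_geom _ _ _ B q 1) => // K K1.
  rewrite -(T1 x) (_ : _ - _ = ((tpoly b K).[x] - (tpoly b 1).[x]) + (g x - (tpoly b K).[x])); last by ring.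
  rewrite (le_trans (le_normcD _ _))// lerD ?hB// -{2}(expr1 (normc x / t)).
  by apply: tpoly_diff => //; rewrite normc_ge0.
have g0 : g 0 = b 0%N.
  have := key 0; rewrite normc0 => /(_ t0); rewrite mul0r mulr0 => h.
  by apply/eqP; rewrite -subr_eq0 -normc_eq0 eq_le h normc_ge0.
(* The first bound makes the inverse of 1 - |x|/t at most 2, the second makes 2M|x|/t at most e. *)
exists (Num.min (t / 2) (e * t / (2 * (M + 1)))).
  by rewrite lt_min !divr_gt0 ?mulr_gt0//; lra.
move=> x; rewrite le_min => /andP[x1 x2]; have x0 := normc_ge0 x.
rewrite g0; apply: le_trans (key x _) _; first lra.
have h1 : (1 - normc x / t)^-1 <= 2.
  have h2 : normc x / t <= 1 / 2 by rewrite ler_pdivrMr//; lra.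
  rewrite invf_ple ?posrE; lra.
have h2 : normc x / t <= e / (2 * (M + 1)).
  by rewrite ler_pdivrMr// mulrAC.
have h0 : 0 <= normc x / t by rewrite divr_ge0// ltW.
apply: (@le_trans _ _ (M * 2 * (e / (2 * (M + 1))))).
  have i0 : 0 <= (1 - normc x / t)^-1.
    rewrite invr_ge0 subr_ge0 ler_pdivrMr//; lra.
  by rewrite ler_pM// ?mulr_ge0// ler_wpM2l.
have -> : M * 2 * (e / (2 * (M + 1))) = e * (M / (M + 1)) by field; lra.
by rewrite ler_piMr ?(ltW e0)// ler_pdivrMr; lra.
Qed.

End slices.

Section interpolation_bound.
Context {R : realType} (n : nat).
Local Notation Cn := 'rV[R[i]]_n.
Local Notation S := (unit_sphere R n).

Lemma le_L1norm (f g : Cn -> R[i]) : measurable_fun S f -> measurable_fun S g ->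
  (forall x, S x -> normc (f x) <= normc (g x)) -> (L1norm f <= L1norm g)%E.
Proof.
move=> mf mg fg; have mS : measurable S by exact: measurable_unit_sphere.
apply: ge0_le_integral => //.
- by move=> x _; rewrite lee_fin normc_ge0.
- by apply/measurable_EFinP; exact: measurable_fun_normc.
- by apply/measurable_EFinP; exact: measurable_fun_normc.
Qed.

Implicit Types (phi : Cn -> R[i]) (z w : Cn).

Lemma cnorm0 : cnorm (0 : Cn) = 0.
Proof. by rewrite /cnorm big1 ?sqrtr0// => i _; rewrite mxE normc0 expr0n. Qed.

(** One expansion at the center serves all slices: by [power_series_disc] it converges on each of
    them up to radius 1, and Cauchy's estimate bounds the homogeneous parts uniformly in the
    direction. Cutting the dilate at degree K leaves a polynomial with uniformly small error. *)
Lemma dilation_approx phi (M s e : R) : analytic_on_ball phi ->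
  (forall z, cnorm z < 1 -> normc (phi z) <= M) -> 0 <= s < 1 -> 0 < e ->
  exists p, forall z, cnorm z <= 1 -> normc (phi (s%:C *: z) - weval p z) <= e.
Proof.
move=> hphi hM /andP[s0 s1] e0.
have [|r [c [r0 hc]]] := hphi 0; first by rewrite /unit_ball /= cnorm0 ltr01.
have hps w : cnorm w <= 1 -> power_series (fun t => phi (t *: w)) (degpart c w) 1.
  move=> w1; have wt t : normc t < 1 -> cnorm (t *: w) < 1.
    move=> t1; rewrite cnormZ (le_lt_trans _ t1)// ler_piMr ?normc_ge0//.
  apply: (power_series_disc (M := M) r0).
  - have := slice_power_series r0 w1 hc.
    by apply: eq_power_series => h _; rewrite add0r.
  - move=> t t1; have [r' [c' [r0' hc']]] := hphi _ (wt t t1).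
    exists r', (degpart c' w); split => //.
    have := slice_power_series r0' w1 hc'.
    by apply: eq_power_series => h _; rewrite scalerDl.
  - by move=> t t1; apply/hM/wt.
pose t := (1 + s) / 2; have t01 : 0 <= t < 1 by rewrite /t; lra.
have st : s < t by rewrite /t; lra.
have t0 : 0 < t by apply: le_lt_trans st.
have hcoef w k : cnorm w <= 1 -> normc (degpart c w k) * t ^+ k <= M.
  move=> w1; apply: (power_series_coef_le _ (hps w w1) t01) => h ht.
  apply: hM; rewrite cnormZ (le_lt_trans (y := t))//; last by case/andP: t01.
  by rewrite (le_trans _ ht)// ler_piMr ?normc_ge0.
have q01 : 0 <= s / t < 1 by rewrite divr_ge0 ?(ltW t0)//= ltr_pdivrMr// mul1r.
have [K hK] := expr_cvg0 (M * (1 - s / t)^-1) q01 e0.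
have [p hp] : ispoly (fun z => \sum_(k < K) degpart c z k * s%:C ^+ k).
  apply: ispoly_sum => k; apply: ispolyM; [exact: ispoly_degpart|exact: ispoly_cst].
exists p => w w1; rewrite -hp.
have -> : \sum_(k < K) degpart c w k * s%:C ^+ k = (tpoly (degpart c w) K).[s%:C].
  by rewrite horner_poly.
have [|B [q [B0 q01' hB]]] := hps w w1 s; first by rewrite s0.
have ns : normc s%:C = s by rewrite normc_real ger0_norm.
apply: le_trans (ltW (hK K (leqnn _))).
apply: (@le_of_geom _ _ _ B q K) => // L KL.
rewrite (_ : _ - _ = ((tpoly (degpart c w) L).[s%:C] - (tpoly (degpart c w) K).[s%:C]) +
  (phi (s%:C *: w) - (tpoly (degpart c w) L).[s%:C])); last by ring.
rewrite (le_trans (le_normcD _ _))// lerD ?hB ?ns//.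
by apply: tpoly_diff => //; rewrite ?s0 ?ns// => k; exact: hcoef.
Qed.

Let error_budget (x y u v : R) : 0 <= y -> 0 <= u -> 0 < v ->
  (x + v / (y + u + 1)) * y + u * (v / (y + u + 1)) <= x * y + v.
Proof.
move=> y0 u0 v0.
have -> : (x + v / (y + u + 1)) * y + u * (v / (y + u + 1)) =
  x * y + v * ((y + u) / (y + u + 1)) by field; lra.
by rewrite lerD2l ler_piMr ?(ltW v0)// ler_pdivrMr; lra.
Qed.

Variables (m : nat) (Z : 'I_m -> Cn).
Hypothesis Zball : forall i, unit_ball R n (Z i).

Lemma bounded_analytic_approx phi (M e : R) : analytic_on_ball phi ->
  (forall z, cnorm z < 1 -> normc (phi z) <= M) -> 0 < e ->
  exists p, (forall z, cnorm z <= 1 -> normc (weval p z) <= M + e) /\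
    forall j, normc (weval p (Z j) - phi (Z j)) <= e.
Proof.
move=> hphi hM e0; have e2 : 0 < e / 2 by lra.
have hd j : exists d : R, 0 < d /\ forall x, normc x <= d ->
    normc (phi (Z j + x *: Z j) - phi (Z j)) <= e / 2.
  have [r [c [r0 hc]]] := hphi _ (Zball j).
  have hZ : cnorm (Z j) <= 1 by apply: ltW; exact: Zball.
  have [d d0 hd] := power_series_continuous r0 (slice_power_series r0 hZ hc) e2.
  by exists d; split => // x hx; have := hd x hx; rewrite scale0r addr0.
have [d hd'] := choice hd.
(* How close to 1 the dilation factor must be to move no value phi(Z j) by more than e/2. *)
pose d0 := \big[Num.min/1]_j d j.
have d00 : 0 < d0 by apply: lt_bigmin => // j _; case: (hd' j).
pose s := 1 - d0; pose s' := Num.max s 0.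
have s01 : 0 <= s' < 1 by rewrite le_max lexx orbT gt_max ltr01 andbT /s; lra.
have [p hp] := dilation_approx hphi hM s01 e2; exists p; split => [z z1|j].
  rewrite -[X in normc X](subKr (phi (s'%:C *: z))) (le_trans (le_normcB _ _))// lerD//.
    apply: hM; rewrite cnormZ normc_real ger0_norm; last by case/andP: s01.
    by case/andP: s01 => s0 s1; rewrite (le_lt_trans _ s1)// ler_piMr.
  by rewrite (le_trans (hp _ z1))//; lra.
have Zj : cnorm (Z j) <= 1 by apply: ltW; exact: Zball.
rewrite (_ : _ - _ = (phi (s'%:C *: Z j) - phi (Z j)) - (phi (s'%:C *: Z j) - weval p (Z j))); last by ring.
rewrite (le_trans (le_normcB _ _))// [e]splitr lerD ?hp//.
have -> : s'%:C *: Z j = Z j + (s' - 1)%:C *: Z j.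
  by rewrite rmorphB rmorph1 scalerBl scale1r addrC subrK.
apply: (hd' j).2; rewrite normc_real.
have h1 : d0 <= d j by exact: bigmin_le.
have h2 : s <= s' by rewrite le_max lexx.
rewrite ler0_norm; last by case/andP: s01; lra.
by move: h2; rewrite /s; lra.
Qed.

Hypothesis n0 : (0 < n)%N.
Hypothesis Zinj : injective Z.

Lemma PiZW_le W phi (M : R) f : analytic_on_ball phi ->
  (forall z, cnorm z < 1 -> normc (phi z) <= M) -> (forall i, phi (Z i) = W i) ->
  MQ Z f -> ((normc (PiZW Z W f))%:E <= M%:E * L1norm f)%E.
Proof.
move=> hphi hM hW hf; have [lf [c hc]] := MQ_pairing n0 Zball hf.
have [mf nf] := L2_integrableS lf.
have nf0 := L1norm_ge0 f.
have nfE : L1norm f = (fine (L1norm f))%:E by rewrite fineK// ge0_fin_numE.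
set F := fine (L1norm f) in nfE; rewrite nfE -EFinM lee_fin.
have F0 : 0 <= F by rewrite fine_ge0.
have -> : PiZW Z W f = \sum_j (c j)^* * W j.
  rewrite /PiZW (hc _ (ball_alg_QZ n0 Zball (QZ_psiZW Z W))).
  by apply: eq_bigr => j _; rewrite psiZW_interpolates.
pose D := \sum_j normc (c j).
have D0 : 0 <= D by apply: sumr_ge0 => j _; exact: normc_ge0.
apply/ler_addgt0Pr => e e0; pose d := e / (F + D + 1).
have FD : 0 < F + D + 1 by lra.
have d0 : 0 < d by rewrite divr_gt0.
have [p [pM pW]] := bounded_analytic_approx hphi hM d0.
have -> : \sum_j (c j)^* * W j = sphere_integral (fun z => weval p z * f z) -
    \sum_j (c j)^* * (weval p (Z j) - phi (Z j)).
  rewrite (hc _ (ball_alg_ispoly (ispoly_weval p))) -sumrB; apply: eq_bigr => j _.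
  by rewrite hW; ring.
apply: le_trans (le_normcB _ _) _.
apply: (@le_trans _ _ ((M + d) * F + D * d)).
  apply: lerD.
    have lp := bdm_L2 (bdm_weval p).
    have ip := integrableSM lp lf.
    rewrite -lee_fin (le_trans (le_normc_sphere_integral ip))// EFinM -nfE.
    have M0 : 0 <= M by apply: le_trans (hM 0 _); rewrite ?normc_ge0// cnorm0.
    have Md : normc (M + d)%:C = M + d by rewrite normc_real ger0_norm//; lra.
    rewrite -[in leRHS]Md -L1normZ//; apply: le_L1norm.
    - by case: ip.
    - by have [] := integrableSZ (M + d)%:C (conj mf nf).
    - by move=> x xS; rewrite !normcM Md ler_wpM2r ?normc_ge0// pM// xS.
  rewrite (le_trans (normc_sum _ _ _))// mulr_suml; apply: ler_sum => j _.
  by rewrite normcM normc_conj ler_wpM2l ?normc_ge0.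
exact: error_budget.
Qed.

End interpolation_bound.

(** * Hahn-Banach extension of the functional *)

Section hahn_banach.
Context {R : realType} (T : Type).
Local Notation V := (T -> R[i]).
Implicit Types (f g v : V) (a r s : R) (G : set (V * R)).

Definition rlin a f g : V := fun t => a%:C * f t + g t.

Variables (L A : set V) (p l : V -> R).
Hypothesis Llin : forall a f g, L f -> L g -> L (rlin a f g).
Hypothesis pD : forall f g, L f -> L g -> p (rlin 1 f g) <= p f + p g.
Hypothesis pZ : forall a f, L f -> 0 <= a -> p (rlin a f (fun=> 0)) = a * p f.
Hypothesis AL : A `<=` L.
Hypothesis Alin : forall a f g, A f -> A g -> A (rlin a f g).
Hypothesis A0 : A !=set0.
Hypothesis llin : forall a f g, A f -> A g -> l (rlin a f g) = a * l f + l g.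
Hypothesis lp : forall f, A f -> l f <= p f.

(* Partial functionals are represented by their graphs. *)
Let dominated G := (forall f r, G (f, r) -> L f /\ r <= p f) /\
  (forall a f r g s, G (f, r) -> G (g, s) -> G (rlin a f g, a * r + s)).

Let G0 : set (V * R) := [set (f, l f) | f in A].

Let dominated_G0 : dominated G0.
Proof.
split=> [f r [g Ag [<- <-]]|a f r g s [f' Af [<- <-]] [g' Ag [<- <-]]].
  by split; [exact: AL|exact: lp].
by exists (rlin a f' g'); [exact: Alin|rewrite llin].
Qed.

Let rlinN1 f : rlin (-1) f f = fun=> 0.
Proof. by apply/funext => t; rewrite /rlin rmorphN rmorph1 mulN1r addNr. Qed.

Let rlin0 f g : rlin 0 f g = g.
Proof. by apply/funext => t; rewrite /rlin rmorph0 mul0r add0r. Qed.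

Let dominated0 G f r : dominated G -> G (f, r) -> G (fun=> 0, 0).
Proof. by move=> [_ h] fr; have := h (-1) _ _ _ _ fr fr; rewrite rlinN1 mulN1r addNr. Qed.

Let p0 f : L f -> p (fun=> 0) = 0.
Proof. by move=> Lf; have := pZ Lf (lexx 0); rewrite rlin0 mul0r. Qed.

Let dominated_uniq G f r s : dominated G -> G (f, r) -> G (f, s) -> r = s.
Proof.
move=> dG fr fs; have [h1 h2] := dG; have z := dominated0 dG fr.
have pz := p0 (h1 _ _ fr).1.
have d := h2 (-1) _ _ _ _ fr fs; rewrite rlinN1 in d.
have d' := h2 (-1) _ _ _ _ fs fr; rewrite rlinN1 in d'.
have [_] := h1 _ _ d; have [_] := h1 _ _ d'; rewrite pz => ? ?; lra.
Qed.

(** The value c at v must lie between r - p(f - v) and p(v + g) - s for all (f, r) and (g, s) in the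
    graph; [sep] is subadditivity applied to f + g = (f - v) + (v + g). *)
Let dominated_extend G v : dominated G -> G !=set0 -> L v -> (forall r, ~ G (v, r)) ->
  exists G', dominated G' /\ G `<` G'.
Proof.
move=> dG [[f0 r0] fr0] Lv nv; have [GL Glin] := dG.
have z := dominated0 dG fr0.
pose E := [set x | exists f r, G (f, r) /\ x = r - p (rlin (-1) v f)].
have sep f r g s : G (f, r) -> G (g, s) -> r - p (rlin (-1) v f) <= p (rlin 1 v g) - s.
  move=> fr gs; have [_ h] := GL _ _ (Glin 1 _ _ _ _ fr gs).
  have Lf := (GL _ _ fr).1; have Lg := (GL _ _ gs).1.
  have := pD (Llin (-1) Lv Lf) (Llin 1 Lv Lg).
  have -> : rlin 1 (rlin (-1) v f) (rlin 1 v g) = rlin 1 f g.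
    by apply/funext => t; rewrite /rlin rmorphN rmorph1; ring.
  by move=> h'; lra.
have E0 : E !=set0 by exists (r0 - p (rlin (-1) v f0)), f0, r0.
pose c := sup E.
have c1 f r : G (f, r) -> r - p (rlin (-1) v f) <= c.
  move=> fr; apply: ub_le_sup; last by exists f, r.
  by exists (p (rlin 1 v f0) - r0) => _ [g [s [gs ->]]]; exact: sep.
have c2 g s : G (g, s) -> c <= p (rlin 1 v g) - s.
  by move=> gs; apply: ge_sup => // _ [f [r [fr ->]]]; exact: sep.
pose G' := [set x | exists t f r, G (f, r) /\ x = (rlin t v f, t * c + r)].
have GG' : G `<=` G' by move=> [f r] fr; exists 0, f, r; rewrite rlin0 mul0r add0r.
exists G'; split; last first.
  split => // G'G; apply: (nv c); apply: G'G.
  exists 1, (fun=> 0), 0; split => //; rewrite mul1r addr0; congr pair.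
  by apply/funext => t; rewrite /rlin rmorph1 mul1r addr0.
split=> [_ _ [t [f [r [fr [-> ->]]]]]|a _ _ _ _ [t [f [r [fr [-> ->]]]]] [u [g [s [gs [-> ->]]]]]]; last first.
  exists (a * t + u), (rlin a f g), (a * r + s); split; first exact: Glin.
  congr pair; last by ring.
  by apply/funext => x; rewrite /rlin rmorphD rmorphM; ring.
have Lf := (GL _ _ fr).1; split; first exact: Llin.
have scal b : G (rlin b f (fun=> 0), b * r).
  by have := Glin b _ _ _ _ fr z; rewrite addr0.
(* Dividing by |t| reduces to the coefficients 1 and -1 at v, which are the two bounds on c. *)
have [t0|t0|->] := ltrgtP t 0; last first.
- by rewrite rlin0 mul0r add0r; exact: (GL _ _ fr).2.
- have h := c2 _ _ (scal t^-1); have tn : t != 0 by rewrite gt_eqF.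
  have -> : rlin t v f = rlin t (rlin 1 v (rlin t^-1 f (fun=> 0))) (fun=> 0).
    apply/funext => x; rewrite /rlin rmorph1 mul1r !addr0 mulrDr mulrA -rmorphM.
    by rewrite mulfV// rmorph1 mul1r.
  rewrite pZ ?(ltW t0)//; last by apply: Llin => //; exact: (GL _ _ (scal _)).1.
  by have := ler_wpM2l (ltW t0) h; rewrite mulrBr mulVKf//; lra.
- pose u := - t; have u0 : 0 < u by rewrite oppr_gt0.
  have un : u != 0 by rewrite gt_eqF.
  have h := c1 _ _ (scal u^-1).
  have -> : rlin t v f = rlin u (rlin (-1) v (rlin u^-1 f (fun=> 0))) (fun=> 0).
    apply/funext => x; rewrite /rlin !addr0 mulrDr [_ * (u^-1%:C * _)]mulrA -rmorphM mulfV//.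
    by rewrite rmorph1 mul1r mulrA -rmorphM mulrN1 opprK.
  rewrite pZ ?(ltW u0)//; last by apply: Llin => //; exact: (GL _ _ (scal _)).1.
  by have := ler_wpM2l (ltW u0) h; rewrite mulrBr mulVKf// /u; lra.
Qed.

Lemma hahn_banach : exists F : V -> R,
  [/\ forall a f g, L f -> L g -> F (rlin a f g) = a * F f + F g,
      forall f, L f -> F f <= p f & forall f, A f -> F f = l f].
Proof.
(* Zorn's lemma is also applied to the empty chain, whose union is empty; hence only nonempty graphs
   are asked to extend l. *)
pose P G := dominated G /\ (G !=set0 -> G0 `<=` G).
have [G [[dG GG0] Gmax]] : exists G, P G /\ forall G', G `<` G' -> ~ P G'.
  apply: Zorn_bigcup => F FP tot; split; first split.
  - by move=> f r [G FG fr]; have [[h _] _] := FP _ FG; exact: h.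
  - move=> a f r g s [G FG fr] [G' FG' gs].
    have [GG'|GG'] := tot _ _ FG FG'.
      exists G' => //; have [[_ h] _] := FP _ FG'; apply: h => //; exact: GG'.
    exists G => //; have [[_ h] _] := FP _ FG; apply: h => //; exact: GG'.
  - move=> [x [G FG Gx]] y G0y; exists G => //; have [_ h] := FP _ FG; apply: h => //; by exists x.
have Gn0 : G !=set0.
  have [f Af] := A0; apply: contrapT => G_0.
  apply: (Gmax G0); last by split; [exact: dominated_G0|move=> _ x].
  split; first by move=> x Gx; exfalso; apply: G_0; exists x.
  by move=> h; apply: G_0; exists (f, l f); apply: h; exists f.
have tot f : exists r, L f -> G (f, r).
  apply: contrapT => h; have Lf : L f by apply: contrapT => nL; apply: h; exists 0.
  have [|G' [dG' GG']] := dominated_extend dG Gn0 Lf.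
    by move=> r fr; apply: h; exists r.
  apply: (Gmax G') => //; split => // _; apply: subset_trans (GG0 Gn0) _.
  by case: GG'.
have [F hF] := choice tot; have [GL Glin] := dG; exists F; split.
- move=> a f g Lf Lg; apply: (dominated_uniq dG (hF _ (Llin a Lf Lg))).
  by apply: Glin; exact: hF.
- by move=> f Lf; exact: (GL _ _ (hF _ Lf)).2.
- move=> f Af; apply: (dominated_uniq dG (hF _ (AL Af))).
  by apply: GG0 => //; exists f.
Qed.

End hahn_banach.

Section linearity.
Context {R : realType} (n : nat).
Local Notation Cn := 'rV[R[i]]_n.
Local Notation S := (unit_sphere R n).
Implicit Types (f g h : Cn -> R[i]) (a : R[i]).

Lemma realcM (x y : R) : (x * y)%:C = x%:C * y%:C.
Proof. exact: rmorphM. Qed.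

Lemma sphere_integral_lin a f g : integrableS f -> integrableS g ->
  sphere_integral (fun z => a * f z + g z) = a * sphere_integral f + sphere_integral g.
Proof.
by move=> hf hg; rewrite (sphere_integralD (integrableSZ a hf) hg) sphere_integralZ.
Qed.

Lemma L2_lin a f g : L2 f -> L2 g -> L2 (fun z => a * f z + g z).
Proof. by move=> hf hg; apply: L2D => //; exact: L2Z. Qed.

Lemma L2ip_lin a f g h : L2 f -> L2 g -> L2 h ->
  L2ip (fun z => a * f z + g z) h = a * L2ip f h + L2ip g h.
Proof.
move=> hf hg hh; have hc := L2_conj hh.
rewrite /L2ip -(sphere_integral_lin _ (integrableSM hf hc) (integrableSM hg hc)).
by apply: eq_sphere_integral => z _; rewrite mulrDl mulrA.
Qed.

Lemma L2ip_conj f g : L2 f -> L2 g -> L2ip f g = (L2ip g f)^*.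
Proof.
move=> hf hg; rewrite /L2ip -(sphere_integral_conj (integrableSM hg (L2_conj hf))).
by apply: eq_sphere_integral => z _; rewrite rmorphM /= conjCK mulrC.
Qed.

Lemma L2normZ a f : L2 f -> L2norm (fun z => a * f z) = normc a * L2norm f.
Proof.
move=> hf; have haf := L2Z a hf.
apply/eqP; rewrite -(@eqrXn2 _ 2)// ?mulr_ge0 ?L2norm_ge0 ?normc_ge0//; apply/eqP.
apply: (@complexI R); rewrite -(L2ip_self haf) exprMn realcM -(L2ip_self hf) -mulc_conj /L2ip.
rewrite -sphere_integralZ; last by apply: integrableSM => //; exact: L2_conj.
by apply: eq_sphere_integral => z _; rewrite rmorphM /=; ring.
Qed.

Lemma H2_of_approx f : L2 f ->
  (forall e : R, 0 < e -> exists p, L2norm (fun z => f z - weval p z) < e) -> H2 f.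
Proof.
move=> lf hf; split => // e e0; have [p hp] := hf e e0.
have [N [c hc]] := weval_box_sum p; exists N, c.
by rewrite (eq_L2norm (g := fun z => f z - weval p z))// => z _; rewrite hc.
Qed.

Lemma H2_lin a f g : H2 f -> H2 g -> H2 (fun z => a * f z + g z).
Proof.
move=> hf hg; have [lf lg] := (H2_L2 hf, H2_L2 hg).
apply: H2_of_approx => [|e e0]; first exact: L2_lin.
have e2 : 0 < e / 2 by lra.
have a1 : 0 < normc a + 1 by rewrite ltr_wpDl ?normc_ge0.
have [p hp] := H2_approx hf (divr_gt0 e2 a1).
have [q hq] := H2_approx hg e2.
have [r hr] := ispolyD (ispolyM (ispoly_cst n a) (ispoly_weval p)) (ispoly_weval q).
exists r; have lp := bdm_L2 (bdm_weval p); have lq := bdm_L2 (bdm_weval q).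
rewrite (eq_L2norm (g := fun z => a * (f z - weval p z) + (g z - weval q z))); last first.
  by move=> z _; rewrite -hr; ring.
have lfp := L2B lf lp; apply: le_lt_trans (L2normD (L2Z a lfp) (L2B lg lq)) _.
rewrite L2normZ// [ltRHS]splitr; apply: ler_ltD => //.
apply: (@le_trans _ _ ((normc a + 1) * (e / 2 / (normc a + 1)))); last first.
  by rewrite mulrCA divff ?mulr1// gt_eqF.
by rewrite ler_pM ?normc_ge0 ?L2norm_ge0 ?(ltW hp)// lerDl.
Qed.

Lemma H20_lin a f g : H20 f -> H20 g -> H20 (fun z => a * f z + g z).
Proof.
move=> [hf f1] [hg g1]; split; first exact: H2_lin.
move=> _ ->; rewrite L2ip_lin ?f1 ?g1 ?mulr0 ?addr0//; first exact: H2_L2.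
  exact: H2_L2.
exact: L2_cst.
Qed.

Lemma MS_lin a f g : MS f -> MS g -> MS (fun z => a * f z + g z).
Proof.
move=> [hf f1] [hg g1]; split; first exact: L2_lin.
move=> h hh; have lh : L2 h.
  case: hh => u hu [_ [v hv <-] <-]; apply: L2D; first exact: H2_L2.
  exact/L2_conj/H2_L2.
by rewrite L2ip_lin ?f1 ?g1 ?mulr0 ?addr0.
Qed.

Lemma H20_0 : H20 ((fun=> 0) : Cn -> R[i]).
Proof.
split; first exact: H2_0.
move=> _ ->; rewrite /L2ip -[RHS](@sphere_integral0 R n).
by apply: eq_sphere_integral => z _; rewrite mul0r.
Qed.

Lemma L2ip0l h : L2ip (fun=> 0) h = 0.
Proof.
rewrite /L2ip -[RHS](@sphere_integral0 R n).
by apply: eq_sphere_integral => z _; rewrite mul0r.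
Qed.

Lemma MS_0 : MS ((fun=> 0) : Cn -> R[i]).
Proof. by split; [exact: L2_cst|move=> h _; exact: L2ip0l]. Qed.

Variables (m : nat) (Z : 'I_m -> Cn) (W : 'I_m -> R[i]).
Hypothesis n0 : (0 < n)%N.
Hypothesis Zball : forall i, unit_ball R n (Z i).

Lemma conj_QZ_lin a f g : conj_set (QZ Z) f -> conj_set (QZ Z) g ->
  conj_set (QZ Z) (fun z => a * f z + g z).
Proof.
move=> [_ [c ->] <-] [_ [d ->] <-].
exists (fun z => \sum_j (a^* * c j + d j) * szego z (Z j)).
  by exists (fun j => a^* * c j + d j).
apply/funext => z; rewrite !rmorph_sum /= mulr_sumr -big_split /=; apply: eq_bigr => j _.
by rewrite !rmorphM rmorphD rmorphM /= conjCK; ring.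
Qed.

Lemma add_set_lin (A B : set (Cn -> R[i])) a f g :
  (forall f g, A f -> A g -> A (fun z => a * f z + g z)) ->
  (forall f g, B f -> B g -> B (fun z => a * f z + g z)) ->
  add_set A B f -> add_set A B g -> add_set A B (fun z => a * f z + g z).
Proof.
move=> hA hB [f1 Af1 [f2 Bf2 <-]] [g1 Ag1 [g2 Bg2 <-]].
exists (fun z => a * f1 z + g1 z); first exact: hA.
exists (fun z => a * f2 z + g2 z); first exact: hB.
by apply/funext => z; ring.
Qed.

Lemma MS_H20_lin a f g : add_set (@MS R n) (@H20 R n) f -> add_set (@MS R n) (@H20 R n) g ->
  add_set (@MS R n) (@H20 R n) (fun z => a * f z + g z).
Proof. by apply: add_set_lin => ? ? ? ?; [exact: MS_lin|exact: H20_lin]. Qed.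

Lemma MQ_lin a f g : MQ Z f -> MQ Z g -> MQ Z (fun z => a * f z + g z).
Proof. by apply: add_set_lin => ? ? ? ?; [exact: conj_QZ_lin|exact: MS_H20_lin]. Qed.

Lemma MQ_L2 f : MQ Z f -> L2 f. Proof. by move=> /(MQ_pairing n0 Zball)[]. Qed.

Lemma L2_psiZW : L2 (psiZW Z W).
Proof. exact/H2_L2/H2_ball_alg/(ball_alg_QZ n0 Zball)/QZ_psiZW. Qed.

Lemma PiZW_lin a f g : L2 f -> L2 g ->
  PiZW Z W (fun z => a * f z + g z) = a * PiZW Z W f + PiZW Z W g.
Proof.
move=> lf lg; have lp := L2_psiZW.
rewrite /PiZW -(sphere_integral_lin _ (integrableSM lp lf) (integrableSM lp lg)).
by apply: eq_sphere_integral => z _; ring.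
Qed.

Lemma add_set0l (A B : set (Cn -> R[i])) f : A (fun=> 0) -> B f -> add_set A B f.
Proof.
by move=> A0 Bf; exists (fun=> 0) => //; exists f => //; apply/funext => z; rewrite add0r.
Qed.

Lemma add_set0r (A B : set (Cn -> R[i])) f : B (fun=> 0) -> A f -> add_set A B f.
Proof.
by move=> B0 Af; exists f => //; exists (fun=> 0) => //; apply/funext => z; rewrite addr0.
Qed.

Lemma conj_QZ_0 : conj_set (QZ Z) (fun=> 0).
Proof.
exists (fun z => \sum_j 0 * szego z (Z j)); first by exists (fun=> 0).
by apply/funext => z; rewrite big1 ?conjC0// => j _; rewrite mul0r.
Qed.

Lemma MQ_conj_QZ f : conj_set (QZ Z) f -> MQ Z f.
Proof. by apply: add_set0r; apply: add_set0l; [exact: MS_0|exact: H20_0]. Qed.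

Lemma MQ_MS_H20 f : add_set (@MS R n) (@H20 R n) f -> MQ Z f.
Proof. by apply: add_set0l; exact: conj_QZ_0. Qed.

Lemma PiZW_MS_H20 f : add_set (@MS R n) (@H20 R n) f -> PiZW Z W f = 0.
Proof.
move=> [u uM [h hH <-]].
have lp := L2_psiZW; have [lu lh] := (MS_L2 uM, H2_L2 (proj1 hH)).
have pH : H2 (psiZW Z W) by apply/H2_ball_alg/(ball_alg_QZ n0 Zball)/QZ_psiZW.
rewrite /PiZW (eq_sphere_integral (g := fun z => psiZW Z W z * u z + psiZW Z W z * h z)); last first.
  by move=> z _; rewrite mulrDr.
rewrite (sphere_integralD (integrableSM lp lu) (integrableSM lp lh)).
by rewrite (MS_H2_integral uM pH) (H20_H2_integral n0 hH pH) addr0.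
Qed.

Lemma L1norm_fin f : L2 f -> L1norm f = (fine (L1norm f))%:E.
Proof.
by move=> /L2_integrableS[_ h]; rewrite fineK// ge0_fin_numE// L1norm_ge0.
Qed.

Lemma L1norm_lin_le a f g : L2 f -> L2 g ->
  fine (L1norm (fun z => a * f z + g z)) <= normc a * fine (L1norm f) + fine (L1norm g).
Proof.
move=> lf lg; have [if_ ig] := (L2_integrableS lf, L2_integrableS lg).
rewrite -lee_fin -(L1norm_fin (L2_lin a lf lg)) EFinD EFinM -(L1norm_fin lf) -(L1norm_fin lg).
by rewrite -L1normZ ?(L1normD (integrableSZ a if_) ig)//; case: if_.
Qed.

(** Real Hahn-Banach is applied to the real part of Pi on L^2, where the L^1 norm is finite. Then F
    f = G f - i G(i f) is complex linear, and obeys the same bound because f can be rotated until F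
    f is real and nonnegative. *)
Lemma PiZW_extension (N : R) : 0 <= N ->
  (forall f, MQ Z f -> normc (PiZW Z W f) <= N * fine (L1norm f)) ->
  exists F : (Cn -> R[i]) -> R[i],
  [/\ forall a f g, L2 f -> L2 g -> F (fun z => a * f z + g z) = a * F f + F g,
      forall f, L2 f -> normc (F f) <= N * fine (L1norm f) &
      forall f, MQ Z f -> F f = PiZW Z W f].
Proof.
move=> N0 hN; pose p f := N * fine (L1norm f).
have nf0 f : 0 <= fine (L1norm f) by rewrite fine_ge0// L1norm_ge0.
have [G [Glin Gp GPi]] : exists G : (Cn -> R[i]) -> R,
  [/\ forall (a : R) f g, L2 f -> L2 g -> G (rlin a f g) = a * G f + G g,
      forall f, L2 f -> G f <= p f & forall f, MQ Z f -> G f = complex.Re (PiZW Z W f)].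
  apply: hahn_banach.
  - by move=> a f g; exact: L2_lin.
  - move=> f g lf lg; rewrite /p -mulrDr ler_wpM2l//.
    by have := L1norm_lin_le 1 lf lg; rewrite normc1 mul1r.
  - move=> a f lf a0; rewrite /p mulrCA; congr (_ * _).
    rewrite (eq_L1norm (g := fun z => a%:C * f z)); last by move=> z _; rewrite /rlin addr0.
    have [mf _] := L2_integrableS lf.
    by rewrite L1normZ// normc_real ger0_norm// (L1norm_fin lf).
  - exact: MQ_L2.
  - by move=> a f g; exact: MQ_lin.
  - by exists (fun=> 0); apply/MQ_conj_QZ/conj_QZ_0.
  - move=> a f g hf hg; rewrite PiZW_lin ?Re_add; try exact: MQ_L2.
    by rewrite Re_mul /= mul0r subr0.
  - by move=> f hf; apply: le_trans (hN _ hf); rewrite (le_trans (ler_norm _))// Re_le_normc.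
pose F f := G f +i* - G (fun z => 'i%C * f z).
have l0 : L2 ((fun=> 0) : Cn -> R[i]) by exact: L2_cst.
have GD f g : L2 f -> L2 g -> G (fun z => f z + g z) = G f + G g.
  move=> lf lg; rewrite -[G f]mul1r -Glin//; congr G; apply/funext => z.
  by rewrite /rlin rmorph1 mul1r.
have G_0 : G (fun=> 0) = 0.
  have := GD _ _ l0 l0; rewrite (_ : (fun z => 0 + 0) = fun=> 0); first by lra.
  by apply/funext => z; rewrite addr0.
have GZ (x : R) f : L2 f -> G (fun z => x%:C * f z) = x * G f.
  move=> lf; have := Glin x f _ lf l0; rewrite G_0 addr0 => <-.
  by congr G; apply/funext => z; rewrite /rlin addr0.
have Flin a f g : L2 f -> L2 g -> F (fun z => a * f z + g z) = a * F f + F g.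
  have aux h : L2 h -> G (fun z => a * h z) = complex.Re a * G h + complex.Im a * G (fun z => 'i%C * h z).
    move=> lh; rewrite -GZ// -GZ; last exact: L2Z.
    rewrite -GD; try by apply: L2Z => //; exact: L2Z.
    congr G; apply/funext => z; rewrite {1}[a]complexE; ring.
  move=> lf lg; have laf := L2Z a lf; have lif := L2Z 'i%C lf.
  rewrite /F GD// (_ : (fun z => 'i%C * (a * f z + g z)) = fun z => a * ('i%C * f z) + 'i%C * g z); last first.
    by apply/funext => z; ring.
  rewrite GD; try by apply: L2Z.
  rewrite !aux// (_ : (fun z => 'i%C * ('i%C * f z)) = fun z => (-1)%:C * f z); last first.
    by apply/funext => z; rewrite mulrA -expr2 sqr_i rmorphN1.
  rewrite GZ// [a in RHS]complexEta.
  by apply/eqP; rewrite eq_complex /=; apply/andP; split; apply/eqP; ring.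
exists F; split => // [f lf|f hf].
  have [F0|Fn0] := eqVneq (F f) 0; first by rewrite F0 normc0 mulr_ge0.
  pose t := (normc (F f))^-1%:C * (F f)^*.
  have nF : normc (F f) != 0 by rewrite normc_eq0.
  have nt : normc t = 1.
    by rewrite normcM normc_real normc_conj ger0_norm ?invr_ge0 ?normc_ge0// mulVf.
  have tF : t * F f = (normc (F f))%:C.
    by rewrite /t -mulrA [_^* * _]mulrC mulc_conj -rmorphM expr2 mulrA mulVf// mul1r.
  have : F (fun z => t * f z) = t * F f.
    have := Flin t f _ lf l0; rewrite (_ : F (fun=> 0) = 0) ?addr0 => [<-|].
      by congr F; apply/funext => z; rewrite addr0.
    rewrite /F G_0 (_ : (fun z => 'i%C * 0) = fun=> 0) ?G_0 ?oppr0//.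
    by apply/funext => z; rewrite mulr0.
  rewrite tF => /(congr1 (@complex.Re R)) /= <-.
  apply: le_trans (Gp _ (L2Z t lf)) _; rewrite /p.
  by have [mf _] := L2_integrableS lf; rewrite L1normZ// nt mul1e.
rewrite /F !GPi//; last first.
  have := MQ_lin 'i%C hf (MQ_conj_QZ conj_QZ_0).
  by congr (MQ Z _); apply/funext => z; rewrite addr0.
have lf := MQ_L2 hf.
have -> : PiZW Z W (fun z => 'i%C * f z) = 'i%C * PiZW Z W f.
  rewrite /PiZW -sphere_integralZ; last by apply: integrableSM => //; exact: L2_psiZW.
  by apply: eq_sphere_integral => z _; rewrite mulrCA.
by rewrite [RHS]complexEta; congr Complex; rewrite (Re_mul 'i%C) /= mul0r mul1r sub0r opprK.
Qed.

End linearity.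

(** * The extension evaluated at the Szego kernels *)

Section projections.
Context {R : realType} (n : nat).
Local Notation Cn := 'rV[R[i]]_n.
Local Notation S := (unit_sphere R n).
Implicit Types (F G f g : Cn -> R[i]) (p q : seq (R[i] * seq 'I_n)) (s t : seq 'I_n) (a c : R[i]) (z w : Cn).

Hypothesis n0 : (0 < n)%N.

(* [F] has a polynomial as its orthogonal projection on the Hardy space. *)
Definition has_proj F := exists p, forall q, L2ip F (weval q) = L2ip (weval p) (weval q).

Let lmono s : L2 (@mono R n s). Proof. exact/bdm_L2/bdm_mono. Qed.
Let lweval p : L2 (@weval R n p). Proof. exact/bdm_L2/bdm_weval. Qed.
Hint Resolve lmono lweval : core.

Lemma L2ip_weval F q : L2 F -> L2ip F (weval q) = \sum_(t <- q) t.1^* * L2ip F (mono t.2).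
Proof.
move=> lF; rewrite (L2ip_conj lF (lweval q)).
elim: q => [|t q ih]; first by rewrite big_nil (_ : weval [::] = fun=> 0) ?L2ip0l ?conjC0//; apply/funext => z; rewrite /weval big_nil.
rewrite big_cons -ih (L2ip_conj lF (lmono _)) -rmorphM -rmorphD; congr (_^*).
rewrite -L2ip_lin//; congr (L2ip _ F); apply/funext => z; exact: weval_cons.
Qed.

Lemma has_proj_mono F p : L2 F -> (forall t, L2ip F (mono t) = L2ip (weval p) (mono t)) ->
  has_proj F.
Proof.
by move=> lF h; exists p => q; rewrite !L2ip_weval//; apply: eq_bigr => t _; rewrite h.
Qed.

Lemma has_proj_lin a F G : L2 F -> L2 G -> has_proj F -> has_proj G ->
  has_proj (fun z => a * F z + G z).
Proof.
move=> lF lG [p hp] [q hq].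
have [r hr] := ispolyD (ispolyM (ispoly_cst n a) (ispoly_weval p)) (ispoly_weval q).
exists r => g; rewrite L2ip_lin// hp hq -L2ip_lin//; congr (L2ip _ _).
by apply/funext => z; rewrite hr.
Qed.

Lemma has_proj_ispoly F : ispoly F -> has_proj F.
Proof. by move=> [p hp]; exists p => q; congr (L2ip _ _); apply/funext => z. Qed.

Let mono_orthogonal s t : size s != size t -> L2ip (@mono R n s) (mono t) = 0.
Proof. exact: hol_degree_orthogonal (hol_mono s) (euler_mono s) (hol_mono t) (euler_mono t). Qed.

Lemma L2_bdmM (b : Cn -> R[i]) F : bdm b -> L2 F -> L2 (fun z => b z * F z).
Proof.
move=> [mb [C hC]] lF; have mF := L2_measurable lF.
have mS : measurable S by exact: measurable_unit_sphere.
have mbS : measurable_fun S b by apply: measurable_funS mb.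
have mbF : measurable_fun S (fun z => b z * F z) by exact: measurable_funcM.
split => //; apply: le_lt_trans (L2Z C%:C lF).2.
apply: ge0_le_integral => //.
- by move=> x _; rewrite lee_fin sqr_ge0.
- by apply/measurable_EFinP; apply: measurable_funX; exact: measurable_fun_normc.
- apply/measurable_EFinP; apply: measurable_funX; apply: measurable_fun_normc => //.
  by apply: L2_measurable; exact: L2Z.
- move=> x xS; rewrite lee_fin lerXn2r ?nnegrE ?normc_ge0// !normcM ler_wpM2r ?normc_ge0//.
  by rewrite normc_real (le_trans (hC x xS))// ler_norm.
Qed.

Let L2_conj_coordM i F : L2 F -> L2 (fun z => (z 0 i)^* * F z).
Proof. by apply: L2_bdmM; apply: bdm_conj; exact: bdm_coord. Qed.

Let L2ip_conj_coordM i F q : L2ip (fun z => (z 0 i)^* * F z) (weval q) =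
  L2ip F (fun z => z 0 i * weval q z).
Proof.
by rewrite /L2ip; apply: eq_sphere_integral => z _; rewrite rmorphM /=; ring.
Qed.

(** By [hol_adjoint] the projection is the i-th derivative of the monomial divided by n + |s| - 1;
    against monomials of any degree other than |s| - 1 both sides vanish. For the empty word the
    derivative is 0, and the truncated predecessor keeps the divisor nonzero. *)
Lemma has_proj_conj_coord_mono i s : has_proj (fun z => (z 0 i)^* * mono s z).
Proof.
have lcm : L2 (fun z => (z 0 i)^* * mono s z) by exact: L2_conj_coordM.
have pairE t : L2ip (fun z => (z 0 i)^* * mono s z) (mono t) = (L2ip (mono (i :: t)) (mono s))^*.
  rewrite -L2ip_conj// /L2ip; apply: eq_sphere_integral => z _.
  by rewrite mono_cons rmorphM /=; ring.
pose k := (n + (size s).-1)%:R : R[i].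
have k0 : k != 0 by rewrite pnatr_eq0 addn_eq0 negb_and -lt0n n0.
have [p hp] := ispolyM (ispoly_cst n k^-1) (ispoly_weval (dw i s)).
have pE t : L2ip (weval p) (mono t) = k^-1 * L2ip (weval (dw i s)) (mono t).
  rewrite (_ : weval p = fun z => k^-1 * weval (dw i s) z + 0); last first.
    by apply/funext => z; rewrite -hp addr0.
  by rewrite L2ip_lin ?L2ip0l ?addr0//; exact: L2_cst.
apply: (has_proj_mono (p := p)) => // t; rewrite pairE pE.
have [st|st] := eqVneq (size s) (size t).+1.
  have hE := hol_adjoint i (@hol_mono R n t) (euler_mono t) (hol_mono s).
  have ts : size t = (size s).-1 by rewrite st.
  have h := congr1 (fun x : R[i] => x^*) hE; rewrite /= ts rmorphM /= conjC_nat -/k in h.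
  have -> : L2ip (mono (i :: t)) (mono s) = sphere_integral (fun z => z 0 i * mono t z * (mono s z)^*).
    by apply: eq_sphere_integral => z _; rewrite mono_cons.
  apply: (mulfI k0); rewrite h mulrA mulfV// mul1r.
  by rewrite (L2ip_conj (lweval _) (lmono _)).
rewrite mono_orthogonal ?conjC0; last by rewrite /= eq_sym.
rewrite (L2ip_conj (lweval _) (lmono _)) L2ip_weval// big_seq big1 ?conjC0 ?mulr0// => u us.
by rewrite mono_orthogonal ?mulr0//; move: st; rewrite (size_dw us) eqSS eq_sym.
Qed.

Lemma has_proj_sum (I : Type) (r : seq I) (H : I -> Cn -> R[i]) : (forall i, L2 (H i)) ->
  (forall i, has_proj (H i)) -> has_proj (fun z => \sum_(i <- r) H i z).
Proof.
move=> lH hH; elim: r => [|i r ih].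
  by apply: has_proj_ispoly; exists [::] => z; rewrite /weval !big_nil.
have -> : (fun z => \sum_(j <- i :: r) H j z) = fun z => 1 * H i z + \sum_(j <- r) H j z.
  by apply/funext => z; rewrite big_cons mul1r.
by apply: has_proj_lin => //; exact: L2_sum.
Qed.

Lemma has_projZ a F : L2 F -> has_proj F -> has_proj (fun z => a * F z).
Proof.
move=> lF hF; have -> : (fun z => a * F z) = fun z => a * F z + 0 by apply/funext => z; rewrite addr0.
by apply: has_proj_lin => //; [exact: L2_cst|exact/has_proj_ispoly/ispoly_cst].
Qed.

(** Moving the conjugate coordinate to the other side turns q into z_i q, again a polynomial, so F
    may be replaced by its projection; monomials times a conjugate coordinate remain. *)
Lemma has_proj_conj_coord i F : L2 F -> has_proj F -> has_proj (fun z => (z 0 i)^* * F z).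
Proof.
move=> lF [p hp].
have [r hr] : has_proj (fun z => \sum_(t <- p) t.1 * ((z 0 i)^* * mono t.2 z)).
  apply: has_proj_sum => t; first by apply: L2Z; exact: L2_conj_coordM.
  by apply: has_projZ; [exact: L2_conj_coordM|exact: has_proj_conj_coord_mono].
exists r => q; rewrite -hr L2ip_conj_coordM.
have [q' hq'] := ispolyM (ispoly_coord i) (ispoly_weval q).
have -> : (fun z : Cn => z 0 i * weval q z) = weval q' by apply/funext => z; rewrite hq'.
rewrite hp (_ : weval q' = fun z => z 0 i * weval q z); last by apply/funext => z; rewrite hq'.
rewrite -L2ip_conj_coordM; congr (L2ip _ _); apply/funext => z.
by rewrite /weval mulr_sumr; apply: eq_bigr => t _; ring.
Qed.

Lemma has_proj_trig p q : has_proj (fun z => (weval p z)^* * weval q z).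
Proof.
have lm s : L2 (fun z => (mono s z)^* * weval q z).
  by apply/bdm_L2/bdmM; [exact/bdm_conj/bdm_mono|exact: bdm_weval].
have hm s : has_proj (fun z => (mono s z)^* * weval q z).
  elim: s => [|i s ih].
    by apply: has_proj_ispoly; exists q => z; rewrite mono_nil conjC1 mul1r.
  have -> : (fun z => (mono (i :: s) z)^* * weval q z) =
      fun z => (z 0 i)^* * ((mono s z)^* * weval q z).
    by apply/funext => z; rewrite mono_cons rmorphM mulrA.
  exact: has_proj_conj_coord.
have -> : (fun z => (weval p z)^* * weval q z) =
    fun z => \sum_(t <- p) t.1^* * ((mono t.2 z)^* * weval q z).
  apply/funext => z; rewrite /weval rmorph_sum mulr_suml; apply: eq_bigr => t _.
  by rewrite rmorphM mulrA.
by apply: has_proj_sum => t; [exact: L2Z|exact: has_projZ].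
Qed.

(** F and its projection p pair equally with u. Integration is multiplicative on polynomials, so the
    conjugate of q pairs with u as its mean c does. *)
Let proj_orthogonal F p q u : L2 F -> (forall u, L2ip F (weval u) = L2ip (weval p) (weval u)) ->
  sphere_integral (weval q) = (sphere_integral F)^* ->
  L2ip (fun z => F z - weval p z - ((weval q z)^* - sphere_integral F)) (weval u) = 0.
Proof.
move=> lF hp hq; set c := sphere_integral F in hq *.
have lc : L2 ((fun=> c) : Cn -> R[i]) by exact: L2_cst.
have l1 : L2 ((fun=> 1) : Cn -> R[i]) by exact: L2_cst.
have lq := L2_conj (lweval q).
have lFp := L2B lF (lweval p).
have -> : (fun z => F z - weval p z - ((weval q z)^* - c)) =
    fun z => (- 1) * (weval q z)^* + ((- 1) * weval p z + (c * 1 + F z)).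
  by apply/funext => z; ring.
rewrite !L2ip_lin//; try by do ?apply: L2_lin.
rewrite hp mulN1r mulN1r.
have -> : L2ip (fun=> 1) (weval u) = (sphere_integral (weval u))^*.
  rewrite -sphere_integral_conj; last exact: L2_integrableS.
  by apply: eq_sphere_integral => z _; rewrite mul1r.
have -> : L2ip (fun z => (weval q z)^*) (weval u) = c * (sphere_integral (weval u))^*.
  rewrite -[c]conjCK -hq -rmorphM -sphere_integral_wevalM// -[RHS]/((sphere_integral _)^*).
  rewrite -sphere_integral_conj; last exact: integrableSM.
  by apply: eq_sphere_integral => z _; rewrite rmorphM.
by ring.
Qed.

Lemma H2_orthogonal F : L2 F -> (forall p, L2ip F (weval p) = 0) -> forall g, H2 g -> L2ip F g = 0.
Proof.
move=> lF hF g hg; have lg := H2_L2 hg.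
apply/eqP; rewrite -normc_eq0 eq_le normc_ge0 andbT.
apply/ler_addgt0Pr => e e0; rewrite add0r.
have F0 := L2norm_ge0 F; have F1 : 0 < L2norm F + 1 by lra.
have [p hp] := H2_approx hg (divr_gt0 e0 F1).
have -> : L2ip F g = L2ip F (fun z => g z - weval p z).
  rewrite (L2ip_conj lF lg) (L2ip_conj lF (L2B lg (lweval p))); congr (_^*).
  rewrite (_ : (fun z => g z - weval p z) = fun z => (-1) * weval p z + g z); last first.
    by apply/funext => z; ring.
  by rewrite L2ip_lin// (L2ip_conj (lweval p) lF) hF conjC0 mulr0 add0r.
apply: le_trans (L2ip_bound lF (L2B lg (lweval p))) _.
apply: (@le_trans _ _ ((L2norm F + 1) * (e / (L2norm F + 1)))); last first.
  by rewrite mulrCA divff ?mulr1// gt_eqF.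
by rewrite ler_pM ?L2norm_ge0 ?(ltW hp)// lerDl.
Qed.

(* The conjugate of [weval q] is the projection of [F] on the conjugate Hardy space. *)
Lemma trig_split F : L2 F -> has_proj F -> has_proj (fun z => (F z)^*) ->
  exists q, add_set (@MS R n) (@H20 R n) (fun z => F z - (weval q z)^*) /\
    forall u, L2ip (fun z => (F z)^*) (weval u) = L2ip (weval q) (weval u).
Proof.
move=> lF [p hp] [q hq]; exists q; split => //; have lcF := L2_conj lF.
have [u hu] := ispoly_cst n (1 : R[i]).
have onE : (fun=> 1) = weval u by apply/funext => z; rewrite -hu.
have SI1 f : L2ip f (fun=> 1) = sphere_integral f.
  by apply: eq_sphere_integral => z _; rewrite conjC1 mulr1.
pose c := sphere_integral F.
have pc : sphere_integral (weval p) = c by rewrite -SI1 onE -hp -onE SI1.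
have qc : sphere_integral (weval q) = c^*.
  by rewrite -SI1 onE -hq -onE SI1 sphere_integral_conj//; exact: L2_integrableS.
have l1 : L2 ((fun=> 1) : Cn -> R[i]) by exact: L2_cst.
(* Both projections are removed and their common constant c restored: this is the part in M. Then p
   - c, of mean zero, is the part in H^2_0. *)
exists (fun z => F z - weval p z - ((weval q z)^* - c)).
  have lq := L2_conj (lweval q).
  have lmu : L2 (fun z => F z - weval p z - ((weval q z)^* - c)).
    by apply: L2B; [exact: L2B|apply: L2B => //; exact: L2_cst].
  split => // _ [g hg [_ [h hh <-] <-]].
  have lg := H2_L2 hg; have lh := H2_L2 hh.
  rewrite (L2ip_conj lmu (L2D lg (L2_conj hh.1))).
  have -> : (fun z => g z + (h z)^*) = fun z => 1 * g z + (h z)^* by apply/funext => z; rewrite mul1r.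
  rewrite L2ip_lin//; last exact: L2_conj.
  rewrite (L2ip_conj lg lmu) (H2_orthogonal lmu _ hg) ?conjC0 ?mulr0 ?add0r; last first.
    by move=> r; apply: proj_orthogonal.
  have -> : L2ip (fun z => (h z)^*) (fun z => F z - weval p z - ((weval q z)^* - c)) =
      L2ip (fun z => (F z - weval p z - ((weval q z)^* - c))^*) h.
    by apply: eq_sphere_integral => z _; rewrite mulrC.
  rewrite (H2_orthogonal (L2_conj lmu) _ hh) ?conjC0// => r.
  have -> : (fun z => (F z - weval p z - ((weval q z)^* - c))^*) =
    fun z => (F z)^* - weval q z - ((weval p z)^* - sphere_integral (fun z => (F z)^*)).
    apply/funext => z; rewrite sphere_integral_conj; last exact: L2_integrableS.
    by rewrite !rmorphB /= conjCK -/c; ring.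
  apply: proj_orthogonal => //.
  by rewrite sphere_integral_conj ?conjCK//; exact: L2_integrableS.
exists (fun z => weval p z - c).
  split.
    apply/H2_ball_alg/ball_alg_ispoly; apply: ispolyD; first exact: ispoly_weval.
    exact: ispoly_cst.
  move=> _ ->; rewrite SI1 sphere_integralB; last 2 first.
    - exact: L2_integrableS.
    - exact/L2_integrableS/L2_cst.
  rewrite pc (_ : sphere_integral (fun=> c) = c) ?subrr//.
  have := sphere_integralZ c (L2_integrableS l1); by rewrite sphere_integral1// mulr1.
by apply/funext => z; ring.
Qed.

(** Since f annihilates q, the squared norm of q is the pairing of q with the conjugate of F - f,
    hence at most e times its norm. *)
Lemma proj_conj_small F f q (e : R) : bdm F -> bdm f -> 0 <= e ->
  (forall z, S z -> normc (F z - f z) <= e) ->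
  (forall p, sphere_integral (fun z => weval p z * f z) = 0) ->
  (forall u, L2ip (fun z => (F z)^*) (weval u) = L2ip (weval q) (weval u)) ->
  L2norm (weval q) <= e.
Proof.
move=> bF bf e0 Ff f0 hq; have [lF lf] := (bdm_L2 bF, bdm_L2 bf).
have q0 := L2norm_ge0 (weval q).
have h : L2norm (weval q) ^+ 2 <= e * L2norm (weval q).
  have -> : L2norm (weval q) ^+ 2 = normc (L2ip (weval q) (weval q)).
    by rewrite L2ip_self// normc_real ger0_norm// sqr_ge0.
  rewrite -hq.
  have -> : L2ip (fun z => (F z)^*) (weval q) =
      (sphere_integral (fun z => (F z - f z) * weval q z))^*.
    rewrite -[X in X^*]addr0 -[in X in _ + X](f0 q) -sphere_integralD; last 2 first.
      - by apply: integrableSM => //; exact: L2B.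
      - exact: integrableSM.
    rewrite -sphere_integral_conj; last first.
      by apply: integrableSD; apply: integrableSM => //; exact: L2B.
    by apply: eq_sphere_integral => z _; rewrite -rmorphM; congr (_^*); ring.
  rewrite normc_conj; apply: le_trans (cauchy_schwarz (L2B lF lf) (lweval q)) _.
  rewrite ler_wpM2r//; apply: L2norm_bounded => //.
  exact: L2_measurable (L2B lF lf).
have [->//|qn0] := eqVneq (L2norm (weval q)) 0.
have qp : 0 < L2norm (weval q) by rewrite lt_neqAle eq_sym qn0.
by rewrite -(ler_pM2r qp) -expr2.
Qed.

End projections.

(** * Bounding the extension by means of the Poisson-Szego kernel *)

Section kernel_bound.
Context {R : realType} (n : nat).
Local Notation Cn := 'rV[R[i]]_n.
Local Notation S := (unit_sphere R n).
Implicit Types (f g : Cn -> R[i]) (p q : seq (R[i] * seq 'I_n)) (z w x : Cn).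

Hypothesis n0 : (0 < n)%N.

Lemma ball_alg_bounded f : ball_alg f -> exists2 C : R, 0 <= C &
  forall z, cnorm z <= 1 -> normc (f z) <= C.
Proof.
move=> [_ hf]; have [p hp] := hf 1 ltr01.
pose C := \sum_(t <- p) normc t.1.
have C0 : 0 <= C by apply: sumr_ge0 => t _; exact: normc_ge0.
exists (1 + C) => [|z z1]; first lra.
have m1 s : normc (mono s z) <= 1.
  elim: s => [|i s ih]; first by rewrite mono_nil normc1.
  rewrite mono_cons normcM -[leRHS]mulr1 ler_pM ?normc_ge0//.
  exact: le_trans (cnorm_coord z i) z1.
rewrite -[f z](subrK (weval p z)) (le_trans (le_normcD _ _))// lerD ?hp//.
rewrite (le_trans (normc_sum _ _ _))//; apply: ler_sum => t _.
by rewrite normcM ler_piMr ?normc_ge0.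
Qed.

Lemma ball_algM f g : ball_alg f -> ball_alg g -> ball_alg (fun z => f z * g z).
Proof.
move=> hf hg; split; first by apply: bdmM; [case: hf|case: hg].
move=> e e0; have [C C0 fC] := ball_alg_bounded hf; have [D D0 gD] := ball_alg_bounded hg.
pose d := Num.min 1 (e / (C + D + 1)); have cd : 0 < C + D + 1 by lra.
have d0 : 0 < d by rewrite lt_min ltr01 divr_gt0.
have d1 : d <= 1 by rewrite ge_min lexx.
have de : d * (C + D + 1) <= e by rewrite -ler_pdivlMr// ge_min lexx orbT.
have [p hp] := hf.2 d d0; have [q hq] := hg.2 d d0.
have [r hr] := ispolyM (ispoly_weval p) (ispoly_weval q).
exists r => z z1; rewrite -hr.
have -> : f z * g z - weval p z * weval q z =
  (f z - weval p z) * g z + (f z - (f z - weval p z)) * (g z - weval q z) by ring.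
apply: (@le_trans _ _ (d * D + (C + d) * d)).
  rewrite (le_trans (le_normcD _ _))// !normcM lerD// ler_pM ?normc_ge0 ?hp ?gD ?hq//.
  by rewrite (le_trans (le_normcB _ _))// lerD ?fC ?hp.
apply: le_trans de; nra.
Qed.

Lemma hip_self z : hip z z = (cnorm z ^+ 2)%:C.
Proof.
rewrite cnorm_sqr /hip rmorph_sum; apply: eq_bigr => i _; exact: mulc_conj.
Qed.

Lemma szego_self z : cnorm z < 1 -> exists2 k : R, 0 < k & szego z z = k%:C.
Proof.
move=> z1; exists ((1 - cnorm z ^+ 2) ^- n).
  by rewrite invr_gt0 exprn_gt0// subr_gt0 expr_lt1 ?cnorm_ge0.
by rewrite /szego hip_self -(rmorph1 (real_complex R)) -rmorphB -rmorphXn -fmorphV.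
Qed.

Variables (m : nat) (Z : 'I_m -> Cn) (W : 'I_m -> R[i]).
Hypothesis Zball : forall i, unit_ball R n (Z i).

Variables (F : (Cn -> R[i]) -> R[i]) (N : R).
Hypothesis N0 : 0 <= N.
Hypothesis Flin : forall a f g, L2 f -> L2 g -> F (fun z => a * f z + g z) = a * F f + F g.
Hypothesis Fle : forall f, L2 f -> normc (F f) <= N * fine (L1norm f).
Hypothesis FPi : forall f, MQ Z f -> F f = PiZW Z W f.

Lemma extension_sup_le f (e : R) : bdm f -> 0 <= e -> (forall z, S z -> normc (f z) <= e) ->
  normc (F f) <= N * e.
Proof.
move=> bf e0 fe; have lf := bdm_L2 bf.
apply: le_trans (Fle lf) _; rewrite ler_wpM2l// -lee_fin -L1norm_fin//.
by apply: L1norm_bounded => //; exact: L2_measurable.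
Qed.

(** For g close to f and q the projection of conj g, write f = (g - conj q) + conj q - (g - f). The
    first part lies in M + H^2_0, where F vanishes; the other two have L^1 norm at most d, for conj
    q by [proj_conj_small]. *)
Lemma extension_annihilates f : bdm f ->
  (forall p, sphere_integral (fun z => weval p z * f z) = 0) ->
  (forall e : R, 0 < e -> exists g, [/\ bdm g, has_proj g, has_proj (fun z => (g z)^*) &
     forall z, S z -> normc (g z - f z) <= e]) ->
  F f = 0.
Proof.
move=> bf f0 happ; apply/eqP; rewrite -normc_eq0 eq_le normc_ge0 andbT.
apply/ler_addgt0Pr => e e0; rewrite add0r.
have N1 : 0 < 2 * (N + 1) by rewrite mulr_gt0// ltr_wpDl.
pose d := e / (2 * (N + 1)); have d0 : 0 < d by rewrite divr_gt0.
have [g [bg pg pcg gf]] := happ d d0.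
have lf := bdm_L2 bf; have lg := bdm_L2 bg.
have [q [hq pq]] := trig_split n0 lg pg pcg.
have nq := proj_conj_small bg bf (ltW d0) gf f0 pq.
have lq := bdm_L2 (bdm_weval q); have lcq := L2_conj lq.
have Fq : normc (F (fun z => (weval q z)^*)) <= N * d.
  apply: le_trans (Fle lcq) _; rewrite ler_wpM2l// -lee_fin -(L1norm_fin lcq).
  by apply: le_trans (L1norm_le_L2norm lcq) _; rewrite L2norm_conj lee_fin.
have Fgf : normc (F (fun z => g z - f z)) <= N * d.
  apply: extension_sup_le => //; last exact: ltW.
  apply: eq_bdm (bdmD bg (bdmM (bdm_cst n (-1)) bf)) _ => z; ring.
have Fh : F (fun z => g z - (weval q z)^*) = 0.
  by rewrite FPi ?(PiZW_MS_H20 W n0 Zball hq)//; exact: MQ_MS_H20.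
have -> : F f = (F (fun z => g z - (weval q z)^*) + F (fun z => (weval q z)^*)) - F (fun z => g z - f z).
  have e1 := Flin 1 (L2B lg lcq) lcq.
  have e2 := Flin (-1) (L2B lg lf) lg.
  have -> : F f = F (fun z => -1 * (g z - f z) + g z) by congr F; apply/funext => z; ring.
  rewrite e2; have -> : F g = F (fun z => 1 * (g z - (weval q z)^*) + (weval q z)^*).
    by congr F; apply/funext => z; ring.
  by rewrite e1; ring.
rewrite Fh add0r (le_trans (le_normcB _ _))// (le_trans (lerD Fq Fgf))//.
have -> : N * d + N * d = e * (N / (N + 1)) by rewrite /d; field; lra.
by rewrite ler_piMr ?(ltW e0)// ler_pdivrMr; lra.
Qed.

(* [F] cannot distinguish the conjugate kernel from the Poisson kernel
   |K_z|^2 / K_z(z), which is a probability density. *)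
Lemma extension_kernel_le z : cnorm z < 1 -> normc (F (fun x => szego z x)) <= N.
Proof.
move=> z1; have [k k0 kE] := szego_self z1.
pose K x := szego x z; have bK : ball_alg K by exact: ball_alg_szego.
have cK x : (K x)^* = szego z x by exact: szego_conj.
pose P x := (k^-1)%:C * (K x * (K x)^*).
have PE x : P x = (k^-1 * normc (K x) ^+ 2)%:C by rewrite realcM -mulc_conj.
have P0 x : 0 <= k^-1 * normc (K x) ^+ 2 by rewrite mulr_ge0 ?sqr_ge0// invr_ge0 ltW.
have bP : bdm P.
  by apply: bdmM; [exact: bdm_cst|apply: bdmM; [case: bK|apply: bdm_conj; case: bK]].
have kk : (k^-1)%:C * k%:C = 1 :> R[i] by rewrite -realcM mulVf ?gt_eqF.
have lK := H2_L2 (H2_ball_alg bK).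
have intP : sphere_integral P = 1.
  rewrite /P sphere_integralZ; last exact: integrableSM lK (L2_conj lK).
  by rewrite [X in _ * X](reproducing n0 bK z1) /K kE.
have nP : fine (L1norm P) = 1.
  have := congr1 (@complex.Re R) intP; rewrite /sphere_integral /= => <-; congr fine.
  by apply: eq_integral => x _; rewrite PE normc_real ger0_norm.
have lP := bdm_L2 bP; have lcK := L2_conj lK.
pose f x := P x - (K x)^*.
have bf : bdm f.
  apply: eq_bdm (bdmD bP (bdmM (bdm_cst n (-1)) (bdm_conj bK.1))) _ => x; rewrite /f; ring.
suff f0 : F f = 0.
  have -> : F (fun x => szego z x) = F P.
    have := Flin (-1) (bdm_L2 bf) lP; rewrite f0 mulr0 add0r => <-.
    by congr F; apply/funext => x; rewrite /f -cK; ring.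
  by apply: le_trans (Fle lP) _; rewrite nP mulr1.
apply: extension_annihilates => // [p|e e0].
  have bp := ball_alg_ispoly (ispoly_weval p).
  have lp := bdm_L2 (bdm_weval p).
  have bpK := ball_algM bp bK; have lpK := H2_L2 (H2_ball_alg bpK).
  rewrite (eq_sphere_integral (g := fun x => (k^-1)%:C * ((weval p x * K x) * (K x)^*) +
    (- (weval p x * (K x)^*)))); last by move=> x _; rewrite /f /P; ring.
  have i1 := integrableSM lpK lcK; have i2 := integrableSM lp lcK.
  rewrite (sphere_integral_lin _ i1 (integrableSN i2)) (sphere_integralN i2).
  have -> : sphere_integral (fun x => weval p x * K x * (K x)^*) = weval p z * K z.
    exact: (reproducing n0 bpK z1).
  have -> : sphere_integral (fun x => weval p x * (K x)^*) = weval p z.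
    exact: (reproducing n0 bp z1).
  by rewrite /K kE mulrCA kk mulr1 subrr.
have [C C0 hC] := ball_alg_bounded bK.
have ki : 0 < k^-1 by rewrite invr_gt0.
have Ck : 0 < k^-1 * (2 * C + 1) + 1 by rewrite addr_gt0// mulr_gt0//; lra.
(* Replacing K by a polynomial within d changes conj K by at most d and |K|^2 / k by at most d(2C +
   d) / k. *)
pose d := Num.min 1 (e / (k^-1 * (2 * C + 1) + 1)).
have d0 : 0 < d by rewrite lt_min ltr01 divr_gt0.
have d1 : d <= 1 by rewrite ge_min lexx.
have de : d * (k^-1 * (2 * C + 1) + 1) <= e by rewrite -ler_pdivlMr// ge_min lexx orbT.
have [p hp] := bK.2 d d0.
have [u hu] := ispoly_cst n (1 : R[i]).
have l1 : L2 (fun x => (weval p x)^* * weval p x).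
  by apply/bdm_L2/bdmM; [exact/bdm_conj/bdm_weval|exact: bdm_weval].
exists (fun x => (k^-1)%:C * ((weval p x)^* * weval p x) + (-1) * (weval p x)^*).
have lm : L2 (fun x => (-1) * (weval p x)^*).
  by apply: L2Z; apply: L2_conj; exact/bdm_L2/bdm_weval.
split.
- apply: bdmD; apply: bdmM; try exact: bdm_cst; last exact/bdm_conj/bdm_weval.
  by apply: bdmM; [exact/bdm_conj/bdm_weval|exact: bdm_weval].
- apply: has_proj_lin => //; first exact: has_proj_trig.
  apply: has_projZ => //; first by apply: L2_conj; exact/bdm_L2/bdm_weval.
  have [r hr] := has_proj_trig n0 p u; exists r => q; rewrite -hr; congr (L2ip _ _).
  by apply/funext => x; rewrite -hu mulr1.
- have -> : (fun x => ((k^-1)%:C * ((weval p x)^* * weval p x) + (-1) * (weval p x)^*)^*) =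
    fun x => (k^-1)%:C * ((weval p x)^* * weval p x) + (-1) * weval p x.
    apply/funext => x; rewrite rmorphD !rmorphM /= rmorphN rmorph1 conjCK.
    by rewrite (_ : (k^-1)%:C^* = (k^-1)%:C) ?[weval p x * _]mulrC//; exact: conjc_real.
  apply: has_proj_lin => //.
  + by apply: L2Z; exact/bdm_L2/bdm_weval.
  + exact: has_proj_trig.
  + by apply: has_projZ; [exact/bdm_L2/bdm_weval|exact/has_proj_ispoly/ispoly_weval].
- move=> x xS; have x1 : cnorm x <= 1 by rewrite xS.
  set t := weval p x; have ht : normc (K x - t) <= d by exact: hp.
  have -> : (k^-1)%:C * (t^* * t) + (-1) * t^* - f x =
      (K x - t)^* - (k^-1)%:C * ((K x - t) * (K x)^* + (K x - (K x - t)) * (K x - t)^*).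
    by rewrite /f /P rmorphB /=; ring.
  rewrite (le_trans (le_normcB _ _))// normc_conj.
  apply: (@le_trans _ _ (d + k^-1 * (d * C + (C + d) * d))).
    rewrite lerD// normcM normc_real gtr0_norm// ler_wpM2l ?(ltW ki)//.
    rewrite (le_trans (le_normcD _ _))// !normcM !normc_conj lerD//.
      by rewrite ler_pM ?normc_ge0 ?hC.
    rewrite ler_pM ?normc_ge0// (le_trans (le_normcB _ _))// lerD ?hC//.
  have h : d * C + (C + d) * d <= d * (2 * C + 1) .
    have -> : d * C + (C + d) * d = d * (2 * C + d) by ring.
    by rewrite ler_wpM2l ?(ltW d0)// lerD2l.
  have h2 := ler_wpM2l (ltW ki) h.
  apply: le_trans de; rewrite [leRHS]mulrDr mulr1 addrC lerD2r (le_trans h2)//.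
  by rewrite mulrCA.
Qed.

End kernel_bound.

(** * Analyticity of the interpolant *)

Section multinomial.
Context (n : nat).
Implicit Types (a : {ffun 'I_n -> nat}) (s : seq 'I_n).

(** The multinomial coefficient as the number of words of length k with content a, which is how it
    arises when a power of a sum is expanded. *)
Definition multinom k a : nat :=
  (\sum_(f : {ffun 'I_k -> 'I_n} | content (codom f) == a) 1)%N.

Lemma multinomial_expansion (V : comPzSemiRingType) (y : 'I_n -> V) k :
  (\sum_i y i) ^+ k =
  \sum_(a <- boxset n k.+1 | degree a == k) (multinom k a)%:R * \prod_i y i ^+ a i.
Proof.
have -> : (\sum_i y i) ^+ k = \prod_(j < k) \sum_i y i by rewrite prodr_const card_ord.
rewrite bigA_distr_bigA /=.
rewrite (eq_bigr (fun f : {ffun 'I_k -> 'I_n} => \prod_i y i ^+ content (codom f) i)); last first.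
  by move=> f _; rewrite -prod_content /codom /image_mem big_map big_enum.
have cod (f : {ffun 'I_k -> 'I_n}) : degree (content (codom f)) = k.
  by rewrite degree_content size_codom card_ord.
rewrite -[RHS]big_filter; set r := [seq a <- boxset n k.+1 | _].
have rf (f : {ffun 'I_k -> 'I_n}) : content (codom f) \in r.
  rewrite mem_filter cod eqxx mem_boxset; apply/forallP => i.
  by rewrite ltnS -[X in (_ <= X)%N](cod f) le_degree.
have ur : uniq r by rewrite filter_uniq ?boxset_uniq.
rewrite (eq_bigr (fun f : {ffun 'I_k -> 'I_n} =>
    \sum_(a <- r | content (codom f) == a) \prod_i y i ^+ a i)); last first.
  move=> f _; rewrite [RHS]big_mkcond [RHS](bigD1_seq _ (rf f) ur) /= eqxx [X in _ + X]big1 ?addr0// => a.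
  by rewrite eq_sym => /negbTE ->.
rewrite (exchange_big_dep xpredT)//; apply: eq_bigr => a _.
by rewrite /multinom natr_sum mulr_suml; apply: eq_bigr => f _; rewrite mul1r.
Qed.

End multinomial.

Section summability.
Context {R : realType} (n : nat).
Local Notation Cn := 'rV[R[i]]_n.
Implicit Types (a : {ffun 'I_n -> nat}) (G : {ffun 'I_n -> nat} -> R).

Lemma le_sum_uniq (T : eqType) (H : T -> R) (s1 s2 : seq T) : (forall t, 0 <= H t) ->
  uniq s1 -> uniq s2 -> {subset s1 <= s2} -> \sum_(t <- s1) H t <= \sum_(t <- s2) H t.
Proof.
move=> H0 u1 u2 s12; rewrite [leRHS](bigID (mem s1)) /=.
rewrite (_ : \sum_(t <- s2 | t \in s1) H t = \sum_(t <- s1) H t).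
  by rewrite lerDl sumr_ge0.
rewrite -big_filter; apply: perm_big; apply: uniq_perm; rewrite ?filter_uniq// => t.
by rewrite mem_filter andb_idr//; exact: s12.
Qed.

Lemma degree_sum_bound G (B : R) : (forall a, 0 <= G a) ->
  (forall K, \sum_(k < K) \sum_(a <- boxset n k.+1 | degree a == k) G a <= B) ->
  forall s : seq {ffun 'I_n -> nat}, uniq s -> \sum_(a <- s) G a <= B.
Proof.
move=> G0 hB s us; pose K := (\max_(a <- s) degree a).+1.
apply: le_trans (hB K); rewrite (degree_sumE G (leqnn K)) -[leRHS]big_filter.
apply: le_sum_uniq => //; first by rewrite filter_uniq ?boxset_uniq.
move=> a sa; rewrite mem_filter mem_boxset.
have aK : (degree a < K)%N by rewrite ltnS; exact: (@leq_bigmax_seq _ s xpredT (@degree n) a).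
by rewrite aK; apply/forallP => i; exact: leq_ltn_trans (le_degree a i) aK.
Qed.

Lemma summable_bound G (B : R) : (forall a, 0 <= G a) ->
  (forall s : seq {ffun 'I_n -> nat}, uniq s -> \sum_(a <- s) G a <= B) ->
  summable setT (fun a => (G a)%:E).
Proof.
move=> G0 hB; rewrite /summable; apply: (@le_lt_trans _ _ B%:E); last exact: ltry.
apply: ge_ereal_sup => _ [X [fX _] <-].
rewrite fsbig_finite//= (eq_bigr (fun a => (G a)%:E)); last first.
  by move=> a _; rewrite /= ger0_norm.
by rewrite sumEFin lee_fin hB// finmap.fset_uniq.
Qed.

End summability.

Section kernel_analytic.
Context {R : realType} (n : nat).
Local Notation Cn := 'rV[R[i]]_n.
Local Notation S := (unit_sphere R n).
Implicit Types (a : {ffun 'I_n -> nat}) (f g : Cn -> R[i]) (p h x z : Cn).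

Hypothesis n0 : (0 < n)%N.

Variables (F : (Cn -> R[i]) -> R[i]) (N : R).
Hypothesis N0 : 0 <= N.
Hypothesis Flin : forall c f g, L2 f -> L2 g -> F (fun z => c * f z + g z) = c * F f + F g.
Hypothesis Fle : forall f (e : R), bdm f -> 0 <= e -> (forall z, S z -> normc (f z) <= e) ->
  normc (F f) <= N * e.

Lemma cnormD x z : cnorm (x + z) <= cnorm x + cnorm z.
Proof.
rewrite -(@ler_pXn2r _ 2)// ?nnegrE ?addr_ge0 ?cnorm_ge0//.
have -> : cnorm (x + z) ^+ 2 = normc (hip (x + z) (x + z)).
  by rewrite hip_self normc_real ger0_norm// sqr_ge0.
have -> : hip (x + z) (x + z) = (hip x x + hip x z) + (hip z x + hip z z).
  rewrite /hip -!big_split /=; apply: eq_bigr => i _; rewrite !mxE rmorphD /=; ring.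
rewrite (le_trans (le_normcD _ _))//.
rewrite (le_trans (lerD (le_normcD _ _) (le_normcD _ _)))//.
rewrite (le_trans (lerD (lerD (hip_le _ _) (hip_le _ _)) (lerD (hip_le _ _) (hip_le _ _))))//.
by rewrite le_eqVlt; apply/orP; left; apply/eqP; ring.
Qed.

Let F0 : F (fun=> 0) = 0.
Proof.
have l0 : L2 ((fun=> 0) : Cn -> R[i]) by exact: L2_cst.
have := Flin (-1) l0 l0; rewrite (_ : (fun z : Cn => -1 * 0 + 0) = fun=> 0) => [->|].
  by rewrite mulN1r addNr.
by apply/funext => z; rewrite mulr0 addr0.
Qed.

Let Fsum (I : Type) (r : seq I) (P : pred I) (c : I -> R[i]) (H : I -> Cn -> R[i]) :
  (forall i, L2 (H i)) ->
  F (fun z => \sum_(i <- r | P i) c i * H i z) = \sum_(i <- r | P i) c i * F (H i).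
Proof.
move=> lH; elim: r => [|i r ih].
  by rewrite big_nil -F0; congr F; apply/funext => z; rewrite big_nil.
rewrite big_cons; case: (boolP (P i)) => Pi; last first.
  by rewrite -ih; congr F; apply/funext => z; rewrite big_cons (negbTE Pi).
rewrite -ih -Flin//; first by congr F; apply/funext => z; rewrite big_cons Pi.
rewrite (_ : (fun z => _) = fun z => \sum_(i <- [seq i <- r | P i]) c i * H i z).
  by apply: L2_sum => j; exact: L2Z.
by apply/funext => z; rewrite big_filter.
Qed.

Variable p : Cn.
Hypothesis p1 : cnorm p < 1.

(** The expansion at p starts from K(p + h, x) = A^-n (1 - <h, x>/A)^-n, where |A| >= al on the
    sphere. *)
Let A x := 1 - hip p x.
Let al : R := 1 - cnorm p.

Let al0 : 0 < al. Proof. by rewrite subr_gt0. Qed.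

Let A_ge x : S x -> al <= normc (A x).
Proof.
move=> xS; apply: le_trans (normc1B _); rewrite lerD2l lerN2.
by rewrite (le_trans (hip_le _ _))// xS mulr1.
Qed.

Let A_neq0 x : S x -> A x != 0.
Proof. by move=> xS; rewrite -normc_gt0 (lt_le_trans al0)// A_ge. Qed.

Let AV_le x d : S x -> normc (A x ^- d) <= al ^- d.
Proof.
move=> xS; rewrite -!exprVn normcX lerXn2r ?nnegrE ?normc_ge0 ?invr_ge0 ?(ltW al0)//.
have An : 0 < normc (A x) by rewrite normc_gt0 A_neq0.
have -> : normc (A x)^-1 = (normc (A x))^-1.
  by apply: (mulfI (lt0r_neq0 An)); rewrite -normcM !mulfV ?normc1 ?A_neq0// gt_eqF.
by rewrite lef_pV2 ?posrE// A_ge.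
Qed.

Let mA : measurable_fun setT A.
Proof.
apply: (@eq_measurable_fun _ _ _ _ _ (fun x => 1 + (-1) * (hip x p)^*)).
  by move=> x _; rewrite hip_conj /A mulN1r.
by have [] := bdmD (bdm_cst n 1) (bdmM (bdm_cst n (-1)) (bdm_conj (ispoly_bdm (ispoly_hip p)))).
Qed.

Let bdmAV d : bdm (fun x => A x ^- d).
Proof.
split; last by exists (al ^- d) => x; exact: AV_le.
by apply: measurable_funcV => //; apply: measurable_funcX => //; exact: mA.
Qed.

(** The coefficient of h^a in that kernel: a negative binomial series in <h, x>/A, each power being
    developed by the multinomial formula. *)
Let u a x : R[i] := ('C(n.-1 + degree a, degree a) * multinom (degree a) a)%:R *
  ((\prod_i (x 0 i)^* ^+ a i) * A x ^- (n + degree a)).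

Let bdm_u a : bdm (u a).
Proof.
apply: bdmM; first exact: bdm_cst.
apply: bdmM => //.
have [w hw] : ispoly (fun x : Cn => \prod_i x 0 i ^+ a i).
  by apply: ispoly_prod => i; apply: ispolyX; exact: ispoly_coord.
apply: (eq_bdm (bdm_conj (bdm_weval w))) => x; rewrite -hw rmorph_prod.
by apply: eq_bigr => i _; rewrite rmorphXn.
Qed.

Let coef a := F (u a).

Let coef_le a : normc (coef a) <= N * (('C(n.-1 + degree a, degree a) *
  multinom (degree a) a)%:R * al ^- (n + degree a)).
Proof.
have e0 : 0 <= al ^- (n + degree a) by rewrite invr_ge0 exprn_ge0// ltW.
apply: Fle => //; first by rewrite mulr_ge0.
move=> x xS; rewrite /u normcM -(rmorph_nat (real_complex R)) normc_real ger0_norm//.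
rewrite ler_wpM2l// normcM -[leRHS]mul1r ler_pM ?normc_ge0 ?AV_le//.
rewrite normc_prod; apply: prodr_ile1 => i _; rewrite normc_ge0 normcX normc_conj /=.
by rewrite exprn_ile1 ?normc_ge0// (le_trans (cnorm_coord x i))// xS.
Qed.

(** The l^1 norm enters because its k-th power is the sum of the moduli of the monomials of degree k
    with multinomial weights. *)
Let nrm1 h : R := \sum_i normc (h 0 i).

Let nrm1_le h : nrm1 h <= n%:R * cnorm h.
Proof.
rewrite /nrm1 (le_trans (ler_sum _ (fun i _ => cnorm_coord h i)))//.
by rewrite sumr_const card_ord mulr_natl.
Qed.

Let degree_coef_le h K : nrm1 h < al ->
  \sum_(k < K) \sum_(a <- boxset n k.+1 | degree a == k) normc (monomial_term coef h a)
  <= N * al ^- n * (1 - nrm1 h / al) ^- n.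
Proof.
move=> hal; pose y := nrm1 h / al.
have h0 : 0 <= nrm1 h by apply: sumr_ge0 => i _; exact: normc_ge0.
have y01 : 0 <= y < 1 by rewrite divr_ge0 ?(ltW al0)//= ltr_pdivrMr// mul1r.
have a0 : 0 <= N * al ^- n by rewrite mulr_ge0// invr_ge0 exprn_ge0// ltW.
apply: (@le_trans _ _ (N * al ^- n * nbsum n.-1 K y)); last first.
  by rewrite ler_wpM2l//; have := nbsum_le n.-1 K y01; rewrite prednK.
rewrite /nbsum mulr_sumr; apply: ler_sum => k _.
rewrite expr_div_n (multinomial_expansion (fun i => normc (h 0 i))) mulrA mulr_suml mulr_sumr.
apply: ler_sum => a /eqP ak.
rewrite /monomial_term normcM normc_prod.
rewrite (eq_bigr (fun i => normc (h 0 i) ^+ a i)); last by move=> i _; rewrite normcX.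
have P0 : 0 <= \prod_i normc (h 0 i) ^+ a i.
  by apply: prodr_ge0 => i _; rewrite exprn_ge0 ?normc_ge0.
apply: le_trans (ler_wpM2r P0 (coef_le a)) _; rewrite ak.
by rewrite natrM exprD invfM le_eqVlt; apply/orP; left; apply/eqP; ring.
Qed.

Let degpart_coef h k : degpart coef h k =
  F (fun x => A x ^- n * ('C(n.-1 + k, k)%:R * (hip h x / A x) ^+ k)).
Proof.
have E : (fun x => A x ^- n * ('C(n.-1 + k, k)%:R * (hip h x / A x) ^+ k)) =
  fun x => \sum_(a <- boxset n k.+1 | degree a == k) (\prod_i h 0 i ^+ a i) * u a x.
  apply/funext => x.
  rewrite expr_div_n /hip multinomial_expansion mulr_suml !mulr_sumr.
  apply: eq_bigr => a /eqP ak; rewrite /u ak natrM.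
  rewrite (eq_bigr (fun i => h 0 i ^+ a i * (x 0 i)^* ^+ a i)); last by move=> i _; rewrite exprMn.
  by rewrite big_split /= exprD invfM; ring.
rewrite E Fsum; last by move=> a; exact: bdm_L2.
by apply: eq_bigr => a _; rewrite mulrC.
Qed.

Let szego_shift h x : S x -> cnorm h < al -> szego (p + h) x = A x ^- n * (1 - hip h x / A x) ^- n.
Proof.
move=> xS hh; rewrite /szego -invfM -exprMn mulrBr mulr1 mulrCA mulfV ?A_neq0// mulr1.
rewrite /A /hip (_ : \sum_i (p + h) 0 i * (x 0 i)^* =
  \sum_i p 0 i * (x 0 i)^* + \sum_i h 0 i * (x 0 i)^*); first by rewrite opprD addrA.
by rewrite -big_split /=; apply: eq_bigr => i _; rewrite mxE mulrDl.
Qed.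

Let bdm_szego_left z : cnorm z < 1 -> bdm (fun x => szego z x).
Proof.
move=> z1; apply: (eq_bdm (bdm_conj (bdm_szego z1))) => x; exact: szego_conj.
Qed.

Let bdm_term h k : bdm (fun x => A x ^- n * ('C(n.-1 + k, k)%:R * (hip h x / A x) ^+ k)).
Proof.
apply: bdmM => //; apply: bdmM; first exact: bdm_cst.
apply: bdmX; apply: bdmM; last exact: (bdmAV 1).
apply: (eq_bdm (bdm_conj (ispoly_bdm (ispoly_hip h)))) => x; exact: hip_conj.
Qed.

Let degpart_cvg : exists B q : R, 0 <= q < 1 /\ forall h K, cnorm h <= al / 2 ->
  normc (F (fun x => szego (p + h) x) - \sum_(k < K) degpart coef h k) <= B * q ^+ K.
Proof.
(* For |h| <= al / 2 the ratio <h, x>/A has modulus at most 1/2 on the sphere. *)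
have r01 : 0 <= (1/2 : R) < 1 by lra.
have [C C0 [q q01 hC]] := nbsum_cvg n.-1 r01; have [q0 _] := andP q01.
exists (N * (al ^- n * C)), q; split => // h K hh.
have hal : cnorm h < al by apply: le_lt_trans hh _; have := al0; lra.
have ph : cnorm (p + h) < 1.
  by apply: le_lt_trans (cnormD _ _) _; move: hal; rewrite /al; lra.
pose G x := szego (p + h) x - \sum_(k < K) A x ^- n * ('C(n.-1 + k, k)%:R * (hip h x / A x) ^+ k).
have bs := bdm_szego_left ph.
have -> : F (fun x => szego (p + h) x) - \sum_(k < K) degpart coef h k = F G.
  have -> : F G = F (fun x => -1 * (\sum_(k < K) 1 * (A x ^- n * ('C(n.-1 + k, k)%:R * (hip h x / A x) ^+ k))) + szego (p + h) x).
    by congr F; apply/funext => x; rewrite mulN1r addrC; congr (_ - _); apply: eq_bigr => k _; rewrite mul1r.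
  rewrite Flin; [|by apply: L2_sum => k; apply: L2Z; exact: bdm_L2|exact: bdm_L2].
  rewrite Fsum; last by move=> k; exact: bdm_L2.
  rewrite mulN1r [RHS]addrC; congr (_ - _); apply: eq_bigr => k _.
  by rewrite mul1r degpart_coef.
rewrite -mulrA; have e0 : 0 <= al ^- n * C * q ^+ K.
  by rewrite !mulr_ge0 ?exprn_ge0// invr_ge0 exprn_ge0// ltW.
apply: Fle => //.
  have bG : bdm (fun x => szego (p + h) x + -1 * (\sum_(k < K) A x ^- n * ('C(n.-1 + k, k)%:R * (hip h x / A x) ^+ k))).
    by apply: bdmD => //; apply: bdmM; [exact: bdm_cst|exact: bdm_sum].
  by apply: (eq_bdm bG) => x; rewrite mulN1r.
move=> x xS; rewrite /G -mulr_sumr szego_shift// -mulrBr normcM -mulrA.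
rewrite ler_pM ?normc_ge0 ?AV_le// normc_sub.
have := hC K (hip h x / A x); rewrite prednK//; apply.
have An : 0 < normc (A x) by rewrite normc_gt0 A_neq0.
have := AV_le 1 xS; rewrite !expr1 normcM => AV.
apply: (@le_trans _ _ (al / 2 * al^-1)).
  rewrite ler_pM ?normc_ge0// (le_trans (hip_le _ _))// xS mulr1//.
by rewrite mulrAC divff ?gt_eqF// le_eqVlt; apply/orP; left; apply/eqP; field.
Qed.

Lemma kernel_analytic_at : analytic_at (fun z => F (fun x => szego z x)) p.
Proof.
have nR : 0 < n%:R :> R by rewrite ltr0n.
have n1 : 1 <= n%:R :> R by rewrite ler1n.
(* The l^1 norm of h is then at most al / 4, so that even 2h is in the domain of absolute
   summability. *)
pose r := al / (4 * n%:R); have r0 : 0 < r by rewrite divr_gt0// mulr_gt0.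
have hr h : cnorm h < r -> nrm1 h <= al / 4.
  move=> hh; apply: le_trans (nrm1_le h) _.
  have : n%:R * cnorm h <= n%:R * r by rewrite ler_wpM2l ?ler0n// ltW.
  by rewrite /r; congr (_ <= _); field; rewrite gt_eqF.
have sm h : nrm1 h < al -> forall s : seq {ffun 'I_n -> nat}, uniq s ->
    \sum_(a <- s) normc (monomial_term coef h a) <= N * al ^- n * (1 - nrm1 h / al) ^- n.
  move=> hh s us; apply: degree_sum_bound => // [a|K]; first exact: normc_ge0.
  exact: degree_coef_le.
exists r, coef; split => // h hh.
have h4 := hr h hh.
have hal : nrm1 h < al by apply: le_lt_trans h4 _; have := al0; lra.
split; first by apply: summable_bound (sm h hal) => a; exact: normc_ge0.
pose h2 := (2 : R)%:C *: h.
have nh2 : nrm1 h2 = 2 * nrm1 h.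
  rewrite /nrm1 mulr_sumr; apply: eq_bigr => i _; rewrite mxE normcM normc_real.
  by rewrite ger0_norm.
have h2al : nrm1 h2 < al by rewrite nh2; have := al0; lra.
pose B := N * al ^- n * (1 - nrm1 h2 / al) ^- n.
(* The box contains all degrees below M; its other terms are compared with those for 2h, which are
   larger by a factor of at least 2^M. *)
have tail M : normc (\sum_(k < M) degpart coef h k - box_sum coef M h) <= B * (1/2) ^+ M.
  rewrite (degree_sumE _ (leqnn M)) box_sumE [X in _ - X](bigID (fun a => (degree a < M)%N)) /=.
  rewrite opprD addrA subrr sub0r normcN (le_trans (normc_sum _ _ _))//.
  apply: (@le_trans _ _ (\sum_(a <- boxset n M | ~~ (degree a < M)%N)
     normc (monomial_term coef h2 a) * (1/2) ^+ M)).
    apply: ler_sum => a; rewrite -leqNgt => Ma.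
    have -> : normc (monomial_term coef h2 a) = 2 ^+ degree a * normc (monomial_term coef h a).
      by rewrite /h2 monomial_termZ normcM normcX normc_real ger0_norm.
    rewrite mulrAC -[leLHS]mul1r ler_wpM2r ?normc_ge0//.
    rewrite -(subnK Ma) exprD -mulrA -exprMn (_ : 2 * (1 / 2) = 1 :> R); last by field.
    by rewrite expr1n mulr1 exprn_ege1// ler1n.
  rewrite -mulr_suml ler_wpM2r ?exprn_ge0// -big_filter.
  by apply: (sm _ h2al); rewrite filter_uniq ?boxset_uniq.
have hh2 : cnorm h <= al / 2.
  apply: le_trans (ltW hh) _; rewrite /r ler_pdivrMr ?mulr_gt0//.
  by rewrite mulrAC -mulrA ler_peMr ?(ltW al0)// ler_pdivlMr//; lra.
have [D [q [q01 hD]]] := degpart_cvg.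
apply/cvgrPdist_lt => e e0; have e2 : 0 < e / 2 by lra.
have [M1 hM1] := expr_cvg0 D q01 e2.
have x01 : 0 <= (1/2 : R) < 1 by lra.
have [M2 hM2] := expr_cvg0 B x01 e2.
exists (maxn M1 M2) => // M /=; rewrite geq_max => /andP[MM1 MM2].
rewrite sub0r normrN ger0_norm ?normc_ge0// [ltRHS]splitr.
rewrite -[X in normc (X - _)](subrK (\sum_(k < M) degpart coef h k)) -addrA.
apply: le_lt_trans (le_normcD _ _) _; apply: ler_ltD.
  by apply: le_trans (hD _ _ hh2) _; rewrite ltW// hM1.
by apply: le_lt_trans (tail M) _; exact: hM2.
Qed.

End kernel_analytic.

(** * Sharpness and distances *)

Section duality.
Context {R : realType} (n m : nat).
Local Notation Cn := 'rV[R[i]]_n.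
Variables (Z : 'I_m -> Cn) (W : 'I_m -> R[i]).
Hypothesis n0 : (0 < n)%N.
Hypothesis Zinj : injective Z.
Hypothesis Zball : forall i, unit_ball R n (Z i).
Implicit Types (N : R) (f g u : Cn -> R[i]).

Local Notation Pi := (PiZW Z W).

Definition interpolable N := exists phi : Cn -> R[i],
  [/\ analytic_on_ball phi, forall z, cnorm z < 1 -> normc (phi z) <= N &
      forall i, phi (Z i) = W i].

Definition PiZW_bounded N := forall f, MQ Z f -> normc (Pi f) <= N * fine (L1norm f).

Let fine_L1norm_ge0 f : 0 <= fine (L1norm f).
Proof. by rewrite fine_ge0// L1norm_ge0. Qed.

Lemma interpolable_bounded N : 0 <= N -> interpolable N <-> PiZW_bounded N.
Proof.
move=> N0; split=> [[phi [aphi phiN phiW]] f hf|hN].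
  have lf := MQ_L2 n0 Zball hf.
  have := PiZW_le Zball n0 Zinj aphi phiN phiW hf.
  by rewrite (L1norm_fin lf) -EFinM lee_fin.
have [F [Flin Fle FPi]] := PiZW_extension n0 Zball N0 hN.
exists (fun z => F (fun x => szego z x)); split.
- move=> p p1; apply: (kernel_analytic_at n0 N0 Flin) => // f e.
  exact: (extension_sup_le N0 Fle).
- by move=> z z1; apply: (extension_kernel_le n0 Zball N0 Flin Fle FPi).
(* The conjugate kernel at Z i lies in M_Q, where F is Pi, and pairing psi with it returns psi(Z i)
   = W i. *)
- move=> i; have KQ : conj_set (QZ Z) (fun x => szego (Z i) x).
    exists (fun x => \sum_j (j == i)%:R * szego x (Z j)); first by exists (fun j => (j == i)%:R).
    apply/funext => x; rewrite (bigD1 i)//= eqxx mul1r big1 ?addr0 ?szego_conj// => j ji.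
    by rewrite (negbTE ji) mul0r.
  rewrite FPi; last exact: MQ_conj_QZ.
  have bp := ball_alg_QZ n0 Zball (QZ_psiZW Z W).
  rewrite -[RHS](psiZW_interpolates n0 Zball Zinj W i) -(reproducing n0 bp (Zball i)).
  by apply: eq_sphere_integral => x _; rewrite szego_conj.
Qed.

Lemma functional_norm_le N : 0 <= N ->
  (functional_norm (MQ Z) Pi <= N%:E)%E <-> PiZW_bounded N.
Proof.
move=> N0; split=> [h f hf|hN]; last first.
  apply: ge_ereal_sup => _ [f [hf f1] <-]; rewrite lee_fin (le_trans (hN f hf))//.
  by rewrite ler_piMr// -lee_fin -(L1norm_fin (MQ_L2 n0 Zball hf)).
have lf := MQ_L2 n0 Zball hf; have [mf _] := L2_integrableS lf.
have scal (t : R) : 0 <= t -> t * fine (L1norm f) <= 1 -> t * normc (Pi f) <= N.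
  move=> t0 tf.
  have hz := MQ_lin t%:C hf (MQ_conj_QZ (conj_QZ_0 Z)).
  have zE : (fun z => t%:C * f z + 0) = fun z => t%:C * f z.
    by apply/funext => z; rewrite addr0.
  rewrite zE in hz.
  have Pt : Pi (fun z => t%:C * f z) = t%:C * Pi f.
    rewrite /PiZW -sphere_integralZ; last by apply: integrableSM => //; exact: L2_psiZW.
    by apply: eq_sphere_integral => z _; rewrite mulrCA.
  have : ((normc (Pi (fun z => t%:C * f z)))%:E <= N%:E)%E.
    apply: le_trans h; apply: ereal_sup_ubound; exists (fun z => t%:C * f z) => //.
    split => //; rewrite L1normZ// normc_real ger0_norm// (L1norm_fin lf).
    by rewrite -EFinM lee_fin.
  by rewrite lee_fin Pt normcM normc_real ger0_norm.
have [l0|ln0] := eqVneq (fine (L1norm f)) 0; last first.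
  have lp : 0 < fine (L1norm f) by rewrite lt_neqAle eq_sym ln0 fine_L1norm_ge0.
  have := scal (fine (L1norm f))^-1; rewrite invr_ge0 (ltW lp) mulVf// => /(_ isT (lexx _)).
  by rewrite mulrC ler_pdivrMr.
(* A function of norm 0 may be scaled arbitrarily: the factor (N + 1)/e yields |Pi f| <= eN/(N +
   1). *)
rewrite l0 mulr0; apply/ler_addgt0Pr => e e0; rewrite add0r.
have := scal ((N + 1) / e); rewrite l0 mulr0 ler01 => /(_ _ isT) h1.
have t0 : 0 <= (N + 1) / e by rewrite divr_ge0 ?(ltW e0)// addr_ge0.
have := h1 t0; rewrite mulrAC ler_pdivrMr// => h2.
have N1 : 0 < N + 1 by rewrite ltr_wpDl.
rewrite -(ler_pM2l N1) (le_trans h2)// ler_wpM2r ?(ltW e0)// lerDl//.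
Qed.

(** The common form of the four conditions. The least bound is described by inequalities, so each
    condition is compared with it through a statement about a fixed N. *)
Definition sharp := PiZW_bounded 1 /\ forall N, 0 <= N < 1 -> ~ PiZW_bounded N.

Lemma functional_norm_sharp : functional_norm (MQ Z) Pi = 1%E <-> sharp.
Proof.
split=> [h|[h1 hN]].
  split=> [|N /andP[N0 N1] /(functional_norm_le N0)].
    by apply/functional_norm_le => //; rewrite h.
  by rewrite h lee_fin leNgt N1.
have s1 : (functional_norm (MQ Z) Pi <= 1%:E)%E by apply/functional_norm_le.
have s0 : (0 <= functional_norm (MQ Z) Pi)%E.
  apply: le_trans (_ : 0 <= (normc (Pi (fun=> 0)))%:E)%E _; first by rewrite lee_fin normc_ge0.
  apply: ereal_sup_ubound; exists (fun=> 0) => //; split; first exact/MQ_conj_QZ/conj_QZ_0.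
  rewrite /L1norm (eq_integral (cst 0%E)) ?integral0 ?lee_fin ?ler01// => x _.
  by congr EFin; apply/eqP; rewrite normc_eq0.
apply/eqP; rewrite eq_le s1 /= leNgt; apply/negP => slt.
have fs : functional_norm (MQ Z) Pi \is a fin_num by rewrite ge0_fin_numE// (lt_trans slt)// ltry.
apply: (hN (fine (functional_norm (MQ Z) Pi))).
  by rewrite fine_ge0//= -lte_fin fineK.
by apply/functional_norm_le; rewrite ?fine_ge0// fineK.
Qed.

(** By [interpolable_bounded], a bound N < 1 for Pi amounts to an interpolant of norm below 1, its
    own norm serving as N. *)
Lemma solves_sharp : solves_extremal_problem Z W <-> sharp.
Proof.
have Hle (phi : Cn -> R[i]) N : (forall z, cnorm z < 1 -> normc (phi z) <= N) -> (Hinf_norm phi <= N%:E)%E.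
  by move=> h; apply: ge_ereal_sup => _ [z z1 <-]; rewrite lee_fin h.
have Hge (phi : Cn -> R[i]) N : (Hinf_norm phi <= N%:E)%E -> forall z, cnorm z < 1 -> normc (phi z) <= N.
  move=> h z z1; rewrite -lee_fin; apply: le_trans h.
  by apply: ereal_sup_ubound; exists z.
have schurP (phi : Cn -> R[i]) N : N <= 1 -> analytic_on_ball phi -> (Hinf_norm phi <= N%:E)%E -> schur_class phi.
  move=> N1 ap hp; have p1 : (Hinf_norm phi <= 1)%E by apply: le_trans hp _; rewrite lee_fin.
  by split => //; split => //; apply: le_lt_trans p1 _; exact: ltry.
split=> [[[phi [[[ap _] p1] pW]] uniq]|[h1 hN]].
  split; first by apply/(interpolable_bounded ler01); exists phi; split => //; exact: Hge.
  move=> N /andP[N0 N1] /(interpolable_bounded N0)[xi [axi xiN xiW]].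
  have := uniq xi (schurP _ _ (ltW N1) axi (Hle _ _ xiN)) xiW => hxi.
  by have := Hle _ _ xiN; rewrite hxi lee_fin leNgt N1.
split.
  have [phi [ap pN pW]] := (interpolable_bounded ler01).2 h1.
  by exists phi; split => //; apply: (schurP _ 1) => //; exact: Hle.
move=> phi [[ap _] p1] pW; apply/eqP; rewrite eq_le p1 /= leNgt; apply/negP => plt.
have p0 : (0 <= Hinf_norm phi)%E.
  apply: le_trans (_ : 0 <= (normc (phi 0))%:E)%E _; first by rewrite lee_fin normc_ge0.
  by apply: ereal_sup_ubound; exists 0 => //; rewrite /unit_ball /= cnorm0.
have fp : Hinf_norm phi \is a fin_num by rewrite ge0_fin_numE// (lt_trans plt)// ltry.
have f0 : 0 <= fine (Hinf_norm phi) by rewrite fine_ge0.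
apply: (hN (fine (Hinf_norm phi))); first by rewrite f0 /= -lte_fin fineK.
by apply/(interpolable_bounded f0); exists phi; split => //; apply: Hge; rewrite fineK.
Qed.

Section distance.
Variable u : Cn -> R[i].
Hypothesis uQ : conj_set (QZ Z) u.
Hypothesis Pu : Pi u = 1.

Let lu : L2 u. Proof. exact/(MQ_L2 n0 Zball)/MQ_conj_QZ. Qed.

Let MQ_tilde_MQ g : MQ_tilde Z W g -> MQ Z g /\ Pi g = 0.
Proof.
move=> [q [qQ q0] [r hr <-]]; split; first by exists q => //; exists r.
have lq : L2 q by exact/(MQ_L2 n0 Zball)/MQ_conj_QZ.
have lr : L2 r by exact/(MQ_L2 n0 Zball)/MQ_MS_H20.
have := PiZW_lin W n0 Zball 1 lq lr; rewrite (PiZW_MS_H20 W n0 Zball hr) addr0 mul1r.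
rewrite (_ : (fun z => 1 * q z + r z) = fun z => q z + r z); last first.
  by apply/funext => z; rewrite mul1r.
move=> ->; rewrite -(q0 _ erefl); apply: eq_sphere_integral => z _.
by rewrite /psiZW_conj conjCK mulrC.
Qed.

(** Up to scalars, the f in M_Q with Pi f nonzero are the u - g with g in the kernel of Pi. There Pi
    takes the value 1, so a bound N reads 1 <= N |u - g|. *)
Lemma PiZW_bounded_dist N :
  PiZW_bounded N <-> forall g, MQ_tilde Z W g -> 1 <= N * fine (L1norm (fun z => u z - g z)).
Proof.
split=> [hN g hg|h f hf].
  have [gM Pg] := MQ_tilde_MQ hg; have lg := MQ_L2 n0 Zball gM.
  have hug := MQ_lin (-1) gM (MQ_conj_QZ uQ).
  have E : (fun z => -1 * g z + u z) = fun z => u z - g z by apply/funext => z; ring.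
  have := hN _ hug; rewrite (PiZW_lin W n0 Zball (-1) lg lu) Pg mulr0 add0r Pu normc1.
  by rewrite E.
have lf := MQ_L2 n0 Zball hf; have [mf _] := L2_integrableS lf.
pose c := Pi f; have [c0|c0] := eqVneq c 0.
  have -> : Pi f = 0 by []. 
  (* A negative N is excluded by taking g = 0. *)
  rewrite normc0; have [N0|N0] := leP 0 N; first by rewrite mulr_ge0.
  exfalso; have gt : MQ_tilde Z W (fun=> 0).
    apply: add_set0l; first by split; [exact: conj_QZ_0|move=> g _; exact: L2ip0l].
    by apply: add_set0l; [exact: MS_0|exact: H20_0].
  have := h _ gt; have := fine_L1norm_ge0 (fun z => u z - 0).
  by move=> p0 /le_trans/(_ (mulr_le0_ge0 (ltW N0) p0)); rewrite ler10.
have [q qQ [r hr fE]] := hf.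
have lq : L2 q by exact/(MQ_L2 n0 Zball)/MQ_conj_QZ.
have lr : L2 r by exact/(MQ_L2 n0 Zball)/MQ_MS_H20.
have Pq : Pi q = c.
  have := PiZW_lin W n0 Zball 1 lq lr; rewrite (PiZW_MS_H20 W n0 Zball hr) addr0 mul1r => <-.
  by rewrite /c; congr (Pi _); rewrite -fE; apply/funext => z; rewrite mul1r.
(* This is u - f / c, split along the decomposition of f so that its part in conj Q_Z is orthogonal
   to conj psi. *)
pose g := fun z => (- c^-1 * q z + u z) + (- c^-1 * r z + 0).
have hg : MQ_tilde Z W g.
  exists (fun z => - c^-1 * q z + u z).
    split; first exact: conj_QZ_lin.
    move=> _ ->; transitivity (Pi (fun z => - c^-1 * q z + u z)).
      by apply: eq_sphere_integral => z _; rewrite /psiZW_conj conjCK mulrC.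
    by rewrite (PiZW_lin W n0 Zball _ lq lu) Pq Pu mulNr mulVf// addNr.
  exists (fun z => - c^-1 * r z + 0) => //.
  by apply: MS_H20_lin => //; apply: add_set0l; [exact: MS_0|exact: H20_0].
have := h g hg.
have -> : L1norm (fun z => u z - g z) = L1norm (fun z => c^-1 * f z).
  by apply: eq_L1norm => z _; rewrite /g -fE; ring.
have -> : fine (L1norm (fun z => c^-1 * f z)) = normc c^-1 * fine (L1norm f).
  by rewrite L1normZ// [in LHS](L1norm_fin lf) -EFinM.
move=> h1.
have cn : 0 < normc c by rewrite normc_gt0.
have ci : normc c * normc c^-1 = 1 by rewrite -normcM mulfV// normc1.
have := ler_wpM2l (ltW cn) h1; rewrite mulr1 => /le_trans; apply.
by rewrite mulrCA [normc c * _]mulrA ci mul1r.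
Qed.

Lemma distL1_sharp : distL1 u (MQ_tilde Z W) = 1%E <-> sharp.
Proof.
have lug g : MQ_tilde Z W g -> L2 (fun z => u z - g z).
  by move=> /MQ_tilde_MQ[/(MQ_L2 n0 Zball) lg _]; exact: L2B.
have t0 : MQ_tilde Z W (fun=> 0).
  apply: add_set0l; first by split; [exact: conj_QZ_0|move=> g _; exact: L2ip0l].
  by apply: add_set0l; [exact: MS_0|exact: H20_0].
have distP N : 0 < N -> ((N^-1)%:E <= distL1 u (MQ_tilde Z W))%E <-> PiZW_bounded N.
  move=> N0; rewrite PiZW_bounded_dist; split=> [h g hg|h].
    have : ((N^-1)%:E <= L1norm (fun z => u z - g z)%R)%E.
      by apply: le_trans h _; apply: ereal_inf_lbound; exists g.
    by rewrite (L1norm_fin (lug _ hg)) lee_fin -ler_pdivrMl// mulr1.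
  apply: le_ereal_inf_tmp => _ [g hg <-].
  by rewrite (L1norm_fin (lug _ hg)) lee_fin -[N^-1]mulr1 ler_pdivrMl// h.
(* The value N = 0 has no reciprocal to compare with the distance and is treated apart. *)
have d0 : ~ PiZW_bounded 0.
  by move/PiZW_bounded_dist/(_ _ t0); rewrite mul0r ler10.
split=> [h|[h1 hN]].
  split; first by apply/(distP 1 ltr01); rewrite h invr1.
  move=> N /andP[N0 N1]; have [->//|Nn0] := eqVneq N 0.
  have Np : 0 < N by rewrite lt_neqAle eq_sym Nn0.
  move/(distP N Np); rewrite h lee_fin => h2.
  by have : 1 < N^-1 by [rewrite invf_gt1]; rewrite ltNge h2.
have d1 : (1 <= distL1 u (MQ_tilde Z W))%E by have := (distP 1 ltr01).2 h1; rewrite invr1.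
apply/eqP; rewrite eq_le d1 andbT leNgt; apply/negP => dlt.
have dfin : distL1 u (MQ_tilde Z W) \is a fin_num.
  rewrite ge0_fin_numE; last by apply: le_trans d1; rewrite lee_fin.
  apply: (@le_lt_trans _ _ (L1norm (fun z => u z - 0))).
    by apply: ereal_inf_lbound; exists (fun=> 0).
  by rewrite (L1norm_fin (lug _ t0)) ltry.
pose D := fine (distL1 u (MQ_tilde Z W)).
have D1 : 1 < D by rewrite -lte_fin fineK.
have D0 : 0 < D by apply: lt_trans D1.
apply: (hN D^-1); first by rewrite invr_ge0 (ltW D0) invf_lt1.
by apply/distP; rewrite ?invr_gt0// invrK fineK.
Qed.

End distance.

End duality.

Theorem theorem8 (R : realType) (n m : nat)
    (Z : 'I_m -> 'rV[R[i]]_n) (W : 'I_m -> R[i]) :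
  (0 < n)%N -> (1 < m)%N ->
  injective Z -> (forall i, unit_ball R n (Z i)) ->
  (forall i, normc (W i) < 1) -> (exists i, W i != 0) ->
  [<-> solves_extremal_problem Z W;
       functional_norm (MQ Z) (PiZW Z W) = 1%E;
       distL1 (fun z => ((L2norm (psiZW Z W) ^+ 2)^-1)%:C * (psiZW Z W z)^*)
              (MQ_tilde Z W) = 1%E;
       distL1 (fun z => ((\sum_i normc (W i) ^+ 2)^-1)%:C *
                        \sum_j (W j)^* * (szego z (Z j))^*)
              (MQ_tilde Z W) = 1%E ].
Proof.
move=> n0 m1 Zinj Zball W1 [i0 Wi0].
have psiQ := QZ_psiZW Z W; have bp := ball_alg_QZ n0 Zball psiQ.
have lp := bdm_L2 bp.1; have lcp := L2_conj lp.
set u3 := (fun z => ((L2norm _ ^+ 2)^-1)%:C * _).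
set u4 := (fun z => _%:C * \sum_j _).
have conjr (x : R) : (x%:C)^* = x%:C by exact: conjc_real.
have QZZ (x : R) q : QZ Z q -> conj_set (QZ Z) (fun z => x%:C * (q z)^*).
  move=> [c ->]; exists (fun z => \sum_j (x%:C * c j) * szego z (Z j)).
    by exists (fun j => x%:C * c j).
  apply/funext => z; rewrite -[x%:C in RHS]conjr -rmorphM; congr (_^*).
  by rewrite mulr_sumr; apply: eq_bigr => j _; rewrite mulrA.
(* By the reproducing property, norm 0 would force psi to vanish at Z i0, where its value is W
   i0. *)
have psi0 : L2norm (psiZW Z W) != 0.
  apply/eqP => h; move: Wi0; rewrite -(psiZW_interpolates n0 Zball Zinj W i0).
  rewrite -(reproducing n0 bp (Zball i0)) -normc_eq0 eq_le normc_ge0 andbT => /negP; apply.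
  by apply: le_trans (L2ip_bound lp (bdm_L2 (bdm_szego (Zball i0)))) _; rewrite h mul0r.
have u3Q : conj_set (QZ Z) u3 by exact: QZZ.
have Pu3 : PiZW Z W u3 = 1.
  rewrite /PiZW (eq_sphere_integral (g := fun z => ((L2norm (psiZW Z W) ^+ 2)^-1)%:C *
    (psiZW Z W z * (psiZW Z W z)^*))); last by move=> z _; rewrite mulrCA.
  rewrite sphere_integralZ; last exact: integrableSM.
  by rewrite [X in _ * X](L2ip_self lp) -realcM mulVf// expf_neq0.
pose q4 z := \sum_j W j * szego z (Z j).
have q4Q : QZ Z q4 by exists W.
have u4E : u4 = fun z => ((\sum_i normc (W i) ^+ 2)^-1)%:C * (q4 z)^*.
  apply/funext => z; rewrite /u4 /q4 rmorph_sum; congr (_ * _); apply: eq_bigr => j _.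
  by rewrite rmorphM.
have u4Q : conj_set (QZ Z) u4 by rewrite u4E; exact: QZZ.
have W0 : \sum_i normc (W i) ^+ 2 != 0.
  rewrite gt_eqF// (bigD1 i0)//= ltr_pwDl ?exprn_gt0 ?normc_gt0//.
  by apply: sumr_ge0 => i _; exact: sqr_ge0.
(* Pairing psi with the conjugate of a combination of kernels evaluates psi at the points Z j, which
   produces the sum of |W j|^2. *)
have Pu4 : PiZW Z W u4 = 1.
  have lq := L2_conj (bdm_L2 (ball_alg_QZ n0 Zball q4Q).1).
  rewrite u4E /PiZW (eq_sphere_integral (g := fun z => ((\sum_i normc (W i) ^+ 2)^-1)%:C *
    (psiZW Z W z * (q4 z)^*))); last by move=> z _; rewrite mulrCA.
  rewrite sphere_integralZ; last exact: integrableSM.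
  rewrite (sphere_integral_QZ n0 Zball W bp) (eq_bigr (fun j => (normc (W j) ^+ 2)%:C)); last first.
    by move=> j _; rewrite psiZW_interpolates// mulrC mulc_conj.
  by rewrite -rmorph_sum -realcM mulVf.
have e1 := solves_sharp W n0 Zinj Zball.
have e2 := functional_norm_sharp W n0 Zball.
have e3 := distL1_sharp n0 Zball u3Q Pu3.
have e4 := distL1_sharp n0 Zball u4Q Pu4.
tfae.
- by move/e1/e2.
- by move/e2/e3.
- by move/e3/e4.
- by move/e4/e1.
Qed.
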